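(* Let $\Omega\subset\mathbb{R}^d$ be a non-empty, bounded, open set and $\Phi\colon\mathbb{R}^N_+\to[0,\infty)$. Then $\mathscr{L}^{\Phi,N}_{1,1}(\Omega)\ge\Lambda^{\Phi,N}_{1,1}(\Omega)$. If $\Phi$ satisfies (Φ.3), then $\mathscr{L}^{\Phi,N}_{1,1}(\Omega)=\Lambda^{\Phi,N}_{1,1}(\Omega)$; moreover, if $u$ is a $(1,\Phi)$-eigen-$N$-function of $\Omega$ then $(\{u_1>0\},\dots,\{u_N>0\})$ is a $(1,\Phi)$-eigen-$N$-set of $\Omega$, and conversely, if $\mathcal E$ is a $(1,\Phi)$-eigen-$N$-set of $\Omega$, there exists a $(1,\Phi)$-eigen-$N$-function $u$ of $\Omega$ with $\{u_i>0\}\subset\mathcal E_i$ for all $i$.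
   Context: All sets are Lebesgue measurable; inclusions/disjointness up to null sets; $|E|$ Lebesgue measure, $P(E)$ perimeter. $h(F)=\inf\{P(E)/|E|: E\subset F, |E|>0\}$. An $N$-set of $F$ is $\mathcal E=(\mathcal E_1,\dots,\mathcal E_N)$ with $\mathcal E_i\subset F$, $|\mathcal E_i|>0$, $|\mathcal E_i\cap\mathcal E_j|=0$ for $i\ne j$. $\mathscr{L}^{\Phi,N}_{1,1}(F)=\inf\{\Phi(h(\mathcal E_1),\dots,h(\mathcal E_N)): \mathcal E \text{ an } N\text{-set of } F\}$; minimizers are $(1,\Phi)$-eigen-$N$-sets. $BV_0(F)=\{u\in BV(\mathbb{R}^d): u=0\text{ a.e. on }\mathbb{R}^d\setminus F\}$. A $(1,N)$-function of $F$ is $u=(u_1,\dots,u_N)$ with $u_i\in BV_0(F)$, $u_i\ge0$, $\|u_i\|_{L^1}=1$, $u_iu_j=0$ a.e. for $i\ne j$; $[u]_1=(|Du_1|(\mathbb{R}^d),\dots,|Du_N|(\mathbb{R}^d))$. $\Lambda^{\Phi,N}_{1,1}(F)=\inf\{\Phi([u]_1)\}$ over $(1,N)$-functions of $F$; minimizers are $(1,\Phi)$-eigen-$N$-functions. $\mathbb{R}^N_+$ has componentwise order; (Φ.3): $v\le w\Rightarrow\Phi(v)\le\Phi(w)$. *)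

(* Defs.v *)
From HB Require Import structures.
From mathcomp Require Import all_boot all_order all_algebra.
From mathcomp Require Import all_classical all_reals all_analysis.
Set Implicit Arguments. Unset Strict Implicit. Unset Printing Implicit Defensive.
Import Order.TTheory GRing.Theory Num.Theory.
Import numFieldNormedType.Exports.
Local Open Scope classical_set_scope.
Local Open Scope ring_scope.

(* Lebesgue measure on R^d = 'rV[R]_d, built as the Caratheodory      *)
(* restriction of the Lebesgue outer measure                           *)
(*    |A|^* = inf { sum_k vol(B_k) : A ⊆ ⋃_k B_k, B_k closed boxes }.  *)
(* We use mathcomp-analysis' mu_ext on the sigma-algebra of all sets, *)
(* with the premeasure vol on closed boxes, 0 on set0, +oo elsewhere.  *)

Section Lebesgue_Rd.
Variables (R : realType) (d : nat).

Definition allsets : measurableType _ :=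
  g_sigma_algebraType (@setT (set 'rV[R]_d)).

Definition box (a b : 'rV[R]_d) : set 'rV[R]_d :=
  [set x | forall i, a 0 i <= x 0 i <= b 0 i].

Definition box_vol (a b : 'rV[R]_d) : R :=
  \prod_(i < d) Num.max 0 (b 0 i - a 0 i).

Definition box_premeasure (A : set allsets) : \bar R :=
  if pselect (A = set0) then 0%E
  else ereal_inf [set x | exists a b, A = box a b /\ x = (box_vol a b)%:E].

Lemma box_premeasure0 : box_premeasure set0 = 0%E.
Proof. by rewrite /box_premeasure; case: pselect. Qed.

Lemma box_premeasure_ge0 A : (0 <= box_premeasure A)%E.
Proof.
rewrite /box_premeasure; case: pselect => [//|nA].
apply: le_ereal_inf_tmp =>  y [a0 [b0 [_ yE]]].
rewrite yE lee_fin.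
by apply: prodr_ge0 => i _; rewrite le_max lexx.
Qed.

Definition lebesgue_outer : set allsets -> \bar R :=
  mu_ext box_premeasure.

HB.instance Definition _ := isOuterMeasure.Build R allsets lebesgue_outer
  (mu_ext0 box_premeasure0 box_premeasure_ge0)
  (mu_ext_ge0 box_premeasure_ge0)
  (le_mu_ext box_premeasure)
  (mu_ext_sigma_subadditive box_premeasure_ge0).

Definition Ld := caratheodory_type lebesgue_outer.

End Lebesgue_Rd.

Notation leb R d := (@lebesgue_outer R d : set (Ld R d) -> \bar R).

Section BV.
Variables (R : realType) (d : nat).
Local Notation lam := (leb R d).

Definition subae (E F : set (Ld R d)) : Prop := lam (E `\` F) = 0%E.

Definition ebasis (j : 'I_d) : 'rV[R]_d := delta_mx 0 j.

Definition Cc1_field (phi : 'I_d -> 'rV[R]_d -> R) : Prop :=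
  [/\ (forall i j x, derivable (phi i) x (ebasis j)),
      (forall i j, continuous (fun x => 'D_(ebasis j) (phi i) x)) &
      exists K : set 'rV[R]_d, compact K /\ forall i x, ~ K x -> phi i x = 0].

Definition divergence (phi : 'I_d -> 'rV[R]_d -> R) (x : 'rV[R]_d) : R :=
  \sum_(i < d) 'D_(ebasis i) (phi i) x.

Definition admissible_field (phi : 'I_d -> 'rV[R]_d -> R) : Prop :=
  Cc1_field phi /\ forall x, \sum_(i < d) (phi i x) ^+ 2 <= 1.

Definition total_variation (u : 'rV[R]_d -> R) : \bar R :=
  ereal_sup [set (\int[lam]_x (u x * divergence phi x)%:E)%E
            | phi in admissible_field].

Definition perimeter (E : set (Ld R d)) : \bar R :=
  total_variation (fun x => \1_E x).

Definition cheeger (F : set (Ld R d)) : \bar R :=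
  ereal_inf [set (perimeter E * (lam E)^-1)%E
            | E in [set E | measurable E /\ subae E F /\ (0 < lam E)%E]].

Definition is_Nset (N : nat) (F : set (Ld R d)) (E : 'I_N -> set (Ld R d))
  : Prop :=
  (forall i, [/\ measurable (E i), subae (E i) F & (0 < lam (E i))%E]) /\
  (forall i j, i != j -> lam (E i `&` E j) = 0%E).

(* Φ(h(E_1),...,h(E_N)), defined when all h(E_i) are finite *)
Definition Phi_h (N : nat) (Phi : ('I_N -> R) -> R) (E : 'I_N -> set (Ld R d))
  : R := Phi (fun i => fine (cheeger (E i))).

Definition admissible_Nset N (F : set (Ld R d)) (E : 'I_N -> set (Ld R d)) :=
  is_Nset F E /\ forall i, cheeger (E i) \is a fin_num.

Definition LPhi N (Phi : ('I_N -> R) -> R) (F : set (Ld R d)) : \bar R :=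
  ereal_inf [set (Phi_h Phi E)%:E | E in admissible_Nset F].

Definition eigen_Nset N (Phi : ('I_N -> R) -> R) (F : set (Ld R d))
  (E : 'I_N -> set (Ld R d)) : Prop :=
  admissible_Nset F E /\ (Phi_h Phi E)%:E = LPhi Phi F.

Definition BV (u : 'rV[R]_d -> R) : Prop :=
  [/\ measurable_fun [set: Ld R d] (u : Ld R d -> R),
      lam.-integrable [set: Ld R d] (fun x => (u x)%:E) &
      (total_variation u < +oo)%E].

Definition BV0 (F : set (Ld R d)) (u : 'rV[R]_d -> R) : Prop :=
  BV u /\ {ae lam, forall x : Ld R d, ~ F x -> u x = 0}.

Definition is_1N_function N (F : set (Ld R d)) (u : 'I_N -> 'rV[R]_d -> R)
  : Prop :=
  [/\ (forall i, BV0 F (u i)),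
      (forall i x, 0 <= u i x),
      (forall i, (\int[lam]_x `|u i x|%:E)%E = 1%E) &
      (forall i j, i != j -> {ae lam, forall x : Ld R d, u i x * u j x = 0})].

Definition bracket1 N (u : 'I_N -> 'rV[R]_d -> R) : 'I_N -> R :=
  fun i => fine (total_variation (u i)).

Definition LambdaPhi N (Phi : ('I_N -> R) -> R) (F : set (Ld R d)) : \bar R :=
  ereal_inf [set (Phi (bracket1 u))%:E | u in is_1N_function F].

Definition eigen_Nfunction N (Phi : ('I_N -> R) -> R) (F : set (Ld R d))
  (u : 'I_N -> 'rV[R]_d -> R) : Prop :=
  is_1N_function F u /\ (Phi (bracket1 u))%:E = LambdaPhi Phi F.

Definition Phi_monotone N (Phi : ('I_N -> R) -> R) : Prop :=
  forall v w : 'I_N -> R, (forall i, 0 <= v i) -> (forall i, v i <= w i) ->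
    Phi v <= Phi w.

End BV.

(* Main.v *)
(** Both infima are compared set by set through the Cheeger constant.

    If [w >= 0] has integral [1], then [h({w > 0}) <= |Dw|(R^d)].  Writing
    [g t = |D (w - t)^+|] and [m t] for the integral of [(w - t)^+], the
    inequality [|D min(u, s)| + |D (u - s)^+| <= |Du|] (mollify, then truncate
    smoothly) and the lower semicontinuity of the variation give, when every
    subset [E] of [{w > 0}] satisfies [P(E) >= h |E|], the bound
    [g t + h (m 0 - m t) <= g 0] by a continuation argument in [t]; let [t] tend
    to infinity.  So the supports of an N-function form an N-set which is at
    least as good, and (Phi.3) applies.

    Conversely [h(E)] is attained by some [w] vanishing off [E].  Sets [G] with
    [P(G) <= M |G|] have measure bounded below, by the isoperimetric inequality,
    so the normalised indicators of near-optimal subsets of [E] are bounded in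
    [L^2].  Functions of nearly minimal [L^2]-norm in the convex sets
    [{w : w = 0 off E, w >= 0, \int w = 1, |Dw| <= h(E) + eps}] are Cauchy by the
    parallelogram law, and their [L^1]-limit as [eps] tends to [0] is the desired
    [w], again by lower semicontinuity. *)

(* The continuation in [t] replaces an integration of perimeters over all levels. Moving to the
   right needs a strict gap: [h] is taken strictly below the Cheeger constant, so one test field
   [phi] certifies P({w > t}) > h |{w > t}|, and it still does so for min((w - t)^+, dl) / dl with
   some small dl. Limits from the left are lower semicontinuity. The truncation inequality is
   convexity of the unit ball: if 0 <= F' <= 1, then F'(u) phi + (1 - F'(u)) psi is again an
   admissible field. Near-optimal sets need not converge, and L^1 is not uniformly convex; the L^2
   norm is what selects a Cauchy sequence among almost optimal functions. The bound from below on
   |G| is |G| - c d s <= K |G|^2 when P(G) <= c, where K bounds a mollifier supported in the cube of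
   radius s: a translation by y costs at most c |y|_1 in the correlation of 1_G with itself, and the
   average of this correlation against the mollifier is at most K |G|^2. Mollifiers are built under
   the hypothesis that some set has positive measure; positivity of cubes, hence of the integral of
   the kernel, follows from it. *)
Require Import Defs.
From HB Require Import structures.
From mathcomp Require Import all_boot all_order all_algebra.
From mathcomp Require Import all_classical all_reals all_analysis.
From mathcomp Require Import measurable_realfun ring lra.
Set Implicit Arguments. Unset Strict Implicit. Unset Printing Implicit Defensive.
Import Order.TTheory GRing.Theory Num.Theory.
Import numFieldNormedType.Exports.
Local Open Scope classical_set_scope.
Local Open Scope ring_scope.

(** * Lebesgue measure on R^d *)

Section lebesgue_outer_theory.
Variables (R : realType) (d : nat).
Local Notation V := 'rV[R]_d.
Local Notation outer := (@lebesgue_outer R d).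
Local Notation prem := (@box_premeasure R d).
Implicit Types (a b x y : V) (A : set V) (i : 'I_d).

Lemma box_vol_ge0 a b : 0 <= box_vol a b.
Proof. by apply: prodr_ge0 => i _; rewrite le_max lexx. Qed.

Lemma box_premeasure_box_le a b : (prem (box a b) <= (box_vol a b)%:E)%E.
Proof.
rewrite /box_premeasure; case: pselect => ?.
  by rewrite lee_fin box_vol_ge0.
by apply: ereal_inf_lbound; exists a, b.
Qed.

Lemma lebesgue_outer_le_premeasure A : (outer A <= prem A)%E.
Proof.
apply: ereal_inf_lbound.
exists (fun k : nat => if k == 0%N then A : set (allsets R d) else set0).
  split=> [k|x Ax]; last by exists 0%N.
  exact: sub_gen_smallest.
rewrite nneseries_recl//; last by move=> k _; exact: box_premeasure_ge0.
rewrite eseries0 ?adde0// => k k0 _; case: k k0 => // k _.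
exact: box_premeasure0.
Qed.

(** This gives finiteness for cubes and nullity for the faces of a box; positivity of cubes is the
    matter of [cube_gt0]. *)
Lemma lebesgue_outer_box_le a b : (outer (box a b) <= (box_vol a b)%:E)%E.
Proof.
exact: (le_trans (lebesgue_outer_le_premeasure _) (box_premeasure_box_le _ _)).
Qed.

Lemma lebesgue_outer_coverP A (c : \bar R) : (outer A < c)%E ->
  exists2 C : nat -> set V, A `<=` \bigcup_k C k &
    (\sum_(k <oo) prem (C k) < c)%E.
Proof.
by move=> /ereal_inf_lt[_ [C [_ AC] <-]] Cc; exists C.
Qed.

Lemma box_premeasure_fin (C : set V) : (prem C < +oo)%E ->
  C = set0 \/ exists a b, C = box a b.
Proof.
rewrite /box_premeasure; case: pselect => C0; first by left.
by move=> /ereal_inf_lt[_ [a [b [-> _]]] _]; right; exists a, b.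
Qed.

Lemma lebesgue_outer_le_map (T : V -> V) A :
  (forall C, (prem (T @^-1` C) <= prem C)%E) ->
  (outer (T @^-1` A) <= outer A)%E.
Proof.
move=> hT; apply: le_ereal_inf_tmp => _ [C [_ AC] <-].
apply: (@le_trans _ _ (\sum_(k <oo) prem (T @^-1` C k))%E).
  apply: ereal_inf_lbound; exists (fun k => T @^-1` C k) => //.
  split=> [k|x /AC[k _ ?]]; last by exists k.
  exact: sub_gen_smallest.
by apply: lee_nneseries => // k *; exact: box_premeasure_ge0.
Qed.

Lemma preimage_shift_box a b y :
  (fun x => x + y) @^-1` (box a b) = box (a - y) (b - y).
Proof.
by apply/seteqP; split => x /= h i; move: (h i); rewrite !mxE; lra.
Qed.

Lemma box_vol_shift a b y : box_vol (a - y) (b - y) = box_vol a b.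
Proof.
by apply: eq_bigr => i _; rewrite !mxE; congr Num.max; lra.
Qed.

Lemma box_premeasure_shift_le (C : set V) y :
  (prem ((fun x => x + y)%R @^-1` C) <= prem C)%E.
Proof.
rewrite {2}/box_premeasure; case: pselect => C0 /=; first rewrite C0.
  by rewrite preimage_set0 box_premeasure0.
apply: le_ereal_inf_tmp => _ [a [b [-> ->]]].
by rewrite preimage_shift_box -(box_vol_shift a b y) box_premeasure_box_le.
Qed.

Lemma lebesgue_outer_shift A y : outer ((fun x => x + y) @^-1` A) = outer A.
Proof.
apply/eqP; rewrite eq_le; apply/andP; split.
  by apply: lebesgue_outer_le_map => C; exact: box_premeasure_shift_le.
rewrite [leLHS](_ : _ = outer ((fun x => x - y) @^-1` ((fun x => x + y) @^-1` A))).
  by apply: lebesgue_outer_le_map => C; exact: box_premeasure_shift_le.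
congr outer; apply/seteqP; split => x /=; by rewrite subrK.
Qed.

Definition halfspace i (c : R) : set V := [set x | x 0 i <= c].

(** The truncation at 0 in [box_vol] keeps the identity valid when the hyperplane misses the box:
    one of the two factors is then 0. *)
Lemma box_vol_split a b i c :
  box_vol a (\row_j if j == i then Num.min (b 0 i) c else b 0 j) +
  box_vol (\row_j if j == i then Num.max (a 0 i) c else a 0 j) b = box_vol a b.
Proof.
rewrite /box_vol (bigD1 i)//= [X in _ + X](bigD1 i)//= [RHS](bigD1 i)//=.
rewrite !mxE eqxx.
under eq_bigr => j ji do rewrite mxE (negbTE ji).
under [X in _ + _ * X]eq_bigr => j ji do rewrite mxE (negbTE ji).
rewrite -mulrDl; congr (_ * _).
rewrite /Num.max /Num.min; repeat case: ifPn; rewrite -?leNgt; lra.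
Qed.

Lemma halfspace_premeasure i c C :
  (outer (C `&` halfspace i c) + outer (C `&` ~` halfspace i c) <= prem C)%E.
Proof.
rewrite /box_premeasure; case: pselect => C0 /=; first rewrite C0.
  by rewrite !set0I outer_measure0 adde0.
apply: le_ereal_inf_tmp => _ [a [b [-> ->]]].
rewrite -(box_vol_split a b i c) EFinD; apply: leeD.
  apply: le_trans (lebesgue_outer_box_le _ _); apply: le_outer_measure.
  move=> x [/= xab xc] j; rewrite !mxE; case: eqP => [->|_]; last exact: xab.
  by rewrite le_min xc; have /andP[-> ->] := xab i.
apply: le_trans (lebesgue_outer_box_le _ _); apply: le_outer_measure.
move=> x [/= xab /negP]; rewrite -ltNge => xc j; rewrite !mxE.
case: eqP => [->|_]; last exact: xab.
by rewrite ge_max (ltW xc); have /andP[-> ->] := xab i.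
Qed.

(** Countable subadditivity reduces the test on an arbitrary set to the members of a cover, and a
    coordinate hyperplane cuts a box into two boxes whose volumes add up. *)
Lemma caratheodory_halfspace i c :
  caratheodory_measurable outer (halfspace i c).
Proof.
apply: le_caratheodory_measurable => X.
apply: le_ereal_inf_tmp => _ [C [_ XC] <-].
apply: (@le_trans _ _ (\sum_(k <oo) (outer (C k `&` halfspace i c) +
    outer (C k `&` ~` halfspace i c)))%E); last first.
  apply: lee_nneseries => [k _ _|k _]; last exact: halfspace_premeasure.
  by rewrite adde_ge0// outer_measure_ge0.
rewrite nneseriesD; [|by move=> *; exact: outer_measure_ge0..].
by apply: leeD;
  apply: (le_trans _ (outer_measure_sigma_subadditive _ _));
  apply: le_outer_measure; rewrite -setI_bigcupl; exact: setSI.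
Qed.

Lemma measurable_halfspace i c : measurable (halfspace i c : set (Ld R d)).
Proof. exact: caratheodory_halfspace. Qed.

Lemma measurable_coord i :
  measurable_fun [set: Ld R d] (fun x : Ld R d => x 0 i).
Proof.
move=> mD; apply: (measurability _ (RGenOInfty.measurableE R)) => //.
move=> /= _ [_ [c ->] <-]; rewrite preimage_itvoy setTI.
rewrite (_ : mkset _ = ~` (halfspace i c : set (Ld R d))).
  by apply: measurableC; exact: measurable_halfspace.
by apply/seteqP; split => x /=; rewrite /halfspace /= ltNge => /negP.
Qed.

(** An open set is the union of the countably many boxes with rational corners that it contains. The
    map [S] is general so that the result also covers (x, y) -> x - y and (x, y) -> x + y on the
    product space. *)
Lemma measurable_open_preimage dT (T : measurableType dT) (S : T -> V) (U : set V) :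
  (forall i, measurable_fun [set: T] (fun t => S t 0 i)) -> open U ->
  measurable (S @^-1` U).
Proof.
move=> mS oU.
pose Q := 'rV[rat]_d; pose r (q : Q) : V := map_mx (@ratr R) q.
have mbox a b : measurable (S @^-1` box a b).
  rewrite (_ : S @^-1` box a b = \bigcap_(i in [set: 'I_d])
    ((fun t => S t 0 i) @^-1` `[a 0 i, b 0 i])).
    apply: fin_bigcap_measurable => // i _; rewrite -[X in measurable X]setTI.
    by apply: mS => //; exact: measurable_itv.
  apply/seteqP; split => x h i; first by move=> _ /=; rewrite in_itv /=; exact: h.
  by have := h i Logic.I; rewrite /= in_itv.
rewrite (_ : S @^-1` U = \bigcup_(pq in [set: Q * Q])
    (if pselect (box (r pq.1) (r pq.2) `<=` U) then S @^-1` box (r pq.1) (r pq.2)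
     else set0)).
  apply: countable_bigcupT_measurable => [|pq]; first exact: countableP.
  by case: pselect => ?; [exact: mbox|exact: measurable0].
apply/seteqP; split=> [t Ut|t [pq _]]; last by case: pselect => // h /h.
have /nbhs_ballP[e /= e0 eU] : nbhs (S t) U by exact: open_nbhs_nbhs.
set x := S t in Ut eU.
have hp i : exists q : rat, x 0 i - e < ratr q <= x 0 i.
  have [|q] := @rat_in_itvoo R (x 0 i - e) (x 0 i); first lra.
  by rewrite in_itv/= => /andP[q1 q2]; exists q; rewrite q1 ltW.
have hq i : exists q : rat, x 0 i <= ratr q < x 0 i + e.
  have [|q] := @rat_in_itvoo R (x 0 i) (x 0 i + e); first lra.
  by rewrite in_itv/= => /andP[q1 q2]; exists q; rewrite q2 ltW.
have [p hp'] := choice hp; have [q hq'] := choice hq.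
exists (\row_i p i, \row_i q i) => //; case: pselect => [?|] /=; rewrite /r.
  by move=> i; rewrite !mxE; have /andP[_ ->] := hp' i; have /andP[-> _] := hq' i.
case=> y yb; apply: eU; split=> // k i; rewrite !ord1.
have := yb i; rewrite !mxE => /andP[y1 y2].
rewrite -ball_normE /= ltr_norml.
have /andP[p1 _] := hp' i; have /andP[_ q1] := hq' i; lra.
Qed.

Lemma continuous_measurable_comp dT (T : measurableType dT) (S : T -> V) (f : V -> R) :
  (forall i, measurable_fun [set: T] (fun t => S t 0 i)) -> continuous f ->
  measurable_fun [set: T] (fun t => f (S t)).
Proof.
move=> mS cf mD; apply: (measurability _ (RGenOInfty.measurableE R)) => //.
move=> /= _ [_ [c ->] <-]; rewrite setTI.
apply: (measurable_open_preimage (U := f @^-1` `]c, +oo[) mS).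
by apply: open_comp => // x _; exact: cf.
Qed.

Lemma continuous_measurable_rV (f : V -> R) : continuous f ->
  measurable_fun [set: Ld R d] (f : Ld R d -> R).
Proof. exact: (continuous_measurable_comp measurable_coord). Qed.

Lemma measurable_box a b : measurable (box a b : set (Ld R d)).
Proof.
rewrite (_ : box a b = \bigcap_(i in [set: 'I_d])
  ((fun x : Ld R d => x 0 i) @^-1` `[a 0 i, b 0 i])).
  apply: fin_bigcap_measurable => // i _; rewrite -[X in measurable X]setTI.
  by apply: measurable_coord => //; exact: measurable_itv.
apply/seteqP; split => x h i; first by move=> _ /=; rewrite in_itv /=; exact: h.
by have := h i Logic.I; rewrite /= in_itv.
Qed.

Definition cube (r : R) : set V := box (const_mx (- r)) (const_mx r).

Lemma cubeP r x : cube r x <-> forall i, `|x 0 i| <= r.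
Proof.
by split=> h i; move: (h i); rewrite ?mxE ler_norml.
Qed.

Lemma cube_lty r : (leb R d (cube r) < +oo)%E.
Proof. exact: le_lt_trans (lebesgue_outer_box_le _ _) (ltry _). Qed.

Lemma measurable_cube r : measurable (cube r : set (Ld R d)).
Proof. exact: measurable_box. Qed.

Lemma sub_cube r s : r <= s -> cube r `<=` cube s.
Proof. by move=> rs x /cubeP h; apply/cubeP => i; rewrite (le_trans (h i)). Qed.

Lemma coord_le_norm x i : `|x 0 i| <= `|x|.
Proof.
have /mapP[j Hj ->] : `|x ord0 i| \in [seq `|x x0.1 x0.2| | x0 : 'I_1 * 'I_d].
  by apply/mapP; exists (ord0, i) => //=; rewrite mem_enum.
by rewrite [leRHS]/Num.Def.normr /= mx_normrE; apply/bigmax_geP; right => /=; exists j.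
Qed.

Lemma cube_norm x : cube `|x| x.
Proof. by apply/cubeP => i; exact: coord_le_norm. Qed.

Lemma bounded_sub_cube (A : set V) : bounded_set A -> exists r, A `<=` cube r.
Proof.
move=> [M [_ hM]]; exists (M + 1) => x Ax.
apply: sub_cube (cube_norm x).
by apply: hM => //; lra.
Qed.

Lemma compact_sub_cube (A : set V) : compact A -> exists r, A `<=` cube r.
Proof. by move=> /compact_bounded/bounded_sub_cube. Qed.

Lemma compact_cube r : compact (cube r).
Proof.
have := @rV_compact R d (fun=> `[- r, r]%classic)
  (fun=> @segment_compact _ _ _).
congr compact; apply/seteqP; split => x h i;
  by have := h i; rewrite /= ?in_itv /= !mxE.
Qed.

Lemma lebesgue_sigma_finite : sigma_finite [set: Ld R d] (leb R d).
Proof.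
exists (fun n => cube n%:R).
  apply/seteqP; split=> // x _.
  exists (Num.bound `|x|) => //.
  apply: sub_cube (cube_norm x).
  by rewrite ltW// archi_boundP.
by move=> n; split; [exact: measurable_cube|exact: cube_lty].
Qed.

End lebesgue_outer_theory.

Section sigma_finite_lebesgue.
Variables (R : realType) (d : nat).
Local Notation outer :=
  (@lebesgue_outer R d : {outer_measure set (allsets R d) -> \bar R}).

(* HB sees that [OuterMeasure.sort outer] is a measure and refuses to key an
   instance on [lebesgue_outer] itself, hence this hand-packed one. *)
Definition lebesgue_measure_rV : {measure set (Ld R d) -> \bar R} :=
  @Measure.Pack _ (Ld R d) R (@lebesgue_outer R d)
    (Measure.class (outer : {measure set (Ld R d) -> \bar R})).
Canonical lebesgue_measure_rV.

Let sigma_finite_mixin := Measure_isSigmaFinite.Build _ (Ld R d) R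
  (@lebesgue_outer R d) (@lebesgue_sigma_finite R d).

Definition lebesgue_sf : {sigma_finite_measure set (Ld R d) -> \bar R} :=
  HB.pack (@lebesgue_outer R d) sigma_finite_mixin
    (Measure.class lebesgue_measure_rV).

End sigma_finite_lebesgue.

(** * Integrals of real-valued functions *)

Section real_dominated_convergence.
Context d (T : measurableType d) (R : realType) (mu : {measure set T -> \bar R}).

Lemma Rintegral_dominated (f_ : nat -> T -> R) (f g : T -> R) :
  (forall n, measurable_fun [set: T] (f_ n)) -> measurable_fun [set: T] f ->
  mu.-integrable [set: T] (EFin \o g) ->
  (forall n x, `|f_ n x| <= g x) ->
  {ae mu, forall x, f_ ^~ x @ \oo --> f x} ->
  [/\ mu.-integrable [set: T] (EFin \o f),
    \int[mu]_x `|f_ n x - f x| @[n --> \oo] --> 0 &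
    \int[mu]_x f_ n x @[n --> \oo] --> \int[mu]_x f x].
Proof.
move=> mf_ mf gi fg ff.
have fi n : mu.-integrable [set: T] (EFin \o f_ n).
  apply: (le_integrable measurableT _ _ gi); first exact/measurable_EFinP.
  by move=> x _ /=; rewrite lee_fin (le_trans (fg n x))// ler_norm.
have [||||h1 h2 h3] := @dominated_convergence _ T R mu setT measurableT
  (fun n x => (f_ n x)%:E) (fun x => (f x)%:E) (fun x => (g x)%:E) _ _ _ gi _.
- by move=> n; exact/measurable_EFinP.
- exact/measurable_EFinP.
- apply: filterS ff => x fx _; apply: cvg_EFin => //; exact: nearW.
- by apply: aeW => x n _; rewrite lee_fin.
split=> //.
  by apply: (@fine_cvg _ _ _ _ (fun n => \int[mu]_x (`|f_ n x - f x|%:E))%E).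
apply: (@fine_cvg _ _ _ _ (fun n => \int[mu]_x (f_ n x)%:E)%E).
by rewrite /Rintegral fineK//; exact: integrable_fin_num.
Qed.

End real_dominated_convergence.

Section real_integral.
Variables (R : realType) (d : nat).
Local Notation V := 'rV[R]_d.
Local Notation lam := (leb R d).
Implicit Types (f g h : V -> R) (x y : V).

(** The vector space and its topology live on [V], the measure on its alias [Ld R d]. This and the
    next two definitions keep the change of type out of later statements. *)
Definition measf f := measurable_fun [set: Ld R d] (f : Ld R d -> R).

Definition itg f := lam.-integrable [set: Ld R d] (EFin \o (f : Ld R d -> R)).

Definition integ f : R := \int[lam]_x (f : Ld R d -> R) x.

Lemma itg_measf f : itg f -> measf f.
Proof. by move=> /measurable_int/measurable_EFinP. Qed.

Lemma EFin_integ f : itg f -> (\int[lam]_x (f x)%:E)%E = (integ f)%:E.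
Proof. by move=> fi; rewrite /integ /Rintegral fineK//; exact: integrable_fin_num. Qed.

Lemma itg_le f g : measf f -> itg g -> (forall x, `|f x| <= g x) -> itg f.
Proof.
move=> mf gi fg; refine (le_integrable measurableT _ _ gi).
  exact/measurable_EFinP.
by move=> x _ /=; rewrite lee_fin (le_trans (fg x))// ler_norm.
Qed.

Lemma itgP f : measf f -> (\int[lam]_x `|f x|%:E < +oo)%E -> itg f.
Proof. by move=> mf h; apply/integrableP; split; first exact/measurable_EFinP. Qed.

Lemma itgD f g : itg f -> itg g -> itg (fun x => f x + g x).
Proof. by move=> fi gi; exact: integrableD fi gi. Qed.

Lemma itgB f g : itg f -> itg g -> itg (fun x => f x - g x).
Proof. by move=> fi gi; exact: integrableB fi gi. Qed.

Lemma itgZ (k : R) f : itg f -> itg (fun x => k * f x).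
Proof. by move=> fi; exact: integrableZl fi. Qed.

Lemma itg_norm f : itg f -> itg (fun x => `|f x|).
Proof. by move=> fi; exact: integrable_norm. Qed.

Lemma itg0 : itg (fun=> 0).
Proof. exact: integrable0. Qed.

Lemma integ0 : integ (fun=> 0) = 0.
Proof. by rewrite /integ /Rintegral integral0. Qed.

Lemma integD f g : itg f -> itg g -> integ (fun x => f x + g x) = integ f + integ g.
Proof. by move=> fi gi; exact: RintegralD. Qed.

Lemma integB f g : itg f -> itg g -> integ (fun x => f x - g x) = integ f - integ g.
Proof. by move=> fi gi; exact: RintegralB. Qed.

Lemma integZ (k : R) f : itg f -> integ (fun x => k * f x) = k * integ f.
Proof. by move=> fi; exact: RintegralZl. Qed.

Lemma integ_sum n (f : 'I_n -> V -> R) : (forall i, itg (f i)) ->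
  integ (fun x => \sum_i f i x) = \sum_i integ (f i) /\
  itg (fun x => \sum_i f i x).
Proof.
elim: n f => [|n IH] f fi.
  split; last by under eq_fun do rewrite big_ord0; exact: itg0.
  by rewrite big_ord0; under eq_fun do rewrite big_ord0; exact: integ0.
have [IH1 IH2] := IH (fun i => f (lift ord0 i)) (fun i => fi _).
split; last by under eq_fun do rewrite big_ord_recl; exact: itgD.
by rewrite big_ord_recl -IH1 -integD//; under eq_fun do rewrite big_ord_recl.
Qed.

Lemma integ_ge0 f : (forall x, 0 <= f x) -> 0 <= integ f.
Proof. by move=> f0; apply: Rintegral_ge0 => x _; exact: f0. Qed.

Lemma integ_le f g : itg f -> itg g -> (forall x, f x <= g x) -> integ f <= integ g.
Proof. by move=> fi gi fg; apply: le_Rintegral => // x _; exact: fg. Qed.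

Lemma integ_norm f : itg f -> `|integ f| <= integ (fun x => `|f x|).
Proof. by move=> fi; exact: le_normr_Rintegral. Qed.

Lemma eq_integ f g : f =1 g -> integ f = integ g.
Proof. by move=> /funext ->. Qed.

Lemma ae_eq_integ f g : measf f -> measf g ->
  {ae lam, forall x : Ld R d, f x = g x} -> integ f = integ g.
Proof.
move=> mf mg fg; congr fine; apply: ae_eq_integral.
- exact: measurableT.
- exact/measurable_EFinP.
- exact/measurable_EFinP.
- by apply: filterS fg => x -> _.
Qed.

Lemma measfM f g : measf f -> measf g -> measf (fun x => f x * g x).
Proof. by move=> mf mg; exact: measurable_funM mf mg. Qed.

Lemma measfB f g : measf f -> measf g -> measf (fun x => f x - g x).
Proof. by move=> mf mg; exact: measurable_funB mf mg. Qed.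

Lemma measf_cst (c : R) : measf (fun=> c).
Proof. exact: measurable_cst. Qed.

Lemma measf_indic (A : set V) : measurable (A : set (Ld R d)) -> measf \1_A.
Proof. by move=> mA; exact: measurable_indic. Qed.

Lemma measf_norm f : measf f -> measf (fun x => `|f x|).
Proof. by move=> mf; exact: measurableT_comp. Qed.

Lemma itg_bounded_mul f g (M : R) : itg f -> measf g -> (forall x, `|g x| <= M) ->
  itg (fun x => f x * g x).
Proof.
move=> fi mg gM; apply: (@itg_le _ (fun x => M * `|f x|)).
- by apply: measfM => //; exact: itg_measf.
- exact/itgZ/itg_norm.
- by move=> x; rewrite normrM mulrC ler_wpM2r.
Qed.

Lemma itg_indic (A : set V) : measurable (A : set (Ld R d)) -> (lam A < +oo)%E ->
  itg \1_A.
Proof.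
move=> mA Afin; apply: itgP; first exact: measf_indic.
rewrite (eq_integral (fun x : Ld R d => (\1_A x)%:E)); last first.
  by move=> x _; rewrite ger0_norm.
by rewrite integral_indic// setIT.
Qed.

Lemma integ_indic (A : set V) : measurable (A : set (Ld R d)) ->
  integ \1_A = fine (lam A).
Proof. by move=> mA; rewrite /integ /Rintegral integral_indic// setIT. Qed.

Lemma itg_bounded_support f (M r : R) : measf f -> (forall x, `|f x| <= M) ->
  (forall x, ~ cube r x -> f x = 0) -> itg f.
Proof.
move=> mf fM f0; apply: (@itg_le _ (fun x => M * \1_(@cube R d r) x)) => //.
  by apply/itgZ/itg_indic; [exact: measurable_cube|exact: cube_lty].
move=> x; rewrite indicE; case: (boolP (x \in _)) => [_|]; first by rewrite mulr1.
by move=> /negP; rewrite inE => /f0 ->; rewrite normr0 mulr0.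
Qed.

Lemma shift_measurable y : measurable_fun [set: Ld R d]
  (fun x : Ld R d => ((x : V) + y : Ld R d)).
Proof.
move=> _ A mA; rewrite setTI.
suff : caratheodory_measurable (@lebesgue_outer R d)
  ((fun x : V => x + y) @^-1` (A : set V)) by [].
have {}mA : caratheodory_measurable (@lebesgue_outer R d) (A : set V) by exact: mA.
(* Once the test set is itself a preimage under the shift, translation invariance applies to all
   three terms of the Caratheodory identity. *)
move=> X; have e : X = (fun x : V => x + y) @^-1` ((fun x => x - y) @^-1` X).
  by apply/seteqP; split => x /=; rewrite addrK.
rewrite {}e preimage_setC -!preimage_setI !(lebesgue_outer_shift _ y); exact: mA.
Qed.

Let pushforward_shift y :
  pushforward lam (fun x : Ld R d => ((x : V) + y : Ld R d)) = lam.
Proof. apply/funext => A; exact: lebesgue_outer_shift. Qed.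

Lemma ge0_integral_shift (f : Ld R d -> \bar R) y :
  measurable_fun [set: Ld R d] f -> (forall x, 0 <= f x)%E ->
  (\int[lam]_x f (((x : V) + y)%R : Ld R d) = \int[lam]_x f x)%E.
Proof.
move=> mf f0.
have := ge0_integral_pushforward (shift_measurable y) lam measurableT mf
  (fun x _ => f0 x).
by rewrite pushforward_shift preimage_setT.
Qed.

Lemma measf_shift f y : measf f -> measf (fun x => f (x + y)).
Proof. by move=> mf; exact: measurableT_comp mf (shift_measurable y). Qed.

Lemma itg_shift f y : itg f -> itg (fun x => f (x + y)).
Proof.
move=> fi; apply: itgP; first exact/measf_shift/itg_measf.
rewrite (@ge0_integral_shift (fun x => `|f x|%:E)); last first.
- by move=> x; rewrite lee_fin normr_ge0.
- by apply/measurable_EFinP/measf_norm/itg_measf.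
- by have /integrableP[] := fi.
Qed.

Lemma integ_shift f y : itg f -> integ (fun x => f (x + y)) = integ f.
Proof.
move=> fi; rewrite /integ /Rintegral; congr fine.
have := @integral_pushforward _ _ _ _ R _ (shift_measurable y) lam setT
  (EFin \o f) _ _ measurableT.
rewrite pushforward_shift preimage_setT => h; apply/esym/h.
- by apply/measurable_EFinP; exact: itg_measf.
- exact: itg_shift.
Qed.

Lemma integ_dominated (f_ : nat -> V -> R) f g :
  (forall n, measf (f_ n)) -> measf f -> itg g ->
  (forall n x, `|f_ n x| <= g x) ->
  {ae lam, forall x : Ld R d, f_ ^~ x @ \oo --> f x} ->
  [/\ itg f, integ (fun x => `|f_ n x - f x|) @[n --> \oo] --> 0 &
      integ (f_ n) @[n --> \oo] --> integ f].
Proof.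
move=> mf_ mf gi fg ff.
exact: (Rintegral_dominated (mu := lebesgue_measure_rV R d) mf_ mf gi fg ff).
Qed.

Lemma integ_Tonelli (f : V -> V -> R) :
  measurable_fun [set: Ld R d * Ld R d] (fun z => f z.1 z.2) ->
  (forall x y, 0 <= f x y) ->
  (\int[lam]_x \int[lam]_y (f x y)%:E = \int[lam]_y \int[lam]_x (f x y)%:E)%E.
Proof.
move=> mf f0.
apply: (@fubini_tonelli _ _ _ _ _ (lebesgue_sf R d) (lebesgue_sf R d)
  (fun z => (f z.1 z.2)%:E)).
- exact/measurable_EFinP.
- by move=> z; rewrite lee_fin.
Qed.

Lemma integral_Fubini (f : V -> V -> R) :
  measurable_fun [set: Ld R d * Ld R d] (fun z => f z.1 z.2) ->
  (\int[lam]_x \int[lam]_y `|f x y|%:E < +oo)%E ->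
  (\int[lam]_x \int[lam]_y (f x y)%:E = \int[lam]_y \int[lam]_x (f x y)%:E)%E.
Proof.
move=> mf h; pose F (z : Ld R d * Ld R d) := (f z.1 z.2)%:E.
apply: (@Fubini _ _ _ _ _ (lebesgue_sf R d) (lebesgue_sf R d) F).
apply: (@integrable12ltyP _ _ _ _ _ (lebesgue_sf R d) (lebesgue_sf R d) F _).2.
  exact/measurable_EFinP.
exact: h.
Qed.

End real_integral.

(* Integrals, and hypotheses of the form [itg f] or [measf f], are hidden from
   [lra], whose preprocessing unfolds them at a prohibitive cost. *)
Ltac lra_integ :=
  repeat match goal with
  | H : itg _ |- _ => clear H
  | H : measf _ |- _ => clear H
  | H : context [integ _] |- _ => move: H
  end;
  repeat match goal with |- context [integ ?f] => move: (integ f) => ? end; lra.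

(** * Functions with continuous partial derivatives *)

Section partial_derivatives.
Variables (R : realType) (d : nat).
Local Notation V := 'rV[R]_d.
Local Notation e := (@ebasis R d).
Implicit Types (f g : V -> R) (x y v : V) (j : 'I_d).

(** Together with [is_derive_line] this moves directional derivatives to the real line and back,
    where the chain rule and the mean value theorem apply. *)
Lemma line_is_derive f x v (t l : R) :
  is_derive (x + t *: v) v f l -> is_derive t 1 (fun s => f (x + s *: v)) l.
Proof.
have E : (fun h : R => h^-1 *: (((fun s => f (x + s *: v)) \o shift t) (h *: (1 : R)) -
    f (x + t *: v))) =
  (fun h : R => h^-1 *: ((f \o shift (x + t *: v)) (h *: v) - f (x + t *: v))).
  apply/funext => h /=; congr (_ *: (f _ - _)).
  by rewrite scalerDl addrCA [_ *: 1]mulr1.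
move=> [dl vl]; split; first by rewrite /derivable E.
by rewrite -vl /derive E.
Qed.

Lemma is_derive_line f x v (l : R) :
  is_derive (0 : R) 1 (fun s => f (x + s *: v)) l -> is_derive x v f l.
Proof.
have E : (fun h : R => h^-1 *: (((fun s => f (x + s *: v)) \o shift 0) (h *: (1 : R)) -
    f (x + 0 *: v))) =
  (fun h : R => h^-1 *: ((f \o shift x) (h *: v) - f x)).
  apply/funext => h /=; rewrite scale0r !addr0; congr (_ *: (f _ - _)).
  by rewrite [_ *: 1]mulr1 addrC.
move=> [dl vl]; split; first by rewrite /derivable -E.
by rewrite -vl /derive E.
Qed.

Lemma is_derive_chain (F : R -> R) f x v (a b : R) :
  is_derive (f x) 1 F a -> is_derive x v f b ->
  is_derive x v (fun y => F (f y)) (a * b).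
Proof.
move=> Fa fb; apply: is_derive_line.
apply: (@is_derive1_comp _ F (fun s => f (x + s *: v))).
  by rewrite scale0r addr0.
by apply: line_is_derive; rewrite scale0r addr0.
Qed.

Lemma MVT_line f (df : V -> R) x v (t : R) :
  (forall y, is_derive y v f (df y)) ->
  exists2 s, `|s| <= `|t| & f (x + t *: v) - f x = df (x + s *: v) * t.
Proof.
move=> fd; pose g s := f (x + s *: v).
have gd (s : R) : is_derive s (1 : R) g (df (x + s *: v)) by apply: line_is_derive; exact: fd.
have gc : continuous g.
  by move=> s; apply/differentiable_continuous/derivable1_diffP; apply: ex_derive.
have g0 : g 0 = f x by rewrite /g scale0r addr0.
have [t0|/ltW t0] := leP 0 t.
- have [s] := @MVT_segment R g _ 0 t t0 (fun s _ => gd s)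
    (continuous_subspaceT gc).
  rewrite in_itv /= => /andP[s0 st]; rewrite g0 subr0 => gs.
  by exists s; rewrite // !ger0_norm.
- have [s] := @MVT_segment R g _ t 0 t0 (fun s _ => gd s)
    (continuous_subspaceT gc).
  rewrite in_itv /= => /andP[s0 st]; rewrite g0 sub0r => gs.
  by exists s; [rewrite !ler0_norm// lerN2|rewrite -/(g t); lra].
Qed.

Let mix x y (k : nat) : V := \row_i if (i < k)%N then y 0 i else x 0 i.

(** Walk from [x] to [y] changing one coordinate at a time, with the mean value theorem on each leg;
    the sum on the right is the length of this path. *)
Lemma partial_lipschitz f (df : 'I_d -> V -> R) (M : R) :
  (forall j x, is_derive x (e j) f (df j x)) -> (forall j x, `|df j x| <= M) ->
  forall x y, `|f x - f y| <= M * \sum_i `|x 0 i - y 0 i|.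
Proof.
move=> fd fM x y.
have step (k : 'I_d) : `|f (mix x y k) - f (mix x y k.+1)| <= M * `|x 0 k - y 0 k|.
  have -> : mix x y k.+1 = mix x y k + (y 0 k - x 0 k) *: e k.
    apply/rowP => i; rewrite !mxE ltnS leq_eqVlt eqxx /=.
    have [->|ik] := eqVneq i k; first by rewrite eqxx ltnn /=; lra.
    have -> : (i == k :> nat) = false by exact/negbTE.
    by rewrite mulr0 addr0.
  have [s _ E] := @MVT_line f (df k) (mix x y k) (e k) (y 0 k - x 0 k) (fd k).
  rewrite distrC E normrM distrC; apply: ler_wpM2r => //.
have -> : f x = f (mix x y 0) by congr f; apply/rowP => i; rewrite !mxE.
have -> : f y = f (mix x y d).
  by congr f; apply/rowP => i; rewrite !mxE ltn_ord.
have sumE n : f (mix x y 0) - f (mix x y n) =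
    \sum_(0 <= k < n) (f (mix x y k) - f (mix x y k.+1)).
  rewrite -opprB -(@telescope_sumr _ 0 n (fun k => f (mix x y k)))//.
  by rewrite -sumrN; apply: eq_bigr => k _; rewrite opprB.
rewrite sumE big_mkord mulr_sumr (le_trans (ler_norm_sum _ _ _))//.
by apply: ler_sum => k _; exact: step.
Qed.

Lemma lipschitz_continuous_rV f (M : R) : 0 <= M ->
  (forall x y, `|f x - f y| <= M * \sum_i `|x 0 i - y 0 i|) -> continuous f.
Proof.
move=> M0 fM x; apply/(@cvgrPdist_lt _ _ _ (nbhs x) (nbhs_filter x)) => eps eps0.
pose dl := eps / (M * d%:R + 1).
have D0 : 0 < M * d%:R + 1 by rewrite ltr_wpDl// mulr_ge0.
have dl0 : 0 < dl by rewrite divr_gt0.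
near=> y; apply: (le_lt_trans (fM x y)).
apply: (@le_lt_trans _ _ (M * \sum_(i < d) dl)).
  apply: ler_wpM2l => //; apply: ler_sum => i _.
  apply: (le_trans (_ : _ <= `|x - y|)).
    by have := coord_le_norm (x - y) i; rewrite !mxE.
  by apply/ltW; near: y; exact: (@cvgr_dist_lt _ _ _ (nbhs x) _ id).
rewrite sumr_const card_ord -mulr_natr /dl.
rewrite [X in X < _](_ : _ = eps * (M * d%:R) / (M * d%:R + 1)); last first.
  by field; rewrite gt_eqF.
by rewrite ltr_pdivrMr// ltr_pM2l// ltrDl.
Unshelve. all: by end_near. Qed.

Definition C1 f (df : 'I_d -> V -> R) :=
  [/\ continuous f, forall j x, is_derive x (e j) f (df j x) &
      forall j, continuous (df j)].

Definition vanishes_off (r : R) f := forall x, ~ cube r x -> f x = 0.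

Definition Cc1 f (df : 'I_d -> V -> R) := C1 f df /\ exists r, vanishes_off r f.

Lemma vanishes_off_le r s f : r <= s -> vanishes_off r f -> vanishes_off s f.
Proof. by move=> rs h x xs; apply: h => /(sub_cube rs). Qed.

Lemma closed_cube r : closed (@cube R d r).
Proof.
apply: compact_closed; last exact: compact_cube.
exact: norm_hausdorff.
Qed.

Lemma derive_vanishes_off r f j (g : V -> R) :
  (forall x, is_derive x (e j) f (g x)) -> vanishes_off r f -> vanishes_off r g.
Proof.
move=> fg f0 x xr.
have U : \near x, f x = (cst 0 : V -> R) x.
  have : nbhs x (~` cube r).
    by apply: open_nbhs_nbhs; split => //; exact/closed_openC/closed_cube.
  by apply: filterS => y /f0.
have := near_eq_derive (e j) U; rewrite derive_cst.
by have [_ ->] := fg x.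
Qed.

Lemma continuous_vanishes_off_bounded r f : continuous f -> vanishes_off r f ->
  exists2 M, 0 <= M & forall x, `|f x| <= M.
Proof.
move=> cf f0.
have : compact [set f x | x in cube r].
  apply: (@continuous_compact _ _ f); last exact: compact_cube.
  exact: continuous_subspaceT.
move=> /compact_bounded[M0 [_ hM]]; exists (`|M0| + 1) => [|x].
  by rewrite addr_ge0.
have [xr|xr] := pselect (cube r x).
  apply: hM; last by exists x.
  by rewrite (le_lt_trans (ler_norm _))// ltrDl.
by rewrite f0// normr0 addr_ge0.
Qed.

Lemma continuous_vanishes_off_itg r f : continuous f -> vanishes_off r f -> itg f.
Proof.
move=> cf f0; have [M _ fM] := continuous_vanishes_off_bounded cf f0.
by apply: (itg_bounded_support _ fM f0); exact: continuous_measurable_rV.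
Qed.

(** Continuity of [f] comes for free: the partial derivatives are continuous with compact support,
    hence bounded, so [f] is Lipschitz. [Cc1_field] asks only for partial derivatives, and this is
    how continuity of a test field is recovered. *)
Lemma C1_of_partials r f (df : 'I_d -> V -> R) :
  (forall j x, is_derive x (e j) f (df j x)) -> (forall j, continuous (df j)) ->
  vanishes_off r f -> Cc1 f df.
Proof.
move=> fd cdf f0; split; last by exists r.
split=> //.
have hM j : exists M, forall x, `|df j x| <= M.
  have [M _ ?] := continuous_vanishes_off_bounded (cdf j)
    (derive_vanishes_off (fd j) f0).
  by exists M.
have [M hM'] := choice hM.
apply: (@lipschitz_continuous_rV _ (\sum_j `|M j|)).
  by rewrite sumr_ge0.
apply: (partial_lipschitz fd) => j x.
rewrite (le_trans (hM' j x))// (le_trans (ler_norm _))//.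
by rewrite (bigD1 j)//= lerDl sumr_ge0.
Qed.

(** The difference quotients integrate to 0 by translation invariance. Their steps are at most 1, so
    by the mean value theorem they are dominated by a constant on the cube enlarged by 1, and the
    limit integrates to 0 as well. *)
Lemma integ_partial f (df : 'I_d -> V -> R) j : Cc1 f df -> integ (df j) = 0.
Proof.
move=> [[cf fd cdf] [r f0]].
have df0 := derive_vanishes_off (fd j) f0.
have [M M0 dfM] := continuous_vanishes_off_bounded (cdf j) df0.
have fi := continuous_vanishes_off_itg cf f0.
pose h (n : nat) : R := n.+1%:R^-1.
have h0 n : 0 < h n by rewrite invr_gt0.
pose q n x := (h n)^-1 * (f (x + h n *: e j) - f x).
have qi n : itg (q n) by apply/itgZ/itgB => //; exact: itg_shift.
have q0 n : integ (q n) = 0.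
  rewrite integZ; last by apply: itgB => //; exact: itg_shift.
  by rewrite integB ?integ_shift ?subrr ?mulr0//; exact: itg_shift.
have hn1 n : h n <= 1 by rewrite invf_le1// ler1n.
have qM n x : `|q n x| <= M * \1_(@cube R d (r + 1)) x.
  rewrite indicE; case: (boolP (x \in _)) => [_|].
    have [s _ E] := MVT_line x (h n) (fd j).
    rewrite /q E mulrCA mulVf ?gt_eqF// !mulr1; exact: dfM.
  move=> /negP; rewrite inE => xr.
  rewrite /q !f0 ?subr0 ?mulr0 ?normr0//.
    by move=> /(sub_cube _) h'; apply/xr/h'; rewrite lerDl.
  move=> /cubeP h'; apply/xr/cubeP => i.
  have := h' i; rewrite !mxE; have := h0 n; have := hn1 n.
  case: (_ && _) => /=; rewrite ?mulr0 ?mulr1 ?addr0; last first.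
    by move=> _ _ ?; lra.
  move=> h1 h2 h3; rewrite -[x 0 i](addrK (h n)) (le_trans (ler_normB _ _))//.
  by rewrite (gtr0_norm h2); lra.
have [|||_ _] := @integ_dominated R d q (df j)
    (fun x => M * \1_(@cube R d (r + 1)) x) (fun n => itg_measf (qi n)) _ _ qM.
- exact: continuous_measurable_rV.
- apply/itgZ/itg_indic; [exact: measurable_cube|exact: cube_lty].
- apply: aeW => x.
  have [fdx <-] := fd j x.
  have /cvgr_dnbhsP/(_ h) H : (fun t : R => t^-1 *: ((f \o shift x) (t *: e j) - f x)) t
      @[t --> 0^'] --> 'D_(e j) f x by exact: fdx.
  have {}H := H (conj (fun n => lt0r_neq0 (h0 n)) cvg_harmonic).
  apply: cvg_trans H; apply: near_eq_cvg; apply: nearW => n.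
  by rewrite /q /= [h n *: _ + x]addrC.
under eq_fun do rewrite q0.
by move=> /(cvg_lim (@Rhausdorff R)); rewrite lim_cst.
Qed.

End partial_derivatives.

(** * Products, compositions and integration by parts for C^1 functions *)

Section C1_calculus.
Variables (R : realType) (d : nat).
Local Notation V := 'rV[R]_d.
Implicit Types (f g : V -> R) (x : V) (j : 'I_d).

Lemma continuousM_rV f g : continuous f -> continuous g ->
  continuous (fun x => f x * g x).
Proof. by move=> cf cg x; apply: (@continuousM _ V f g x); [exact: cf|exact: cg]. Qed.

Lemma continuousD_rV f g : continuous f -> continuous g ->
  continuous (fun x => f x + g x).
Proof. by move=> cf cg x; apply: (@continuousD _ _ V f g x); [exact: cf|exact: cg]. Qed.

Lemma continuous_comp_rV (F : R -> R) f : continuous F -> continuous f ->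
  continuous (fun x => F (f x)).
Proof. by move=> cF cf x; apply: (continuous_comp (cf x)); exact: cF. Qed.

Lemma is_derive_continuous (F F' : R -> R) :
  (forall t : R, is_derive t (1 : R) F (F' t)) -> continuous F.
Proof.
by move=> Fd t; apply/differentiable_continuous/derivable1_diffP; apply: ex_derive.
Qed.

Lemma C1M f df g dg : C1 f df -> C1 g dg ->
  C1 (fun x => f x * g x) (fun j x => df j x * g x + f x * dg j x).
Proof.
move=> [cf fd cdf] [cg gd cdg]; split; first exact: continuousM_rV.
  move=> j x; apply: is_derive_eq (is_deriveM (fd j x) (gd j x)) _.
  by rewrite /GRing.scale /= addrC [g x * _]mulrC.
by move=> j; apply: continuousD_rV; exact: continuousM_rV.
Qed.

Lemma C1D f df g dg : C1 f df -> C1 g dg ->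
  C1 (fun x => f x + g x) (fun j x => df j x + dg j x).
Proof.
move=> [cf fd cdf] [cg gd cdg]; split; first exact: continuousD_rV.
  by move=> j x; exact: is_deriveD (fd j x) (gd j x).
by move=> j; apply: continuousD_rV.
Qed.

Lemma C1_comp (F F' : R -> R) f df :
  (forall t : R, is_derive t (1 : R) F (F' t)) -> continuous F' -> C1 f df ->
  C1 (fun x => F (f x)) (fun j x => F' (f x) * df j x).
Proof.
move=> Fd cF' [cf fd cdf]; split.
- by apply: continuous_comp_rV => //; exact: is_derive_continuous Fd.
- by move=> j x; exact: (is_derive_chain (Fd (f x)) (fd j x)).
- by move=> j; apply: continuousM_rV => //; exact: continuous_comp_rV.
Qed.

Lemma Cc1M f df g dg : C1 f df -> Cc1 g dg ->
  Cc1 (fun x => f x * g x) (fun j x => df j x * g x + f x * dg j x).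
Proof.
move=> fc [gc [r g0]]; split; first exact: C1M.
by exists r => x xr; rewrite g0// mulr0.
Qed.

Lemma Cc1D f df g dg : Cc1 f df -> Cc1 g dg ->
  Cc1 (fun x => f x + g x) (fun j x => df j x + dg j x).
Proof.
move=> [fc [r f0]] [gc [s g0]]; split; first exact: C1D.
exists (Num.max r s) => x xr.
have fr : r <= Num.max r s by rewrite le_max lexx.
have gr : s <= Num.max r s by rewrite le_max lexx orbT.
by rewrite (vanishes_off_le fr f0 xr) (vanishes_off_le gr g0 xr) addr0.
Qed.

Lemma Cc1_partial_itg f df j : Cc1 f df -> itg (df j).
Proof.
move=> [[cf fd cdf] [r f0]].
exact: continuous_vanishes_off_itg (cdf j) (derive_vanishes_off (fd j) f0).
Qed.

Lemma Cc1_partial_bounded f df j : Cc1 f df ->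
  exists2 M, 0 <= M & forall x, `|df j x| <= M.
Proof.
move=> [[cf fd cdf] [r f0]].
exact: continuous_vanishes_off_bounded (cdf j) (derive_vanishes_off (fd j) f0).
Qed.

Lemma Cc1_bounded f df : Cc1 f df -> exists2 M, 0 <= M & forall x, `|f x| <= M.
Proof. by move=> [[cf _ _] [r f0]]; exact: continuous_vanishes_off_bounded cf f0. Qed.

(* With [A t = F t - t * F' t] one has [A' t = - t * F'' t], so the difference of
   the two integrands is the [j]-th partial derivative of [A (w x) * phi x]. *)
Lemma integ_chain_partial (F F' F'' : R -> R) w dw phi dphi j :
  (forall t : R, is_derive t (1 : R) F (F' t)) ->
  (forall t : R, is_derive t (1 : R) F' (F'' t)) -> continuous F'' ->
  C1 w dw -> Cc1 phi dphi ->
  integ (fun x => F (w x) * dphi j x) =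
  integ (fun x => w x * (F'' (w x) * dw j x * phi x + F' (w x) * dphi j x)).
Proof.
move=> Fd F'd cF'' wc phic.
pose A t := F t - t * F' t; pose A' t := - (t * F'' t).
have Ad (t : R) : is_derive t (1 : R) A (A' t).
  apply: is_derive_eq (is_deriveB (Fd t) (is_deriveM (is_derive_id t 1) (F'd t))) _.
  by rewrite /GRing.scale /= /A'; ring.
have cid : continuous (id : R -> R) by move=> t; exact: cvg_id.
have cA' : continuous A'.
  move=> t; apply: cvgN; apply: (@continuousM _ _ id F''); [exact: cid|exact: cF''].
have cF' := is_derive_continuous F'd.
have := integ_partial j (Cc1M (C1_comp Ad cA' wc) phic).
have i1 : itg (fun x => F (w x) * dphi j x).
  have [wcc _ _] := wc; have [[cphi phid cdphi] [r phi0]] := phic.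
  apply: (@continuous_vanishes_off_itg _ _ r).
    by apply: continuousM_rV => //; apply: continuous_comp_rV => //;
      exact: is_derive_continuous Fd.
  by move=> x xr; rewrite (derive_vanishes_off (phid j) phi0)// mulr0.
have i2 : itg (fun x => w x * (F'' (w x) * dw j x * phi x + F' (w x) * dphi j x)).
  have [wcc _ cdw] := wc; have [[cphi phid cdphi] [r phi0]] := phic.
  apply: (@continuous_vanishes_off_itg _ _ r).
    apply: continuousM_rV => //; apply: continuousD_rV; apply: continuousM_rV => //.
      by apply: continuousM_rV => //; exact: continuous_comp_rV.
    exact: continuous_comp_rV.
  by move=> x xr; rewrite (derive_vanishes_off (phid j) phi0)// phi0// !mulr0 addr0 mulr0.
move=> E; apply/eqP; rewrite -subr_eq0 -integB//; apply/eqP; rewrite -[RHS]E.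
by apply: eq_integ => x; rewrite /A /A'; ring.
Qed.

End C1_calculus.

(** * Total variation *)

Section total_variation_theory.
Variables (R : realType) (d : nat).
Local Notation V := 'rV[R]_d.
Local Notation lam := (leb R d).
Local Notation e := (@ebasis R d).
Local Notation tv := (@Defs.total_variation R d).
Implicit Types (u w g : V -> R) (x : V) (phi : 'I_d -> V -> R).

Lemma admissible_Cc1 phi : admissible_field phi ->
  forall i, Cc1 (phi i) (fun j x => 'D_(e j) (phi i) x).
Proof.
move=> [[dphi cphi [K [cK phi0]]] _] i.
have [r Kr] := compact_sub_cube cK.
apply: (@C1_of_partials _ _ r) => [j x|j|x xr]; first exact/derivableP/dphi.
  exact: cphi.
by apply: phi0 => /Kr.
Qed.

Lemma admissible_fieldP phi dphi : (forall i, Cc1 (phi i) (dphi i)) ->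
  (forall x, \sum_(i < d) (phi i x) ^+ 2 <= 1) -> admissible_field phi.
Proof.
move=> phic phi1; split=> //.
have D i j x : 'D_(e j) (phi i) x = dphi i j x.
  by have [[_ + _] _] := phic i => /(_ j x)[].
split.
- by move=> i j x; have [[_ + _] _] := phic i => /(_ j x)[].
- by move=> i j; under eq_fun do rewrite D; have [[_ _ +] _] := phic i; exact.
- have [r hr] := choice (fun i => (phic i).2).
  exists (cube (\sum_i `|r i|)); split; first exact: compact_cube.
  move=> i x xr; apply: (vanishes_off_le _ (hr i)) xr.
  by rewrite (le_trans (ler_norm _))// (bigD1 i)//= lerDl sumr_ge0.
Qed.

Lemma divergenceE phi dphi : (forall i, Cc1 (phi i) (dphi i)) ->
  forall x, divergence phi x = \sum_i dphi i i x.
Proof.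
move=> phic x; apply: eq_bigr => i _.
by have [[_ + _] _] := phic i => /(_ i x)[].
Qed.

Lemma divergence_bounded phi : admissible_field phi ->
  exists2 M, 0 <= M & forall x, `|divergence phi x| <= M.
Proof.
move=> /admissible_Cc1 phic.
have hM i : exists M, 0 <= M /\ forall x, `|'D_(e i) (phi i) x| <= M.
  by have [M M0 ?] := Cc1_partial_bounded i (phic i); exists M.
have [M /all_and2[M0 hM']] := choice hM.
exists (\sum_i M i); first exact: sumr_ge0.
move=> x; rewrite (le_trans (ler_norm_sum _ _ _))//.
by apply: ler_sum => i _; exact: hM'.
Qed.

Lemma divergence_itg phi : admissible_field phi -> itg (divergence phi).
Proof.
move=> /admissible_Cc1 phic.
by have [_] := integ_sum (fun i => Cc1_partial_itg i (phic i)).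
Qed.

Lemma itg_divergence u phi : itg u -> admissible_field phi ->
  itg (fun x => u x * divergence phi x).
Proof.
move=> ui pa; have [M _ hM] := divergence_bounded pa.
by apply: itg_bounded_mul hM => //; exact/itg_measf/divergence_itg.
Qed.

Lemma tv_ub u phi : itg u -> admissible_field phi ->
  ((integ (fun x => u x * divergence phi x))%:E <= tv u)%E.
Proof.
move=> ui pa; apply: ereal_sup_ubound; exists phi => //.
by rewrite -EFin_integ//; exact: itg_divergence.
Qed.

Lemma tv_le u (c : R) : itg u ->
  (forall phi, admissible_field phi -> integ (fun x => u x * divergence phi x) <= c) ->
  (tv u <= c%:E)%E.
Proof.
move=> ui h; apply: ge_ereal_sup => _ [phi pa <-].
rewrite (EFin_integ (f := fun x => u x * divergence phi x)) ?lee_fin; first exact: h.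
exact: itg_divergence.
Qed.

Lemma tv_leP u (c : R) : itg u -> (tv u <= c%:E)%E ->
  forall phi, admissible_field phi -> integ (fun x => u x * divergence phi x) <= c.
Proof.
by move=> ui uc phi pa; rewrite -lee_fin (le_trans (tv_ub ui pa)).
Qed.

Lemma Cc1_0 : Cc1 (fun=> 0 : R) (fun (j : 'I_d) (x : V) => 0).
Proof.
split; last by exists 0.
by split=> [x|j x|j x]; [exact: (@cst_continuous V R)|exact: is_derive_cst|exact: (@cst_continuous V R)].
Qed.

Lemma tv_ge0 u : itg u -> (0 <= tv u)%E.
Proof.
move=> ui; have pa : @admissible_field R d (fun _ _ => 0).
  apply: admissible_fieldP => [i|x]; first exact: Cc1_0.
  by rewrite big1// => i _; rewrite expr0n.
apply: le_trans (tv_ub ui pa).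
rewrite (@eq_integ _ _ _ (fun=> 0)) ?integ0// => x.
by rewrite (divergenceE (fun i => Cc1_0)) big1// mulr0.
Qed.

Lemma eq_tv u w : itg u -> itg w -> {ae lam, forall x : Ld R d, u x = w x} ->
  tv u = tv w.
Proof.
move=> ui wi uw; congr ereal_sup; apply: eq_imagel => phi pa.
have m := itg_measf (divergence_itg pa).
rewrite (EFin_integ (itg_divergence ui pa)) (EFin_integ (itg_divergence wi pa)).
congr EFin; apply: ae_eq_integ.
- exact/itg_measf/itg_divergence.
- exact/itg_measf/itg_divergence.
- by apply: filterS uw => x ->.
Qed.

Lemma tv_scale_le (k c : R) u : 0 <= k -> itg u -> (tv u <= c%:E)%E ->
  (tv (fun x => k * u x)%R <= (k * c)%:E)%E.
Proof.
move=> k0 ui uc; apply: tv_le; first exact: itgZ.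
move=> phi pa.
rewrite (@eq_integ _ _ _ (fun x => k * (u x * divergence phi x))); last first.
  by move=> x; rewrite mulrA.
rewrite integZ; last exact: itg_divergence.
by apply: ler_wpM2l => //; exact: tv_leP.
Qed.

Lemma tv_add_le (a c : R) u w : itg u -> itg w -> (tv u <= a%:E)%E ->
  (tv w <= c%:E)%E -> (tv (fun x => u x + w x)%R <= (a + c)%:E)%E.
Proof.
move=> ui wi ua wc; apply: tv_le; first exact: itgD.
move=> phi pa.
rewrite (@eq_integ _ _ _ (fun x => u x * divergence phi x + w x * divergence phi x));
  last by move=> x; rewrite mulrDl.
rewrite integD; [|exact: itg_divergence..].
by apply: lerD; exact: tv_leP.
Qed.

Lemma integ_mul_dist u w g (M : R) : itg u -> itg w -> measf g ->
  (forall x, `|g x| <= M) ->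
  `|integ (fun x => u x * g x) - integ (fun x => w x * g x)| <=
  M * integ (fun x => `|u x - w x|).
Proof.
move=> ui wi mg gM.
have iu := itg_bounded_mul ui mg gM; have iw := itg_bounded_mul wi mg gM.
have iuw : itg (fun x => `|u x - w x|) by exact/itg_norm/itgB.
rewrite -integB// -integZ//; apply: le_trans (integ_norm (itgB iu iw)) _.
apply: integ_le; [exact/itg_norm/itgB|exact: itgZ|move=> x].
by rewrite -mulrBl normrM mulrC ler_wpM2r.
Qed.

(** The variation is a supremum of functionals that are continuous in L^1, the divergence of a test
    field being bounded. *)
Lemma tv_lsc u (c : R) : itg u ->
  (forall eps, 0 < eps -> exists w, [/\ itg w,
     integ (fun x => `|w x - u x|) <= eps & (tv w <= (c + eps)%:E)%E]) ->
  (tv u <= c%:E)%E.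
Proof.
move=> ui h; apply: tv_le => // phi pa.
have [M M0 hM] := divergence_bounded pa.
apply/ler_addgt0Pr => eps eps0.
have D0 : 0 < M + 1 by rewrite ltr_wpDl.
(* A share M eps / (M + 1) of [eps] pays for replacing [u] by [w] in the integral, the remaining eps
   / (M + 1) for the excess in the variation of [w]. *)
have [w [wi wu wc]] := h (eps / (M + 1)) (divr_gt0 eps0 D0).
have := integ_mul_dist wi ui (itg_measf (divergence_itg pa)) hM.
have := tv_leP wi wc pa.
set a := integ _; set b := integ _; rewrite ler_norml => ac /andP[ab _].
have : M * integ (fun x => `|w x - u x|) <= M * (eps / (M + 1)).
  exact: ler_wpM2l.
have : M * (eps / (M + 1)) + eps / (M + 1) = eps by field; rewrite gt_eqF.
lra.
Qed.

End total_variation_theory.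

(** * Mollification *)

Section bump.
Variable R : realType.
Implicit Types s t h : R.

Lemma sqr_normr s : `|s| ^+ 2 = s ^+ 2.
Proof. by rewrite real_normK// num_real. Qed.

(** A kernel with Lipschitz derivative is smooth enough for the sequel, and for this one every
    estimate is a polynomial inequality. *)
Definition bump s : R := Num.max 0 (1 - s ^+ 2) ^+ 2.
Definition dbump s : R := - 4 * s * Num.max 0 (1 - s ^+ 2).

Lemma bump_cases s :
  (`|s| <= 1 /\ bump s = (1 - s ^+ 2) ^+ 2 /\ dbump s = - 4 * s * (1 - s ^+ 2)) \/
  (1 <= `|s| /\ bump s = 0 /\ dbump s = 0).
Proof.
rewrite /bump /dbump; have [s1|s1] := leP `|s| 1; [left|right].
  have s2 : 0 <= 1 - s ^+ 2 by rewrite subr_ge0 -sqr_normr expr_le1.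
  by rewrite max_r.
have s2 : 1 - s ^+ 2 <= 0.
  by rewrite subr_le0 -sqr_normr exprn_ege1// ltW.
by rewrite max_l// expr0n mulr0 ltW.
Qed.

Lemma bump_ge0 s : 0 <= bump s.
Proof. exact: sqr_ge0. Qed.

Lemma bump_le1 s : bump s <= 1.
Proof.
have [[+ [-> _]]|[_ [-> _]]] := bump_cases s; last by [].
rewrite ler_norml => /andP[h1 h2].
have S : 0 <= s ^+ 2 <= 1 by nra.
by move: S; set S := s ^+ 2 => /andP[S0 S1]; nra.
Qed.

Lemma bumpN s : bump (- s) = bump s.
Proof. by rewrite /bump sqrrN. Qed.

Lemma dbump_le s : `|dbump s / 4| <= 1.
Proof.
have [[+ [_ ->]]|[_ [_ ->]]] := bump_cases s; last by rewrite mul0r normr0.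
move=> s1; rewrite (_ : _ / 4 = - (s * (1 - s ^+ 2))); last by field.
rewrite normrN normrM mulr_ile1// ler_norml.
have S0 := sqr_ge0 s; have S1 : s ^+ 2 <= 1 by rewrite -sqr_normr expr_le1.
by apply/andP; split; lra.
Qed.

Lemma bump_eq0 s : 1 <= `|s| -> bump s = 0.
Proof.
have [[s1 [-> _]]|[_ [-> _]]//] := bump_cases s.
move=> s1'; have : `|s| = 1 by apply/le_anti; rewrite s1 s1'.
by rewrite -sqr_normr => ->; rewrite expr1n subrr expr0n.
Qed.

Lemma bump_gt0 s : `|s| < 1 -> 0 < bump s.
Proof.
have [[_ [-> _]]|[s1 _ s1']] := bump_cases s; last by move: s1; rewrite leNgt s1'.
move=> s1; rewrite exprn_gt0// subr_gt0 -sqr_normr expr_lt1//.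
Qed.

Lemma bump_lipschitz s t : `|bump s - bump t| <= 4 * `|s - t|.
Proof.
(* This leaves one genuine mixed case, [s] outside and [t] inside [-1, 1], where 1 - |t| <= |s - t|;
   the opposite one forces |s| = 1. *)
wlog st : s t / `|t| <= `|s|.
  move=> H; have [|/ltW] := leP `|t| `|s|; first exact: H.
  by move=> h; rewrite distrC (distrC s) H.
have n := ler_dist_dist s t.
have [[s1 [-> _]]|[s1 [-> _]]] := bump_cases s;
  have [[t1 [-> _]]|[t1 [-> _]]] := bump_cases t.
- rewrite (_ : _ - _ = (t - s) * ((s + t) * (2 - s ^+ 2 - t ^+ 2))); last by ring.
  rewrite normrM distrC mulrC ler_wpM2r//.
  move: s1 t1; rewrite !ler_norml => /andP[a b] /andP[c' e].
  have S : 0 <= s ^+ 2 <= 1 by nra.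
  have T : 0 <= t ^+ 2 <= 1 by nra.
  move: S T; set S := s ^+ 2; set T := t ^+ 2 => /andP[S0 S1] /andP[T0 T1].
  by apply/andP; split; nra.
- have s1' : `|s| = 1 by apply/le_anti; rewrite s1 (le_trans t1).
  by rewrite -sqr_normr s1' expr1n subrr expr0n subrr normr0 mulr_ge0.
- rewrite sub0r normrN -sqr_normr; set T := `|t| in t1 st n *.
  have T0 : 0 <= T by exact: normr_ge0.
  rewrite ger0_norm ?sqr_ge0//.
  have : 1 - T <= `|s - t| by rewrite (le_trans _ n)// ger0_norm; lra.
  have : (1 - T) * ((1 - T) * (1 + T) ^+ 2) <= (1 - T) * 4.
    by apply: ler_wpM2l; [lra|nra].
  rewrite (_ : (1 - T) * (_ * _) = (1 - T ^+ 2) ^+ 2); last by ring.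
  lra.
- by rewrite subrr normr0 mulr_ge0.
Qed.

Lemma dbump_lipschitz s t : `|dbump s - dbump t| <= 8 * `|s - t|.
Proof.
wlog st : s t / `|t| <= `|s|.
  move=> H; have [|/ltW] := leP `|t| `|s|; first exact: H.
  by move=> h; rewrite distrC (distrC s) H.
have n := ler_dist_dist s t.
have [[s1 [_ ->]]|[s1 [_ ->]]] := bump_cases s;
  have [[t1 [_ ->]]|[t1 [_ ->]]] := bump_cases t.
- rewrite (_ : _ - _ = (s - t) * (4 * (s ^+ 2 + s * t + t ^+ 2 - 1))); last by ring.
  rewrite normrM mulrC ler_wpM2r//.
  move: s1 t1; rewrite !ler_norml => /andP[a b] /andP[c' e].
  by apply/andP; split; nra.
- have s1' : `|s| = 1 by apply/le_anti; rewrite s1 (le_trans t1).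
  by rewrite -sqr_normr s1' expr1n subrr mulr0 subrr normr0 mulr_ge0.
- rewrite sub0r normrN -sqr_normr !normrM normrN; set T := `|t| in t1 st n *.
  have T0 : 0 <= T by exact: normr_ge0.
  rewrite (ger0_norm (_ : 0 <= 1 - T ^+ 2)); last by nra.
  rewrite (@ger0_norm _ 4)//.
  have : 1 - T <= `|s - t| by rewrite (le_trans _ n)// ger0_norm; lra.
  have : (1 - T) * (4 * (T * (1 + T))) <= (1 - T) * 8.
    by apply: ler_wpM2l; [lra|nra].
  rewrite (_ : (1 - T) * (4 * _) = 4 * T * (1 - T ^+ 2)); last by ring.
  lra.
- by rewrite subrr normr0 mulr_ge0.
Qed.

(** Taylor's formula for the square of the positive part, whose derivative 2 max(0, r) is
    2-Lipschitz. *)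
Lemma sqr_max_remainder (r a : R) :
  `|Num.max 0 (r + a) ^+ 2 - Num.max 0 r ^+ 2 - 2 * Num.max 0 r * a| <= a ^+ 2.
Proof.
have [r0|r0] := leP 0 r; have [ra|ra] := leP 0 (r + a);
  rewrite ?(max_r r0) ?(max_l (ltW r0)) ?(max_r ra) ?(max_l (ltW ra)) ler_norml;
  apply/andP; split; nra.
Qed.

(** Apply [sqr_max_remainder] with a = - 2 s h - h^2. For |s| <= 2 one has |a| <= 5 |h|, which gives
    25 h^2; the term - h^2 of [a], multiplied by 2 P <= 2, adds 2 h^2. For |s| > 2 everything
    vanishes. *)
Lemma bump_remainder s h : `|h| <= 1 ->
  `|bump (s + h) - bump s - h * dbump s| <= 27 * h ^+ 2.
Proof.
move=> h1; have [s2|s2] := leP `|s| 2; last first.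
  have b0 : bump (s + h) = 0.
    apply: bump_eq0; have := ler_dist_normD s (- h); rewrite ?opprK normrN.
    have := lerB_dist s (- h); rewrite opprK normrN; lra.
  have [[s1 _]|[_ [-> ->]]] := bump_cases s; first by lra.
  by rewrite b0 mulr0 !subr0 normr0 mulr_ge0// sqr_ge0.
have := sqr_max_remainder (1 - s ^+ 2) (- 2 * s * h - h ^+ 2).
rewrite /bump (_ : 1 - s ^+ 2 + _ = 1 - (s + h) ^+ 2); last by ring.
set A := Num.max 0 (1 - (s + h) ^+ 2); set P := Num.max 0 (1 - s ^+ 2).
have P0 : 0 <= P by rewrite le_max lexx.
have P1 : P <= 1 by rewrite ge_max ler01 /=; have := sqr_ge0 s; lra.
have -> : dbump s = - 4 * s * P by [].
have : (- 2 * s * h - h ^+ 2) ^+ 2 <= 25 * h ^+ 2.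
  move: s2 h1; rewrite !ler_norml => /andP[s1 s2] /andP[h1 h2].
  have H0 := sqr_ge0 h.
  rewrite (_ : (_ - _) ^+ 2 = (2 * s + h) ^+ 2 * h ^+ 2); last by ring.
  by apply: ler_wpM2r => //; nra.
have : 0 <= P * h ^+ 2 <= h ^+ 2.
  by rewrite mulr_ge0 ?sqr_ge0//= ler_piMl// sqr_ge0.
rewrite !ler_norml => /andP[a1 a2] b /andP[c1 c2].
by apply/andP; split; lra.
Qed.

(** A uniform quadratic remainder survives integration against an integrable function, so
    derivatives are passed under the integral sign in this form. *)
Lemma quad_remainder_is_derive (W : normedModType R) (f : W -> R) (x v : W)
    (l L dl : R) : 0 < dl -> (forall h : R, `|h| <= dl ->
  `|f (x + h *: v) - f x - h * l| <= L * h ^+ 2) -> is_derive x v f l.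
Proof.
move=> dl0 hf.
have L0 : 0 <= L.
  have d2 : 0 < dl ^+ 2 by rewrite exprn_gt0.
  rewrite -(pmulr_lge0 L d2); apply: le_trans (hf dl _); first exact: normr_ge0.
  by rewrite ger0_norm// ltW.
suff H : (h^-1 *: ((f \o shift x) (h *: v) - f x) @[h --> (0 : R)^'] --> l).
  split; first by apply/cvg_ex; exists l.
  exact: (cvg_lim (@Rhausdorff R) H).
apply/cvgrPdist_le => eps eps0.
near=> h.
have h0 : h != 0 by near: h; exact: nbhs_dnbhs_neq.
have hd : `|h| <= dl.
  near: h; apply: dnbhs0_le => //.
have he : `|h| <= eps / (L + 1).
  near: h; apply: dnbhs0_le; rewrite divr_gt0// ltr_wpDl//.
have := hf h hd; rewrite /= [h *: v + x]addrC => H.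
rewrite distrC -(ler_pM2l (_ : 0 < `|h|)) ?normr_gt0//.
rewrite -normrM mulrBr [h^-1 *: _]/(h^-1 * _) mulVKf//.
apply: le_trans H _.
rewrite -[h ^+ 2]sqr_normr expr2 mulrA [L * _]mulrC -mulrA ler_wpM2l//.
move: he; rewrite ler_pdivlMr ?ltr_wpDl// => he.
by apply: le_trans he; rewrite mulrC ler_wpM2l// lerDl.
Unshelve. all: by end_near. Qed.

End bump.

(** * Mollifiers on R^d as products of one-dimensional bumps *)

Section mollifier_definition.
Variables (R : realType) (d : nat).
Local Notation V := 'rV[R]_d.
Local Notation lam := (leb R d).
Local Notation e := (@ebasis R d).
Implicit Types (k : V -> R) (dk : 'I_d -> V -> R) (x y : V) (j : 'I_d) (m : R).

(** The quadratic remainder and the Lipschitz bound on [dk] are recorded because they pass to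
    convolutions, and so make these C^1. Evenness makes convolution self-adjoint. *)
Record mollifier k dk : Prop := Mollifier {
  mol_ge0 : forall x, 0 <= k x ;
  mol_even : forall x, k (- x) = k x ;
  mol_Cc1 : Cc1 k dk ;
  mol_remainder : exists L dl, 0 < dl /\ forall j x h, `|h| <= dl ->
    `|k (x + h *: e j) - k x - h * dk j x| <= L * h ^+ 2 ;
  mol_dlipschitz : exists2 L, 0 <= L & forall j x y,
    `|dk j x - dk j y| <= L * \sum_i `|x 0 i - y 0 i| ;
  mol_integ : integ k = 1 }.

Lemma prod_bounds (I : finType) (P : pred I) (a : I -> R) :
  (forall i, `|a i| <= 1) -> `|\prod_(i | P i) a i| <= 1.
Proof. by move=> a1; rewrite normr_prod; apply: prodr_ile1 => i _; rewrite normr_ge0 a1. Qed.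

Lemma prod_lipschitz n (a b : 'I_n -> R) :
  (forall i, `|a i| <= 1) -> (forall i, `|b i| <= 1) ->
  `|\prod_i a i - \prod_i b i| <= \sum_i `|a i - b i|.
Proof.
elim: n a b => [|n IH] a b a1 b1; first by rewrite !big_ord0 subrr normr0.
rewrite !big_ord_recl.
set A := \prod_(i < n) _; set B := \prod_(i < n) b _.
rewrite (_ : _ - _ = (a ord0 - b ord0) * A + b ord0 * (A - B)); last by ring.
apply: le_trans (ler_normD _ _) _; rewrite !normrM; apply: lerD.
  by rewrite ler_piMr// /A prod_bounds.
apply: le_trans (IH (fun i => a (lift ord0 i)) (fun i => b (lift ord0 i)) _ _) => //.
by rewrite ler_piMl.
Qed.

Definition bump_rV m x : R := \prod_(i < d) bump (m * x 0 i).

(** The constant 4 is taken out of [dbump] so that each factor of the product has absolute value at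
    most 1, as [prod_lipschitz] requires. *)
Definition dbump_rV m j x : R :=
  4 * m * \prod_(i < d) (if i == j then dbump (m * x 0 i) / 4 else bump (m * x 0 i)).

Lemma bump_norm_le1 (s : R) : `|bump s| <= 1.
Proof. by rewrite ger0_norm ?bump_le1// bump_ge0. Qed.

Lemma bump_rV_ge0 m x : 0 <= bump_rV m x.
Proof. by apply: prodr_ge0 => i _; exact: bump_ge0. Qed.

Lemma bump_rVN m x : bump_rV m (- x) = bump_rV m x.
Proof. by apply: eq_bigr => i _; rewrite mxE mulrN bumpN. Qed.

Lemma bump_rV_vanishes m : 0 < m -> vanishes_off m^-1 (bump_rV m).
Proof.
move=> m0 x /cubeP/existsNP[i /negP]; rewrite -ltNge => xi.
rewrite /bump_rV (bigD1 i)//= bump_eq0 ?mul0r//.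
rewrite normrM gtr0_norm// mulrC -ler_pdivrMr// div1r; exact: ltW.
Qed.

Lemma bump_rV_remainder m j x h : 0 < m -> `|h| <= m^-1 ->
  `|bump_rV m (x + h *: e j) - bump_rV m x - h * dbump_rV m j x| <=
  (27 * m ^+ 2) * h ^+ 2.
Proof.
move=> m0 hm; rewrite /bump_rV /dbump_rV.
rewrite (bigD1 j)//= [X in _ - X - _](bigD1 j)//= [X in 4 * m * X](bigD1 j)//= eqxx.
have -> : \prod_(i < d | i != j) bump (m * (x + h *: e j) 0 i) =
    \prod_(i < d | i != j) bump (m * x 0 i).
  by apply: eq_bigr => i ij; rewrite !mxE (negbTE ij) mulr0 addr0.
have -> : \prod_(i < d | i != j) (if i == j then dbump (m * x 0 i) / 4
    else bump (m * x 0 i)) = \prod_(i < d | i != j) bump (m * x 0 i).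
  by apply: eq_bigr => i ij; rewrite (negbTE ij).
set P := \prod_(i < d | _) _.
have -> : (x + h *: e j) 0 j = x 0 j + h by rewrite !mxE !eqxx mulr1.
rewrite mulrDr; set b := bump _; set c := bump _; set D := dbump _.
rewrite (_ : _ - _ = (b - c - m * h * D) * P); last by field.
rewrite normrM; apply: (@le_trans _ _ `|b - c - m * h * D|).
  by rewrite ler_piMr// prod_bounds// => i; exact: bump_norm_le1.
rewrite -[leRHS]mulrA -exprMn; apply: bump_remainder.
by rewrite normrM gtr0_norm// mulrC -ler_pdivlMr// div1r.
Qed.

Lemma dbump_rV_lipschitz m j x y : 0 < m ->
  `|dbump_rV m j x - dbump_rV m j y| <= (16 * m ^+ 2) * \sum_i `|x 0 i - y 0 i|.
Proof.
move=> m0; rewrite /dbump_rV -mulrBr normrM gtr0_norm; last by rewrite mulr_gt0.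
rewrite (_ : 16 * m ^+ 2 = 4 * m * (4 * m)); last by ring.
rewrite -mulrA ler_wpM2l//; first by rewrite mulr_ge0// ltW.
have b1 (z : V) i : `|if i == j then dbump (m * z 0 i) / 4 else bump (m * z 0 i)| <= 1.
  by case: ifP => _; [exact: dbump_le|exact: bump_norm_le1].
apply: le_trans (prod_lipschitz (b1 x) (b1 y)) _.
rewrite mulr_sumr; apply: ler_sum => i _.
have E : `|m * x 0 i - m * y 0 i| = m * `|x 0 i - y 0 i|.
  by rewrite -mulrBr normrM gtr0_norm.
case: ifP => _; last by rewrite -mulrA -E; exact: bump_lipschitz.
rewrite -mulrBl normrM (@ger0_norm _ 4^-1)//.
have := dbump_lipschitz (m * x 0 i) (m * y 0 i); rewrite E.
have := normr_ge0 (x 0 i - y 0 i).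
set N := `|x 0 i - _|; have : 0 <= m * N by rewrite mulr_ge0 ?normr_ge0// ltW.
by rewrite -[4 * m * N]mulrA; lra.
Qed.

Lemma bump_rV_Cc1 m : 0 < m -> Cc1 (bump_rV m) (dbump_rV m).
Proof.
move=> m0; apply: (@C1_of_partials _ _ m^-1).
- move=> j x; apply: (@quad_remainder_is_derive _ _ _ _ _ _ (27 * m ^+ 2) m^-1).
    by rewrite invr_gt0.
  by move=> h hm; exact: bump_rV_remainder.
- move=> j; apply: (@lipschitz_continuous_rV _ _ _ (16 * m ^+ 2)).
    by rewrite mulr_ge0// sqr_ge0.
  by move=> x y; exact: dbump_rV_lipschitz.
- exact: bump_rV_vanishes.
Qed.

(** Countably many translates of a cube by rational vectors cover the space; were the cube null, so
    would be every set. *)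
Lemma cube_gt0 (A : set V) : (0 < lam A)%E -> forall r, 0 < r ->
  (0 < lam (@cube R d r))%E.
Proof.
move=> A0 r r0; rewrite lt_neqAle outer_measure_ge0 andbT eq_sym.
apply: contraTneq A0 => C0; rewrite -leNgt.
pose T (q : 'rV[rat]_d) : set V := (fun x => x + map_mx (@ratr R) q) @^-1` cube r.
pose F (n : nat) : set V := if unpickle n is Some q then T q else set0.
apply: (@le_trans _ _ (lam (\bigcup_n F n))).
  apply: le_outer_measure => x _.
  have hq i : exists q : rat, `|x 0 i + ratr q| <= r.
    have [|q] := @rat_in_itvoo R (- x 0 i - r) (- x 0 i + r); first lra.
    rewrite in_itv/= => /andP[q1 q2]; exists q; rewrite ler_norml.
    by apply/andP; split; lra.
  have [q hq'] := choice hq.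
  exists (pickle (\row_i q i)) => //; rewrite /F pickleK.
  by apply/cubeP => i; rewrite !mxE.
apply: le_trans (outer_measure_sigma_subadditive _ _) _.
rewrite eseries0// => n _ _; rewrite /F; case: unpickle => [q|].
  by apply: etrans C0; exact: lebesgue_outer_shift.
by rewrite outer_measure0.
Qed.

(** On the cube of radius 1 / (2 m) each factor is at least [bump] at 1/2. *)
Lemma bump_rV_integ_gt0 m (A : set V) : (0 < lam A)%E -> 0 < m ->
  0 < integ (bump_rV m).
Proof.
move=> A0 m0; have [[cb _ _] _] := bump_rV_Cc1 m0.
pose r := (2 * m)^-1.
have r0 : 0 < r by rewrite invr_gt0 mulr_gt0.
have C0 := cube_gt0 A0 r0.
pose c := bump (2^-1 : R) ^+ d.
have h2 : `|2^-1 : R| < 1 by rewrite ger0_norm// invf_lt1// ltr1n.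
apply: (@lt_le_trans _ _ (c * fine (lam (@cube R d r)))).
  rewrite mulr_gt0//; first by rewrite exprn_gt0// bump_gt0.
  by rewrite fine_gt0// C0 cube_lty.
have ib : itg (bump_rV m).
  exact: continuous_vanishes_off_itg cb (bump_rV_vanishes m0).
have mc := @measurable_cube R d r.
have ic : itg (\1_(@cube R d r)) by apply: itg_indic => //; exact: cube_lty.
rewrite -integ_indic// -integZ//; apply: integ_le => //; first exact: itgZ.
move=> x; rewrite indicE; have [|_] := boolP (x \in _); last first.
  by rewrite mulr0 bump_rV_ge0.
rewrite inE => /cubeP xr; rewrite mulr1 /c -[X in _ ^+ X](card_ord d) -prodr_const.
apply: ler_prod => i _; rewrite bump_ge0 /=.
have m2 : `|m * x 0 i| <= 2^-1.
  rewrite normrM gtr0_norm// mulrC -ler_pdivlMr//.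
  by apply: le_trans (xr i) _; rewrite /r invfM.
rewrite /bump; have s2 : 0 <= (m * x 0 i) ^+ 2 <= 2^-1 ^+ 2.
  rewrite sqr_ge0 /= -sqr_normr.
  by rewrite -(sqr_normr (2^-1)) ler_sqr ?nnegrE// (@ger0_norm _ 2^-1)//.
have Q : (2^-1 : R) ^+ 2 <= 1 by rewrite expr_le1// invf_le1// ler1n.
move: s2; set S := _ ^+ 2; set T := 2^-1 ^+ 2 in Q * => /andP[S0 S1].
rewrite !max_r; [|lra|lra].
by rewrite ler_sqr ?nnegrE; lra.
Qed.

Lemma mollifier_exists (A : set V) r : (0 < lam A)%E -> 0 < r ->
  exists k dk, mollifier k dk /\ vanishes_off r k.
Proof.
move=> A0 r0; pose m := r^-1.
have m0 : 0 < m by rewrite invr_gt0.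
have Z0 := bump_rV_integ_gt0 A0 m0.
set Z := integ _ in Z0; pose c := Z^-1.
have c0 : 0 < c by rewrite invr_gt0.
have [[cb bd cdb] _] := bump_rV_Cc1 m0.
have kv : vanishes_off r (fun x => c * bump_rV m x).
  by move=> x xr; rewrite bump_rV_vanishes ?mulr0// invrK.
have rem j x h : `|h| <= m^-1 -> `|c * bump_rV m (x + h *: e j) - c * bump_rV m x -
    h * (c * dbump_rV m j x)| <= c * (27 * m ^+ 2) * h ^+ 2.
  move=> hm; rewrite [h * (c * _)]mulrCA -!mulrBr normrM gtr0_norm// -mulrA.
  by rewrite ler_pM2l//; exact: bump_rV_remainder.
exists (fun x => c * bump_rV m x), (fun j x => c * dbump_rV m j x); split=> //.
split.
- by move=> x; rewrite mulr_ge0 ?bump_rV_ge0// ltW.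
- by move=> x; rewrite bump_rVN.
- apply: (@C1_of_partials _ _ r) => //.
  by move=> j; apply: continuousM_rV => //; exact: cst_continuous.
- by exists (c * (27 * m ^+ 2)), m^-1; rewrite invr_gt0.
- exists (c * (16 * m ^+ 2)); first by rewrite !mulr_ge0 ?sqr_ge0// ltW.
  move=> j x y; rewrite -mulrBr normrM gtr0_norm// -mulrA ler_pM2l//.
  exact: dbump_rV_lipschitz.
- rewrite integZ ?mulVf ?gt_eqF//.
  exact: continuous_vanishes_off_itg cb (bump_rV_vanishes m0).
Qed.

End mollifier_definition.

(** * Convolution with a fixed mollifier *)

Section convolution.
Variables (R : realType) (d : nat).
Local Notation V := 'rV[R]_d.
Local Notation e := (@ebasis R d).
Local Notation tv := (@Defs.total_variation R d).
Implicit Types (u w g : V -> R) (x y : V) (j : 'I_d).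

Definition conv w u x : R := integ (fun y => u y * w (x - y)).

Lemma measf_reflect w x : continuous w -> measf (fun y => w (x - y)).
Proof.
move=> cw; apply: continuous_measurable_rV => y.
apply: (continuous_comp (f := fun y => x - y)); last exact: cw.
by apply: continuousB; [exact: cst_continuous|exact: cvg_id].
Qed.

Lemma conv_itg w u x (M : R) : itg u -> continuous w -> (forall x, `|w x| <= M) ->
  itg (fun y => u y * w (x - y)).
Proof.
move=> ui cw wM; apply: (itg_bounded_mul (M := M)) => //.
exact: measf_reflect.
Qed.

Lemma conv_bounded w u x (M : R) : itg u -> continuous w ->
  (forall x, `|w x| <= M) -> `|conv w u x| <= M * integ (fun y => `|u y|).
Proof.
move=> ui cw wM; have i := conv_itg x ui cw wM.
apply: le_trans (integ_norm i) _; rewrite -integZ; last exact: itg_norm.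
apply: integ_le; [exact: itg_norm|exact/itgZ/itg_norm|move=> y].
by rewrite normrM mulrC ler_wpM2r.
Qed.

Lemma conv_lipschitz w u x y (M L : R) : itg u -> continuous w ->
  (forall x, `|w x| <= M) ->
  (forall x y, `|w x - w y| <= L * \sum_i `|x 0 i - y 0 i|) ->
  `|conv w u x - conv w u y| <= L * integ (fun y => `|u y|) * \sum_i `|x 0 i - y 0 i|.
Proof.
move=> ui cw wM wL; have ix := conv_itg x ui cw wM; have iy := conv_itg y ui cw wM.
rewrite /conv -integB// mulrAC -integZ; last exact: itg_norm.
apply: le_trans (integ_norm (itgB ix iy)) _.
apply: integ_le; [exact/itg_norm/itgB|exact/itgZ/itg_norm|move=> z].
rewrite -mulrBr normrM mulrC ler_wpM2r//; apply: le_trans (wL _ _) _.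
by rewrite le_eqVlt; apply/orP; left; apply/eqP; congr (_ * _);
  apply: eq_bigr => i _; rewrite !mxE; congr `|_|; ring.
Qed.

Section fixed_mollifier.
Variables (k : V -> R) (dk : 'I_d -> V -> R).
Hypothesis mk : mollifier k dk.

Let ck : continuous k. Proof. by have [[]] := mol_Cc1 mk. Qed.

Let cdk j : continuous (dk j). Proof. by have [[_ _ +] _] := mol_Cc1 mk; exact. Qed.

Let k_bounded : exists2 M, 0 <= M & forall x, `|k x| <= M.
Proof. exact: Cc1_bounded (mol_Cc1 mk). Qed.

Let dk_bounded j : exists2 M, 0 <= M & forall x, `|dk j x| <= M.
Proof. exact: Cc1_partial_bounded (mol_Cc1 mk). Qed.

Let k_itg : itg k.
Proof. by have [_ [r kr]] := mol_Cc1 mk; exact: continuous_vanishes_off_itg ck kr. Qed.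

Let k_reflect x y : k (x - y) = k (y - x).
Proof. by rewrite -opprB (mol_even mk). Qed.

Lemma mollifier_conv_itg u x : itg u -> itg (fun y => u y * k (x - y)).
Proof. by move=> ui; have [M _ kM] := k_bounded; exact: (conv_itg x ui ck kM). Qed.

Lemma conv_partial_itg u x j : itg u -> itg (fun y => u y * dk j (x - y)).
Proof. by move=> ui; have [M _ kM] := dk_bounded j; exact: (conv_itg x ui (@cdk j) kM). Qed.

Lemma integ_mollifier_reflect x : integ (fun y => k (x - y)) = 1.
Proof.
rewrite -(mol_integ mk) -(integ_shift (- x) k_itg).
by apply: eq_integ => y; exact: k_reflect.
Qed.

Lemma mollifier_reflect_itg x : itg (fun y => k (x - y)).
Proof.
have := itg_shift (- x) k_itg; congr (itg _); apply/funext => y; exact: k_reflect.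
Qed.

(** The remainder of the kernel, uniform in the base point, is integrated against |u|. *)
Lemma conv_remainder u : itg u -> exists L dl, 0 < dl /\ forall j x h, `|h| <= dl ->
  `|conv k u (x + h *: e j) - conv k u x - h * conv (dk j) u x| <= L * h ^+ 2.
Proof.
move=> ui; have [L [dl [dl0 kL]]] := mol_remainder mk.
exists (L * integ (fun y => `|u y|)), dl; split=> // j x h hd.
have i1 := mollifier_conv_itg (x + h *: e j) ui.
have i2 := mollifier_conv_itg x ui.
have i3 := conv_partial_itg x j ui.
rewrite /conv -integB// -integZ// -integB; [|exact: itgB|exact: itgZ].
rewrite mulrAC -integZ; last exact: itg_norm.
have i4 : itg (fun y => u y * k (x + h *: e j - y) - u y * k (x - y) -
    h * (u y * dk j (x - y))).
  by apply: itgB; [exact: itgB|exact: itgZ].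
apply: le_trans (integ_norm i4) _.
apply: integ_le; [exact: itg_norm|exact/itgZ/itg_norm|move=> y].
rewrite [h * (_ * _)]mulrCA -!mulrBr normrM mulrC ler_wpM2r//.
have -> : x + h *: e j - y = x - y + h *: e j by rewrite addrAC.
exact: kL.
Qed.

Lemma conv_C1 u : itg u -> C1 (conv k u) (fun j => conv (dk j) u).
Proof.
move=> ui; have [M M0 kM] := k_bounded.
have N0 : 0 <= integ (fun y => `|u y|) by exact: integ_ge0.
split.
- have hD j : exists D, forall x, `|dk j x| <= D.
    by have [D _ ?] := dk_bounded j; exists D.
  have [D hD'] := choice hD.
  have DS j x : `|dk j x| <= \sum_j `|D j|.
    rewrite (le_trans (hD' j x))// (le_trans (ler_norm _))//.
    by rewrite (bigD1 j)//= lerDl sumr_ge0.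
  have [[_ kd _] _] := mol_Cc1 mk.
  apply: (@lipschitz_continuous_rV _ _ _
    ((\sum_j `|D j|) * integ (fun y => `|u y|))).
    by rewrite mulr_ge0// sumr_ge0.
  move=> x y; apply: (@conv_lipschitz k u x y M) => //.
  exact: partial_lipschitz.
- have [L [dl [dl0 kL]]] := conv_remainder ui.
  by move=> j x; apply: (quad_remainder_is_derive dl0) => h; exact: kL.
- move=> j; have [L L0 kL] := mol_dlipschitz mk; have [D _ kD] := dk_bounded j.
  apply: (@lipschitz_continuous_rV _ _ _ (L * integ (fun y => `|u y|))).
    exact: mulr_ge0.
  by move=> x y; apply: (@conv_lipschitz (dk j) u x y D).
Qed.

(** The factor [g] serves both applications: [g] = 1 for the L^1 bound by Tonelli, a general [g] for
    the self-adjointness by Fubini. *)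
Lemma conv_measurable2 u g : measf u -> measf g ->
  measurable_fun [set: Ld R d * Ld R d]
    (fun z => u z.2 * k ((z.1 : V) - (z.2 : V)) * g z.1).
Proof.
move=> mu mg; apply: measurable_funM; last exact: (measurableT_comp mg measurable_fst).
apply: measurable_funM; first exact: (measurableT_comp mu measurable_snd).
apply: (continuous_measurable_comp (S := fun z : Ld R d * Ld R d =>
  (z.1 : V) - (z.2 : V))) => // i.
rewrite (_ : (fun z => _) = (fun z : Ld R d * Ld R d =>
  (z.1 : V) 0 i - (z.2 : V) 0 i)); last by apply/funext => z; rewrite !mxE.
apply: measurable_funB.
- exact: (measurableT_comp (measurable_coord i) measurable_fst).
- exact: (measurableT_comp (measurable_coord i) measurable_snd).
Qed.

Lemma conv_norm_itg u : itg u -> itg (conv k (fun y => `|u y|)) /\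
  integ (conv k (fun y => `|u y|)) = integ (fun y => `|u y|).
Proof.
move=> ui; have ni := itg_norm ui.
have m := conv_measurable2 (itg_measf ni) (@measf_cst R d 1).
have g0 x y : 0 <= `|u y| * k (x - y) * 1 by rewrite !mulr_ge0// (mol_ge0 mk).
have := integ_Tonelli (f := fun x y => `|u y| * k (x - y) * 1) m g0.
rewrite (eq_integral (fun x : Ld R d => (conv k (fun y => `|u y|) x)%:E)); last first.
  move=> x _; under eq_integral do rewrite mulr1.
  by rewrite (EFin_integ (mollifier_conv_itg x ni)).
rewrite [RHS in (_ = RHS -> _)](eq_integral (fun y : Ld R d => (`|u y|)%:E)); last first.
  move=> y _; under eq_integral do rewrite mulr1.
  have ki : itg (fun x => k (x - y)) by exact: itg_shift.
  by rewrite (EFin_integ (itgZ (`|u y|) ki)) integZ// integ_shift// (mol_integ mk) mulr1.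
rewrite (EFin_integ ni) => E.
have mc : measf (conv k (fun y => `|u y|)).
  by apply: continuous_measurable_rV; have [] := conv_C1 ni.
have c0 x : 0 <= conv k (fun y => `|u y|) x.
  by apply: integ_ge0 => y; rewrite mulr_ge0// (mol_ge0 mk).
have ci : itg (conv k (fun y => `|u y|)).
  apply: itgP => //.
  under eq_integral => x _ do rewrite ger0_norm//.
  by rewrite E ltry.
by split=> //; apply: EFin_inj; rewrite -E EFin_integ.
Qed.

Lemma conv_itg_L1 u : itg u -> itg (conv k u) /\
  integ (fun x => `|conv k u x|) <= integ (fun x => `|u x|).
Proof.
move=> ui; have [ci cE] := conv_norm_itg ui.
have le x : `|conv k u x| <= conv k (fun y => `|u y|) x.
  apply: le_trans (integ_norm (mollifier_conv_itg x ui)) _.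
  apply: integ_le; first exact/itg_norm/mollifier_conv_itg.
    exact/mollifier_conv_itg/itg_norm.
  by move=> y; rewrite normrM (ger0_norm (mol_ge0 mk _)).
have cc : itg (conv k u).
  apply: itg_le ci le.
  by apply: continuous_measurable_rV; have [] := conv_C1 ui.
by split=> //; rewrite -cE; apply: integ_le => //; exact: itg_norm.
Qed.

(** Fubini and the evenness of [k]. Absolute integrability holds because [conv k] of |u| is bounded
    and [g] is integrable. *)
Lemma integ_conv u g : itg u -> itg g ->
  integ (fun x => conv k u x * g x) = integ (fun y => u y * conv k g y).
Proof.
move=> ui gi; have ni := itg_norm ui; have [M M0 kM] := k_bounded.
have c x : itg (fun y => u y * k (x - y) * g x).
  have := itgZ (g x) (mollifier_conv_itg x ui); congr (itg _).
  by apply/funext => y; rewrite mulrC.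
have c' y : itg (fun x => u y * k (x - y) * g x).
  have := itgZ (u y) (mollifier_conv_itg y gi); congr (itg _).
  by apply/funext => x; rewrite k_reflect; ring.
have cM v x : itg v -> `|conv k v x| <= M * integ (fun y => `|v y|).
  by move=> vi; exact: conv_bounded.
have mc v : itg v -> measf (conv k v).
  by move=> vi; apply: continuous_measurable_rV; have [] := conv_C1 vi.
have i1 : itg (fun x => conv k u x * g x).
  have := itg_bounded_mul gi (mc _ ui) (fun x => cM _ x ui); congr (itg _).
  by apply/funext => x; rewrite mulrC.
have i2 : itg (fun y => u y * conv k g y).
  exact: itg_bounded_mul ui (mc _ gi) (fun x => cM _ x gi).
have := integral_Fubini (f := fun x y => u y * k (x - y) * g x)
  (conv_measurable2 (itg_measf ui) (itg_measf gi)).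
rewrite (eq_integral (fun x : Ld R d =>
  (`|g x| * conv k (fun y => `|u y|) x)%:E)); last first.
  move=> x _; rewrite (EFin_integ (f := fun y => `|u y * k (x - y) * g x|)); last first.
    exact: itg_norm.
  congr EFin; rewrite /conv -integZ; last exact: mollifier_conv_itg.
  apply: eq_integ => y; rewrite !normrM (ger0_norm (mol_ge0 mk _)); ring.
have i3 : itg (fun x => `|g x| * conv k (fun y => `|u y|) x).
  exact: itg_bounded_mul (itg_norm gi) (mc _ ni) (fun x => cM _ x ni).
rewrite (EFin_integ i3) ltry => /(_ isT).
rewrite (eq_integral (fun x : Ld R d => (conv k u x * g x)%:E)); last first.
  move=> x _; rewrite (EFin_integ (c x)); congr EFin.
  rewrite mulrC /conv -integZ; last exact: mollifier_conv_itg.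
  by apply: eq_integ => y; rewrite mulrC.
rewrite [RHS in (_ = RHS -> _)](eq_integral (fun y : Ld R d =>
    (u y * conv k g y)%:E)); last first.
  move=> y _; rewrite (EFin_integ (c' y)); congr EFin.
  rewrite /conv -integZ; last exact: mollifier_conv_itg.
  by apply: eq_integ => x; rewrite k_reflect; ring.
by rewrite (EFin_integ i1) (EFin_integ i2) => -[].
Qed.

Lemma mollifier_reflect_C1 x :
  C1 (fun y => k (x - y)) (fun j y => - dk j (x - y)).
Proof.
have cr (w : V -> R) : continuous w -> continuous (fun y => w (x - y)).
  move=> cw y; apply: (continuous_comp (f := fun y => x - y)); last exact: cw.
  by apply: continuousB; [exact: cst_continuous|exact: cvg_id].
split; first exact: cr.
- have [L [dl [dl0 kL]]] := mol_remainder mk.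
  move=> j y; apply: (@quad_remainder_is_derive _ _ _ _ _ _ L dl) => // h hd.
  have := kL j (x - y) (- h); rewrite normrN => /(_ hd).
  rewrite sqrrN scaleNr mulNr mulrN opprD addrA; exact.
- by move=> j y; apply: continuousN; exact: cr.
Qed.

(** Integration by parts: the integral of a partial derivative of y -> k (x - y) phi y is 0. *)
Lemma conv_partial phi dphi j x : Cc1 phi dphi ->
  conv (dk j) phi x = conv k (dphi j) x.
Proof.
move=> phic; have [[cp pd cdp] [r p0]] := phic.
have := integ_partial j (Cc1M (mollifier_reflect_C1 x) phic).
have pi := continuous_vanishes_off_itg cp p0.
have dpi := Cc1_partial_itg j phic.
have i1 := conv_partial_itg x j pi; have i2 := mollifier_conv_itg x dpi.
move=> E; apply/esym/eqP; rewrite -subr_eq0 /conv -integB//; apply/eqP.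
by rewrite -[RHS]E; apply: eq_integ => y; ring.
Qed.

Lemma conv_vanishes_off phi r s : vanishes_off r phi -> vanishes_off s k ->
  vanishes_off (r + s) (conv k phi).
Proof.
move=> p0 ks x xrs.
rewrite /conv -[RHS](integ0 R d); apply: eq_integ => y.
have [yr|yr] := pselect (cube r y); last by rewrite p0 ?mul0r.
rewrite ks ?mulr0// => xs; apply: xrs; apply/cubeP => i.
have /cubeP/(_ i) := xs; have /cubeP/(_ i) := yr; rewrite !mxE => h1 h2.
by rewrite -[x 0 i](subrKC (y 0 i)) (le_trans (ler_normD _ _))// lerD.
Qed.

(** By self-adjointness the mollifier moves onto the test field, and a mollified admissible field
    [psi] is admissible, with mollified divergence. *)
Lemma tv_conv_le u (c : R) : itg u -> (tv u <= c%:E)%E -> (tv (conv k u) <= c%:E)%E.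
Proof.
move=> ui uc; have [ci _] := conv_itg_L1 ui.
apply: tv_le => // phi pa; have phic := admissible_Cc1 pa.
rewrite integ_conv//; last exact: divergence_itg.
pose psi i := conv k (phi i); pose dpsi i j := conv (dk j) (phi i).
have pi i : itg (phi i).
  by have [[cp _ _] [r p0]] := phic i; exact: continuous_vanishes_off_itg cp p0.
have psic i : Cc1 (psi i) (dpsi i).
  split; first exact: conv_C1.
  have [_ [r p0]] := phic i; have [_ [s ks]] := mol_Cc1 mk.
  by exists (r + s); exact: conv_vanishes_off p0 ks.
(* With S = |psi x|^2, S is the average of the inner products of psi x with phi y, each at most (S +
   1) / 2; hence S <= (S + 1) / 2, that is S <= 1. *)
have psi1 x : \sum_i psi i x ^+ 2 <= 1.
  set S := \sum_i _.
  have E : S = integ (fun y => \sum_i psi i x * (phi i y * k (x - y))).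
    have [-> _] := integ_sum (f := fun i y => psi i x * (phi i y * k (x - y)))
      (fun i => itgZ (psi i x) (mollifier_conv_itg x (pi i))).
    apply: eq_bigr => i _; rewrite integZ//; exact: mollifier_conv_itg.
  have [_ si] := integ_sum (f := fun i y => psi i x * (phi i y * k (x - y)))
      (fun i => itgZ (psi i x) (mollifier_conv_itg x (pi i))).
  suff : S <= (S + 1) / 2 by lra.
  have -> : (S + 1) / 2 = integ (fun y => (S + 1) / 2 * k (x - y)).
    by rewrite integZ ?integ_mollifier_reflect ?mulr1//; exact: mollifier_reflect_itg.
  rewrite {1}E; apply: integ_le => //; first exact/itgZ/mollifier_reflect_itg.
  move=> y; under eq_bigr do rewrite mulrA.
  rewrite -mulr_suml ler_wpM2r ?(mol_ge0 mk)//.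
  have [_ /(_ y) p1] := pa.
  apply: (@le_trans _ _ ((S + \sum_i phi i y ^+ 2) / 2)); last by rewrite ler_pM2r ?invr_gt0// lerD2l.
  rewrite /S -big_split /= mulr_suml; apply: ler_sum => i _.
  have := sqr_ge0 (psi i x - phi i y); rewrite sqrrB; lra.
have psia := admissible_fieldP psic psi1.
have := tv_leP ui uc psia; congr (_ <= _); apply: eq_integ => y; congr (_ * _).
rewrite (divergenceE psic) /dpsi.
under eq_bigr => i _ do rewrite (conv_partial _ _ (phic i)).
rewrite /conv.
have [<- _] := integ_sum (f := fun i z => 'D_(e i) (phi i) z * k (y - z))
  (fun i => mollifier_conv_itg y (Cc1_partial_itg i (phic i))).
by apply: eq_integ => z; rewrite -mulr_suml.
Qed.

End fixed_mollifier.
End convolution.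

(** * L^1 convergence of mollifications, for bounded sets with null boundary *)

Section mollification_convergence.
Variables (R : realType) (d : nat).
Local Notation V := 'rV[R]_d.
Local Notation lam := (leb R d).
Implicit Types (u w k : V -> R) (x y a b : V) (A B : set V).

Definition L1_mollifiable u := forall eps, 0 < eps -> exists2 dl, 0 < dl &
  forall k dk r, mollifier k dk -> vanishes_off r k -> r <= dl ->
    integ (fun x => `|conv k u x - u x|) <= eps.

Lemma integ_norm_tri u1 u2 u3 : itg u1 -> itg u2 -> itg u3 ->
  integ (fun x => `|u1 x - u3 x|) <=
  integ (fun x => `|u1 x - u2 x|) + integ (fun x => `|u2 x - u3 x|).
Proof.
move=> i1 i2 i3.
have i12 : itg (fun x => `|u1 x - u2 x|) by exact/itg_norm/itgB.
have i23 : itg (fun x => `|u2 x - u3 x|) by exact/itg_norm/itgB.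
rewrite -integD//; apply: integ_le; [exact/itg_norm/itgB|exact: itgD|move=> x].
by apply: le_trans (ler_normD _ _); rewrite addrA subrK.
Qed.

Lemma convB k dk u w x : mollifier k dk -> itg u -> itg w ->
  conv k (fun y => u y - w y) x = conv k u x - conv k w x.
Proof.
move=> mk ui wi; rewrite /conv -integB; last 2 first.
- exact: (mollifier_conv_itg mk _ ui).
- exact: (mollifier_conv_itg mk _ wi).
by apply: eq_integ => y; rewrite mulrBl.
Qed.

(** Convolution contracts the L^1 norm, so the approximation error of [w] is paid twice and the
    mollification error once, a third of [eps] each. *)
Lemma L1_mollifiable_lim u : itg u -> (forall eps, 0 < eps -> exists w,
    [/\ itg w, L1_mollifiable w & integ (fun x => `|u x - w x|) <= eps]) ->
  L1_mollifiable u.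
Proof.
move=> ui h eps eps0; have e3 : 0 < eps / 3 by rewrite divr_gt0.
have [w [wi wm uw]] := h _ e3; have [dl dl0 hw] := wm _ e3.
exists dl => // k dk r mk kr rdl; have {}hw := hw k dk r mk kr rdl.
have [ci _] := conv_itg_L1 mk ui; have [cwi _] := conv_itg_L1 mk wi.
have [_] := conv_itg_L1 mk (itgB ui wi).
rewrite (@eq_integ _ _ _ (fun x => `|conv k u x - conv k w x|)); last first.
  by move=> x; rewrite (convB _ mk).
have := integ_norm_tri ci cwi ui; have := integ_norm_tri cwi wi ui.
have -> : integ (fun x => `|w x - u x|) = integ (fun x => `|u x - w x|).
  by apply: eq_integ => x; rewrite distrC.
lra_integ.
Qed.

Lemma L1_mollifiableD u w : itg u -> itg w ->
  L1_mollifiable u -> L1_mollifiable w -> L1_mollifiable (fun x => u x + w x).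
Proof.
move=> ui wi um wm eps eps0; have e2 : 0 < eps / 2 by rewrite divr_gt0.
have [d1 d10 h1] := um _ e2; have [d2 d20 h2] := wm _ e2.
exists (Num.min d1 d2); first by rewrite lt_min d10.
move=> k dk r mk kr; rewrite le_min => /andP[r1 r2].
have {}h1 := h1 k dk r mk kr r1; have {}h2 := h2 k dk r mk kr r2.
have [ci _] := conv_itg_L1 mk ui; have [cwi _] := conv_itg_L1 mk wi.
rewrite (@eq_integ _ _ _ (fun x => `|(conv k u x - u x) + (conv k w x - w x)|)); last first.
  move=> x; congr `|_|; rewrite /conv.
  rewrite (@eq_integ _ _ _ (fun y => u y * k (x - y) + w y * k (x - y))); last first.
    by move=> y; rewrite mulrDl.
  rewrite integD; [|exact: (mollifier_conv_itg mk _ ui)|exact: (mollifier_conv_itg mk _ wi)].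
  by ring.
have i1 := itgB ci ui; have i2 := itgB cwi wi.
apply: (@le_trans _ _ (integ (fun x => `|conv k u x - u x| + `|conv k w x - w x|))).
  apply: integ_le; [exact/itg_norm/itgD|by apply: itgD; exact: itg_norm|move=> x].
  exact: ler_normD.
by rewrite integD; [lra_integ|exact: itg_norm..].
Qed.

Lemma L1_mollifiableZ (c : R) u : itg u -> L1_mollifiable u ->
  L1_mollifiable (fun x => c * u x).
Proof.
move=> ui um eps eps0; have c0 : 0 < `|c| + 1 by rewrite ltr_wpDl.
have [dl dl0 h] := um _ (divr_gt0 eps0 c0).
exists dl => // k dk r mk kr rd; have {}h := h k dk r mk kr rd.
have [ci _] := conv_itg_L1 mk ui; have i := itg_norm (itgB ci ui).
rewrite (@eq_integ _ _ _ (fun x => `|c| * `|conv k u x - u x|)); last first.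
  move=> x; rewrite -normrM mulrBr; congr `|_ - _|.
  rewrite /conv -integZ; last exact: (mollifier_conv_itg mk _ ui).
  by apply: eq_integ => y; rewrite mulrA.
rewrite integZ//; apply: (@le_trans _ _ (`|c| * (eps / (`|c| + 1)))).
  exact: ler_wpM2l.
rewrite mulrCA -[leRHS]mulr1 ler_pM2l// ler_pdivrMr// mul1r lerDl//.
Qed.

(** Says that [x] is not a boundary point of [A]. *)
Definition locally_constant_at A x := exists2 dl, 0 < dl &
  forall y, (forall i, `|x 0 i - y 0 i| <= dl) -> (A y <-> A x).

Lemma locally_constant_setU A B x : locally_constant_at A x ->
  locally_constant_at B x -> locally_constant_at (A `|` B) x.
Proof.
move=> [d1 d10 h1] [d2 d20 h2]; exists (Num.min d1 d2); first by rewrite lt_min d10.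
move=> y xy.
have /h1 h1' : forall i, `|x 0 i - y 0 i| <= d1.
  by move=> i; have := xy i; rewrite le_min => /andP[].
have /h2 h2' : forall i, `|x 0 i - y 0 i| <= d2.
  by move=> i; have := xy i; rewrite le_min => /andP[].
by split=> -[/h1'|/h2']; [left|right|left|right].
Qed.

(** The points of the box where this fails lie on its faces, which are boxes of volume 0. *)
Lemma ae_locally_constant_box a b :
  {ae lam, forall x : Ld R d, locally_constant_at (box a b) x}.
Proof.
pose face (c : V) i := box (\row_j if j == i then c 0 i else a 0 j)
  (\row_j if j == i then c 0 i else b 0 j).
have ae_face (c : V) : {ae lam, forall x : Ld R d, forall i,
    box a b x -> (x : V) 0 i != c 0 i}.
  apply: filter_forall => i; exists (face c i); split.
  - exact: measurable_box.
  - apply/eqP; rewrite eq_le outer_measure_ge0 andbT.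
    apply: le_trans (lebesgue_outer_box_le _ _) _.
    by rewrite lee_fin /box_vol (bigD1 i)//= !mxE eqxx subrr maxxx mul0r.
  - move=> x /= /not_implyP[xab /negP]; rewrite negbK => /eqP xi j.
    by rewrite !mxE; case: eqP => [->|_]; [rewrite xi lexx|exact: xab].
apply: filterS2 (ae_face a) (ae_face b) => x na nb.
have [xab|] := pselect (box a b x); last first.
  move=> nx; have /existsNP[i /negP] := nx; rewrite negb_and -!ltNge => /orP[xa|xb].
    exists ((a 0 i - (x : V) 0 i) / 2); first by rewrite divr_gt0 ?subr_gt0.
    move=> y /(_ i); rewrite ler_norml => /andP[h1 h2]; split=> // /(_ i); lra.
  exists (((x : V) 0 i - b 0 i) / 2); first by rewrite divr_gt0 ?subr_gt0.
  move=> y /(_ i); rewrite ler_norml => /andP[h1 h2]; split=> // /(_ i); lra.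
pose dl i := Num.min ((x : V) 0 i - a 0 i) (b 0 i - (x : V) 0 i).
have dl0 i : 0 < dl i.
  have /andP[xa xb] := xab i.
  by rewrite lt_min !subr_gt0 !lt_neqAle xa xb eq_sym na// nb.
(* A positive radius below every [dl i], defined also when there are no coordinates. *)
exists (1 + \sum_i (dl i)^-1)^-1.
  by rewrite invr_gt0 ltr_pwDl// sumr_ge0// => i _; rewrite invr_ge0 ltW.
move=> y hy; split=> // _ i.
have : `|(x : V) 0 i - y 0 i| <= dl i.
  apply: le_trans (hy i) _; rewrite -[leRHS]invrK lef_pV2 ?posrE ?invr_gt0//.
    rewrite (bigD1 i)//= addrCA lerDl addr_ge0// sumr_ge0// => j _.
    by rewrite invr_ge0 ltW.
  by rewrite ltr_pwDl// sumr_ge0// => j _; rewrite invr_ge0 ltW.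
have /andP[m1 m2] : (dl i <= (x : V) 0 i - a 0 i) && (dl i <= b 0 i - (x : V) 0 i).
  by rewrite -le_min.
by rewrite ler_norml => /andP[h1 h2]; lra.
Qed.

(** A failure of the uniform statement yields a sequence of kernels with radii at most 1 / (n + 1).
    Where [A] is locally constant the mollified indicators are eventually equal to the indicator,
    and all of them are bounded by 1 and vanish off a fixed cube, so dominated convergence gives a
    contradiction. *)
Lemma L1_mollifiable_indic A r : measurable (A : set (Ld R d)) -> A `<=` cube r ->
  {ae lam, forall x : Ld R d, locally_constant_at A x} -> L1_mollifiable \1_A.
Proof.
move=> mA Ar aeA; apply: contrapT => /existsNP[eps /not_implyP[eps0 h]].
pose P (n : nat) (K : (V -> R) * ('I_d -> V -> R) * R) :=
  [/\ mollifier K.1.1 K.1.2, vanishes_off K.2 K.1.1, K.2 <= n.+1%:R^-1 &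
    eps < integ (fun x => `|conv K.1.1 \1_A x - \1_A x|)].
have hP n : exists K, P n K.
  apply: contrapT => nk; apply: h; exists n.+1%:R^-1; first by rewrite invr_gt0.
  move=> k dk s mk kr sn; rewrite leNgt; apply/negP => ek.
  by apply: nk; exists (k, dk, s).
have [K /all_and4[mk kv kn ke]] := choice hP.
have Ai : itg \1_A.
  apply: itg_indic => //; apply: le_lt_trans (le_outer_measure _ _ _ Ar) _.
  exact: cube_lty.
have A01 x : 0 <= (\1_A x : R) <= 1 by rewrite indicE; case: (_ \in _); rewrite ?lexx ?ler01.
have c0 n x : 0 <= conv (K n).1.1 \1_A x.
  by apply: integ_ge0 => y; rewrite mulr_ge0 ?(mol_ge0 (mk n))//; have /andP[] := A01 y.
have c1 n x : conv (K n).1.1 \1_A x <= 1.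
  rewrite -(integ_mollifier_reflect (mk n) x); apply: integ_le.
  - exact: (mollifier_conv_itg (mk n) x Ai).
  - exact: (mollifier_reflect_itg (mk n) x).
  - by move=> y; rewrite ler_piMl ?(mol_ge0 (mk n))//; have /andP[] := A01 y.
have Av : vanishes_off r (\1_A : V -> R).
  by move=> x xr; rewrite indicE memNset// => /Ar.
have cv n : vanishes_off (r + 1) (conv (K n).1.1 \1_A).
  apply: (vanishes_off_le (r := r + (K n).2)); last first.
    exact: (conv_vanishes_off Av (kv n)).
  by rewrite lerD2l (le_trans (kn n))// invf_le1// ler1n.
have [|||||_ + _] := @integ_dominated R d (fun n => conv (K n).1.1 \1_A) \1_A
    (\1_(cube (r + 1))).
- move=> n; apply: continuous_measurable_rV.
  by have [] := conv_C1 (mk n) Ai.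
- exact: measf_indic.
- by apply: itg_indic; [exact: measurable_cube|exact: cube_lty].
- move=> n x; rewrite ger0_norm// indicE; case: (boolP (x \in _)) => [_|]; first exact: c1.
  by move=> /negP; rewrite inE => xr; rewrite cv.
- have FA := ae_filter_ringOfSetsType (lebesgue_measure_rV R d).
  apply: (filterS _ aeA) => x [dl dl0 hx].
  apply: (@cvg_trans _ ((fun=> \1_A x) @ \oo)); last exact: cvg_cst.
  apply: near_eq_cvg.
  have : \forall n \near \oo, n.+1%:R^-1 <= dl.
    near=> n; apply/ltW; near: n.
    exact: (cvgr_lt (0 : R) cvg_harmonic dl dl0).
  apply: filterS => n ndl.
  rewrite -[LHS]mulr1 -(integ_mollifier_reflect (mk n) x) /conv -integZ; last first.
    exact: (mollifier_reflect_itg (mk n) x).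
  apply: eq_integ => y.
  have [xy|xy] := pselect (cube (K n).2 ((x : V) - y)); last first.
    by rewrite (kv n)// !mulr0.
  congr (_ * _); rewrite !indicE; congr (nat_of_bool _)%:R.
  have /hx [H1 H2] : forall i, `|(x : V) 0 i - y 0 i| <= dl.
    move=> i; have /cubeP/(_ i) := xy; rewrite !mxE => /le_trans; apply.
    by rewrite (le_trans (kn n)).
  by apply/idP/idP; rewrite !inE.
move=> /(cvgr_lt (0 : R))/(_ _ eps0)[n _ /(_ n (leqnn n))] /=.
by apply/negP; rewrite -leNgt ltW.
Unshelve. all: by end_near. Qed.

End mollification_convergence.

Import HBSimple.

(** * L^1 convergence of mollifications, for all integrable functions *)

Section mollification_density.
Variables (R : realType) (d : nat).
Local Notation V := 'rV[R]_d.
Local Notation lam := (leb R d).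
Implicit Types (u : V -> R) (x a b : V) (A : set V) (C : nat -> set V).

Lemma box_sub_cube a b : exists r, box a b `<=` cube r.
Proof.
exists (`|a| + `|b|) => x xab; apply/cubeP => i.
have /andP[xa xb] := xab i.
have := coord_le_norm a i; have := coord_le_norm b i.
rewrite !ler_norml => /andP[b1 b2] /andP[a1 a2].
have := normr_ge0 a; have := normr_ge0 b; move: xa xb.
by move=> h1 h2 h3 h4; apply/andP; split; lra.
Qed.

Lemma union_of_boxes C n :
  (forall k, C k = set0 \/ exists a b, C k = box a b) ->
  let U := \big[setU/set0]_(k < n) C k in
  [/\ measurable (U : set (Ld R d)), (exists r, U `<=` cube r) &
    {ae lam, forall x : Ld R d, locally_constant_at U x}].
Proof.
move=> hC /=; elim: n => [|n [mU [r Ur] aeU]].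
  rewrite big_ord0; split; [exact: measurable0|by exists 0|].
  by apply: aeW => x; exists 1.
rewrite big_ord_recr /=; have [->|[a [b ->]]] := hC n.
  by rewrite setU0; split=> //; exists r.
have [s abs] := box_sub_cube a b; split.
- by apply: measurableU => //; exact: measurable_box.
- exists (Num.max r s) => x [/Ur|/abs]; apply: sub_cube.
    by rewrite le_max lexx.
  by rewrite le_max lexx orbT.
- have FA := ae_filter_ringOfSetsType (lebesgue_measure_rV R d).
  apply: filterS2 aeU (ae_locally_constant_box a b) => x.
  exact: locally_constant_setU.
Qed.

(** The measure being an infimum over box covers, [A] is L^1-close to a countable union of boxes,
    and that union to a finite one, to which [L1_mollifiable_indic] applies. *)
Lemma L1_mollifiable_measurable A : measurable (A : set (Ld R d)) ->
  (lam A < +oo)%E -> L1_mollifiable \1_A.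
Proof.
move=> mA Afin; have Ai := itg_indic mA Afin.
apply: L1_mollifiable_lim => // eps eps0.
have e2 : 0 < eps / 2 by rewrite divr_gt0.
have Af : lam A \is a fin_num by rewrite ge0_fin_numE// outer_measure_ge0.
have [C AC Cs] : exists2 C, A `<=` \bigcup_k C k &
    (\sum_(k <oo) box_premeasure (C k) < lam A + (eps / 2)%:E)%E.
  by apply: lebesgue_outer_coverP; rewrite lteDl// lte_fin.
(* Any other set has premeasure +oo, which would make the sum of the cover infinite. *)
have hC k : C k = set0 \/ exists a b, C k = box a b.
  apply: box_premeasure_fin; rewrite ltey; apply/negP => /eqP Ck.
  move: Cs; rewrite (nneseries_pinfty _ _ Ck)//.
    by rewrite -(fineK Af) ltNge leey.
  by move=> n _; exact: box_premeasure_ge0.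
pose U := \bigcup_k C k; pose Un n := \big[setU/set0]_(k < n) C k.
have mC k : measurable (C k : set (Ld R d)).
  by have [->|[a [b ->]]] := hC k; [exact: measurable0|exact: measurable_box].
have mU : measurable (U : set (Ld R d)) by exact: bigcupT_measurable.
have UA : (lam U <= lam A + (eps / 2)%:E)%E.
  apply: le_trans (ltW Cs).
  apply: le_trans (outer_measure_sigma_subadditive _ _) _.
  apply: lee_nneseries => [k _ _|k _]; first exact: outer_measure_ge0.
  exact: lebesgue_outer_le_premeasure.
have Ufin : (lam U < +oo)%E.
  by apply: le_lt_trans UA _; rewrite -(fineK Af) -EFinD ltry.
have Ui := itg_indic mU Ufin.
have mUn n : measurable (Un n : set (Ld R d)) by have [] := union_of_boxes n hC.
have UnU n : Un n `<=` U by move=> x; rewrite /Un -bigcup_mkord => -[k _ kx]; exists k.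
have Uni n : itg \1_(Un n).
  apply: itg_indic => //; apply: le_lt_trans Ufin; exact: le_outer_measure.
have [||_ + _] := @integ_dominated R d (fun n => \1_(Un n)) \1_U \1_U
    (fun n => measf_indic (mUn n)) (measf_indic mU) Ui.
- move=> n x; rewrite ger0_norm// !indicE; case: (boolP (x \in Un n)) => //.
  by rewrite inE => /UnU xU; rewrite mem_set.
- apply: aeW => x.
  apply: (@cvg_trans _ ((fun=> \1_U x) @ \oo)); last exact: cvg_cst.
  apply: near_eq_cvg; rewrite !indicE.
  have [[k _ kx]|xU] := pselect (U x); last first.
    apply: nearW => n; rewrite !indicE !memNset//.
    by move=> /UnU.
  exists k.+1 => // n kn /=; rewrite !indicE !mem_set//; last by exists k.
  by rewrite /Un -bigcup_mkord; exists k.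
move=> /(cvgr_lt (0 : R))/(_ _ e2)[n _ /(_ n (leqnn n))] /= hn.
have [_ [r Unr] aeUn] := union_of_boxes n hC.
exists \1_(Un n); split=> //; first exact: L1_mollifiable_indic (mUn n) Unr aeUn.
apply: le_trans (integ_norm_tri Ai Ui (Uni n)) _.
have -> : integ (fun x => `|\1_U x - \1_(Un n) x|) =
          integ (fun x => `|\1_(Un n) x - \1_U x|).
  by apply: eq_integ => x; rewrite distrC.
have -> : integ (fun x => `|\1_A x - \1_U x|) = fine (lam U) - fine (lam A).
  rewrite -(integ_indic mU) -(integ_indic mA) -integB//; apply: eq_integ => x.
  rewrite distrC ger0_norm// !indicE; case: (boolP (x \in A)) => //.
    by rewrite inE => /AC xU; rewrite mem_set// subrr.
  by rewrite subr0.
have : fine (lam U) - fine (lam A) <= eps / 2.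
  rewrite lerBlDl -lee_fin EFinD !fineK//.
  by rewrite ge0_fin_numE// outer_measure_ge0.
by move: hn => /ltW; lra_integ.
Qed.

Lemma L1_mollifiable0 : L1_mollifiable (fun _ : V => 0).
Proof.
have := @L1_mollifiable_measurable set0 measurable0.
rewrite outer_measure0 => /(_ (ltry 0)); congr L1_mollifiable.
by apply/funext => x; rewrite indicE memNset.
Qed.

Lemma L1_mollifiable_sum (I : eqType) (r : seq I) (f : I -> V -> R) :
  (forall i, i \in r -> itg (f i) /\ L1_mollifiable (f i)) ->
  itg (fun x => \sum_(i <- r) f i x) /\ L1_mollifiable (fun x => \sum_(i <- r) f i x).
Proof.
elim: r => [|i r IH] h.
  by under eq_fun do rewrite big_nil; split; [exact: itg0|exact: L1_mollifiable0].
have [i1 m1] := h i (mem_head _ _).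
have [j jr|i2 m2] := IH; first by apply: h; rewrite in_cons jr orbT.
under eq_fun do rewrite big_cons.
by split; [exact: itgD|exact: L1_mollifiableD].
Qed.

Lemma itg_indic_fin A : measurable (A : set (Ld R d)) -> itg \1_A -> (lam A < +oo)%E.
Proof.
move=> mA Ai; have := EFin_integ Ai.
by rewrite (@integral_indic _ _ _ _ setT)// setIT => ->; rewrite ltry.
Qed.

Lemma L1_mollifiable_sfun (s : {sfun (Ld R d) >-> R}) :
  itg (s : Ld R d -> R) -> L1_mollifiable (s : Ld R d -> R).
Proof.
move=> si.
pose f (c : R) : V -> R := fun x => c * \1_(s @^-1` [set c]) x.
have -> : (s : Ld R d -> R) = fun x => \sum_(c <- finmap.enum_fset (fset_set (range s))) f c x.
  apply/funext => x; rewrite [LHS]fimfunE fsbig_finite//.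
apply: (L1_mollifiable_sum (f := f) _).2 => c _.
(* The level set of 0 may have infinite measure, but its term vanishes; the other level sets have
   finite measure since [s] is integrable. *)
have [->|c0] := eqVneq c 0.
  rewrite (_ : f 0 = fun=> 0); last by apply/funext => x; rewrite /f mul0r.
  by split; [exact: itg0|exact: L1_mollifiable0].
have ms : measurable (s @^-1` [set c] : set (Ld R d)) by exact: measurable_sfunP.
have ci : itg \1_(s @^-1` [set c]).
  apply: (@itg_le _ _ _ (fun x => `|c|^-1 * `|s x|)).
  - exact: measf_indic.
  - exact/itgZ/itg_norm.
  - move=> x; rewrite ger0_norm// indicE; case: (boolP (x \in _)) => [|_].
      by rewrite inE /= => ->; rewrite mulVf// normr_eq0.
    by rewrite mulr_ge0.
split; first exact: itgZ.
by apply: L1_mollifiableZ => //; apply: L1_mollifiable_measurable => //; exact: itg_indic_fin.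
Qed.

Theorem itg_L1_mollifiable u : itg u -> L1_mollifiable u.
Proof.
move=> ui; apply: L1_mollifiable_lim => // eps eps0.
have [g [gi _ g0]] := @approximation_sfun_integrable _ (Ld R d) R
  (lebesgue_measure_rV R d) setT measurableT _ ui.
have gi' n : itg (g n : Ld R d -> R) by exact: gi.
have [n _ /(_ n (leqnn n)) /= hn] := cvgr_lt (0 : R) (fine_cvg g0) eps eps0.
exists (g n : Ld R d -> R); split=> //; first exact: L1_mollifiable_sfun.
exact: ltW hn.
Qed.

End mollification_density.

(** * Splitting the total variation at a level *)

Section smooth_truncation.
Variables (R : realType) (t dl : R).
Hypothesis dl0 : 0 < dl.
Implicit Types s r : R.

(** A smooth stand-in for |s - t| in min(s, t) = (s + t - |s - t|) / 2. *)
Let S s : R := Num.sqrt ((s - t) ^+ 2 + dl ^+ 2).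

Let q0 s : 0 < (s - t) ^+ 2 + dl ^+ 2.
Proof. by rewrite ltr_wpDl ?sqr_ge0// exprn_gt0. Qed.

Let S0 s : 0 < S s. Proof. by rewrite sqrtr_gt0. Qed.

Let S2 s : S s ^+ 2 = (s - t) ^+ 2 + dl ^+ 2.
Proof. by rewrite sqr_sqrtr// ltW. Qed.

Let Sd s : is_derive s (1 : R) S ((s - t) / S s).
Proof.
have qd : is_derive s (1 : R) (fun s => (s - t) ^+ 2 + dl ^+ 2) (2 * (s - t)).
  have h : is_derive s (1 : R) (fun s => s - t) 1.
    apply: is_derive_eq (is_deriveB (is_derive_id s 1) (is_derive_cst t s 1)) _.
    by rewrite subr0.
  apply: is_derive_eq (is_deriveD (is_deriveX 2 h) (is_derive_cst (dl ^+ 2) s 1)) _.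
  by rewrite /GRing.scale /= addr0 expr1 mulr1.
have -> : (s - t) / S s =
    (2 * Num.sqrt ((s - t) ^+ 2 + dl ^+ 2))^-1 * (2 * (s - t)).
  by rewrite -/(S s); field; rewrite gt_eqF.
apply: (@is_derive1_comp _ Num.sqrt (fun s => (s - t) ^+ 2 + dl ^+ 2)).
exact: is_derive1_sqrt (q0 s).
Qed.

Definition smooth_min s : R := (s + t - S s) / 2.
Definition smooth_min' s : R := (1 - (s - t) / S s) / 2.
Definition smooth_min'' s : R := - (dl ^+ 2 / S s ^+ 3) / 2.

Lemma smooth_min_derive s : is_derive s (1 : R) smooth_min (smooth_min' s).
Proof.
have h : is_derive s (1 : R) (fun s => s + t - S s) (1 - (s - t) / S s).
  apply: is_derive_eq (is_deriveB (is_deriveD (is_derive_id s 1)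
    (is_derive_cst t s 1)) (Sd s)) _.
  by rewrite addr0.
apply: is_derive_eq (is_deriveM h (is_derive_cst (2^-1 : R) s 1)) _.
by rewrite /GRing.scale /= mulr0 add0r mulrC.
Qed.

Lemma smooth_min'_derive s : is_derive s (1 : R) smooth_min' (smooth_min'' s).
Proof.
have Sn : S s != 0 by rewrite gt_eqF.
have hV : is_derive s (1 : R) (fun s => (S s)^-1) (- (S s) ^- 2 * ((s - t) / S s)).
  have [Sds Sv] := Sd s.
  split; first exact: derivableV.
  by rewrite deriveV// Sv.
have h : is_derive s (1 : R) (fun s => s - t) 1.
  apply: is_derive_eq (is_deriveB (is_derive_id s 1) (is_derive_cst t s 1)) _.
  by rewrite subr0.
have h2 := is_deriveB (is_derive_cst (1 : R) s 1) (is_deriveM h hV).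
apply: is_derive_eq (is_deriveM h2 (is_derive_cst (2^-1 : R) s 1)) _.
rewrite /GRing.scale /= mulr0 add0r sub0r mulr1 /smooth_min''.
have -> : dl ^+ 2 = S s ^+ 2 - (s - t) ^+ 2 by rewrite S2; ring.
by field.
Qed.

Lemma smooth_min''_continuous : continuous smooth_min''.
Proof.
have cS : continuous S by exact: is_derive_continuous Sd.
move=> s; rewrite /smooth_min''.
apply: (@continuousM _ _ (fun s => - (dl ^+ 2 / S s ^+ 3)) (fun=> 2^-1)); last first.
  exact: cst_continuous.
apply: continuousN; apply: (@continuousM _ _ (fun=> dl ^+ 2) (fun s => (S s ^+ 3)^-1)).
  exact: cst_continuous.
apply: continuousV; first by rewrite expf_neq0// gt_eqF.
apply: (@continuous_comp _ _ _ S (fun r : R => r ^+ 3)); first exact: cS.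
exact: exprn_continuous.
Qed.

Let S_ge s : `|s - t| <= S s.
Proof. by rewrite -sqrtr_sqr ler_sqrt ?lerDl ?sqr_ge0// ltW. Qed.

Lemma smooth_min'_ge0 s : 0 <= smooth_min' s.
Proof.
rewrite divr_ge0// subr_ge0 ler_pdivrMr// mul1r (le_trans (ler_norm _))//.
Qed.

Lemma smooth_min'_le1 s : smooth_min' s <= 1.
Proof.
have : -1 <= (s - t) / S s.
  rewrite ler_pdivlMr// mulN1r lerNl (le_trans _ (S_ge s))//.
  by rewrite -normrN ler_norm.
rewrite /smooth_min'; lra.
Qed.

(** The square root lies between |s - t| and |s - t| + dl, and min(-, t) is 1-Lipschitz. *)
Lemma smooth_min_dist s r : `|smooth_min s - Num.min r t| <= dl / 2 + `|s - r|.
Proof.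
have h : `|smooth_min s - Num.min s t| <= dl / 2.
  have A := S_ge s.
  have B : S s <= `|s - t| + dl.
    rewrite -[leRHS]ger0_norm; last by rewrite addr_ge0// ltW.
    rewrite -sqrtr_sqr ler_sqrt ?sqr_ge0//.
    by rewrite [leRHS]sqrrD sqr_normr lerD2r lerDl mulrn_wge0// mulr_ge0// ltW.
  rewrite /smooth_min; have [st|st] := leP s t.
    by move: A B; rewrite ler0_norm ?subr_le0// ler_norml => A B; apply/andP; split; lra.
  by move: A B; rewrite gtr0_norm ?subr_gt0// ler_norml => A B; apply/andP; split; lra.
have g : `|Num.min s t - Num.min r t| <= `|s - r|.
  have := ler_norm (s - r); have := ler_norm (r - s); rewrite [`|r - s|]distrC.
  have := normr_ge0 (s - r).
  by have [st|st] := leP s t; have [rt|rt] := leP r t; rewrite ler_norml => *;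
    apply/andP; split; lra.
rewrite (le_trans (ler_distD (Num.min s t) _ _))// lerD//.
Qed.

End smooth_truncation.

(** * The inequality |D min(u, t)| + |D (u - t)^+| <= |Du| *)

Section tv_splitting.
Variables (R : realType) (d : nat).
Local Notation V := 'rV[R]_d.
Local Notation lam := (leb R d).
Local Notation e := (@ebasis R d).
Local Notation tv := (@Defs.total_variation R d).
Implicit Types (u v w : V -> R) (x : V).

Lemma smooth_approximation u eps (A : set V) : (0 < lam A)%E -> itg u -> 0 < eps ->
  exists v dv, [/\ itg v, C1 v dv, integ (fun x => `|v x - u x|) <= eps &
    forall c : R, (tv u <= c%:E)%E -> (tv v <= c%:E)%E].
Proof.
move=> A0 ui eps0; have [dl dl0 h] := itg_L1_mollifiable ui eps0.
have [k [dk [mk kr]]] := mollifier_exists A0 dl0.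
exists (conv k u), (fun j => conv (dk j) u); split.
- by have [] := conv_itg_L1 mk ui.
- exact: conv_C1.
- exact: h mk kr (lexx _).
- by move=> c; exact: (tv_conv_le mk ui).
Qed.

Lemma convex_combination_sqr_le n (a : R) (p q : 'I_n -> R) : 0 <= a <= 1 ->
  \sum_i p i ^+ 2 <= 1 -> \sum_i q i ^+ 2 <= 1 ->
  \sum_i (a * p i + (1 - a) * q i) ^+ 2 <= 1.
Proof.
move=> /andP[a0 a1] p1 q1.
apply: (@le_trans _ _ (a * \sum_i p i ^+ 2 + (1 - a) * \sum_i q i ^+ 2)).
  rewrite !mulr_sumr -big_split /=; apply: ler_sum => i _.
  have : 0 <= a * (1 - a) * (p i - q i) ^+ 2.
    by apply: mulr_ge0; [apply: mulr_ge0; lra|exact: sqr_ge0].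
  rewrite -subr_ge0 [X in _ -> 0 <= X](_ : _ = a * (1 - a) * (p i - q i) ^+ 2)//.
  by ring.
have : a * \sum_i p i ^+ 2 <= a by rewrite ler_piMr.
have : (1 - a) * \sum_i q i ^+ 2 <= 1 - a by rewrite ler_piMr ?subr_ge0.
lra.
Qed.

(** The field [eta] = F'(v) phi + (1 - F'(v)) psi is a pointwise convex combination of admissible
    fields, hence admissible. Integration by parts turns the integral of v div eta into the
    left-hand side, one summand for [F] and one for [G] = id - F. *)
Lemma C1_truncation_ibp (t dl c : R) v dv phi psi : 0 < dl -> itg v -> C1 v dv ->
  (tv v <= c%:E)%E -> admissible_field phi -> admissible_field psi ->
  integ (fun x => smooth_min t dl (v x) * divergence phi x) +
  integ (fun x => (v x - smooth_min t dl (v x)) * divergence psi x) <= c.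
Proof.
move=> dl0 vi vc vt pa qa; have pc := admissible_Cc1 pa; have qc := admissible_Cc1 qa.
pose F := smooth_min t dl; pose F' := smooth_min' t dl; pose F'' := smooth_min'' t dl.
pose G s := s - F s; pose G' s := 1 - F' s; pose G'' s := - F'' s.
have Fd s : is_derive s (1 : R) F (F' s) by exact: smooth_min_derive.
have F'd s : is_derive s (1 : R) F' (F'' s) by exact: smooth_min'_derive.
have cF'' : continuous F'' by exact: smooth_min''_continuous.
have Gd s : is_derive s (1 : R) G (G' s) by exact: is_deriveB (is_derive_id s 1) (Fd s).
have G'd s : is_derive s (1 : R) G' (G'' s).
  apply: is_derive_eq (is_deriveB (is_derive_cst (1 : R) s 1) (F'd s)) _.
  by rewrite sub0r.
have cG'' : continuous G'' by move=> s; apply: continuousN; exact: cF''.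
have [vcc _ _] := vc.
have chain_itg (H H' : R -> R) phi0 dphi j : (forall s, is_derive s (1 : R) H (H' s)) ->
    Cc1 phi0 dphi -> itg (fun x => H (v x) * dphi j x).
  move=> Hd [[cp pd cdp] [r p0]]; apply: (@continuous_vanishes_off_itg _ _ r).
    by apply: continuousM_rV => //; apply: continuous_comp_rV => //;
      exact: is_derive_continuous Hd.
  by move=> x xr; rewrite (derive_vanishes_off (pd j) p0)// mulr0.
pose D (f : V -> R) i x := 'D_(e i) f x.
pose eta i x := F' (v x) * phi i x + G' (v x) * psi i x.
pose dF i j x := F'' (v x) * dv j x * phi i x + F' (v x) * D (phi i) j x.
pose dG i j x := G'' (v x) * dv j x * psi i x + G' (v x) * D (psi i) j x.
have Fc i : Cc1 (fun x => F' (v x) * phi i x) (dF i).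
  exact: Cc1M (C1_comp F'd cF'' vc) (pc i).
have Gc i : Cc1 (fun x => G' (v x) * psi i x) (dG i).
  exact: Cc1M (C1_comp G'd cG'' vc) (qc i).
have etac i : Cc1 (eta i) (fun j x => dF i j x + dG i j x) by exact: Cc1D (Fc i) (Gc i).
have eta1 x : \sum_(i < d) eta i x ^+ 2 <= 1.
  apply: convex_combination_sqr_le; [|exact: pa.2|exact: qa.2].
  by rewrite smooth_min'_ge0//= smooth_min'_le1.
have etaa := admissible_fieldP etac eta1.
have := tv_leP vi vt etaa; congr (_ <= _).
have bi (h : V -> R) f df j : Cc1 f df -> h = df j -> itg (fun x => v x * h x).
  move=> fc ->; have [M _ hM] := Cc1_partial_bounded j fc.
  by apply: itg_bounded_mul hM => //; exact/itg_measf/(Cc1_partial_itg j fc).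
rewrite (@eq_integ _ _ _ (fun x => \sum_i (v x * dF i i x + v x * dG i i x))); last first.
  move=> x; rewrite (divergenceE etac) mulr_sumr; apply: eq_bigr => i _.
  by rewrite mulrDr.
have [-> _] := integ_sum (f := fun i x => v x * dF i i x + v x * dG i i x)
  (fun i => itgD (bi _ _ _ i (Fc i) erefl) (bi _ _ _ i (Gc i) erefl)).
rewrite [X in _ = X + _](@eq_integ _ _ _ (fun x => \sum_i F (v x) * D (phi i) i x)); last first.
  by move=> x; rewrite mulr_sumr.
rewrite [X in _ = _ + X](@eq_integ _ _ _ (fun x => \sum_i G (v x) * D (psi i) i x)); last first.
  by move=> x; rewrite mulr_sumr.
have [-> _] := integ_sum (f := fun i x => F (v x) * D (phi i) i x)
  (fun i => chain_itg _ _ _ _ i Fd (pc i)).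
have [-> _] := integ_sum (f := fun i x => G (v x) * D (psi i) i x)
  (fun i => chain_itg _ _ _ _ i Gd (qc i)).
rewrite -big_split /=; apply: eq_bigr => i _.
rewrite integD; [|exact: bi (Fc i) erefl|exact: bi (Gc i) erefl].
congr (_ + _); apply/esym.
  exact: (integ_chain_partial i Fd F'd cF'' vc (pc i)).
exact: (integ_chain_partial i Gd G'd cG'' vc (qc i)).
Qed.

(** The two fields are kept explicit: the coarea argument fixes [phi] and takes the supremum over
    [psi] alone. *)
Lemma tv_split u (t c : R) (A : set V) phi psi : (0 < lam A)%E -> itg u ->
  (forall x, 0 <= u x) -> 0 <= t -> (tv u <= c%:E)%E ->
  admissible_field phi -> admissible_field psi ->
  integ (fun x => Num.min (u x) t * divergence phi x) +
  integ (fun x => (u x - Num.min (u x) t) * divergence psi x) <= c.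
Proof.
move=> A0 ui u0 t0 uc pa qa.
have [Mp Mp0 pM] := divergence_bounded pa; have [Mq Mq0 qM] := divergence_bounded qa.
have pi := divergence_itg pa; have qi := divergence_itg qa.
pose N := integ (fun x => `|divergence phi x|) + integ (fun x => `|divergence psi x|).
have N0 : 0 <= N by rewrite addr_ge0// integ_ge0.
have mini : itg (fun x => Num.min (u x) t).
  apply: (itg_le _ ui) => [|x].
    exact: (measurable_minr (itg_measf ui) (@measf_cst R d t)).
  by rewrite ger0_norm ?le_min ?u0// ge_min lexx.
have pminI := itg_divergence mini pa.
have qminI := itg_divergence (itgB ui mini) qa.
apply/ler_addgt0Pr => eps eps0.
(* Half of [eps] covers the smoothing error dl N / 2. The other half covers the L^1 distance of [v]
   and [u], which counts once in the truncation and twice in v minus its truncation, whence Mp + 2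
   Mq. *)
pose dl := eps / (N + 1); pose et := eps / (2 * (Mp + 2 * Mq + 1)).
have D0 : 0 < Mp + 2 * Mq + 1 by rewrite ltr_wpDl// addr_ge0// mulr_ge0.
have dl0 : 0 < dl by rewrite divr_gt0// ltr_wpDl.
have et0 : 0 < et by rewrite divr_gt0// mulr_gt0.
have [v [dv [vi vc vu vt]]] := smooth_approximation A0 ui et0.
have := C1_truncation_ibp t dl0 vi vc (vt _ uc) pa qa.
have Fm : measf (fun x => smooth_min t dl (v x)).
  apply: continuous_measurable_rV; have [vcc _ _] := vc.
  apply: continuous_comp_rV vcc.
  by apply: is_derive_continuous => s; exact: smooth_min_derive.
have vui := itg_norm (itgB vi ui).
(* The constant dl / 2 is not integrable over R^d, so it is integrated against |g|, whereas |v - u|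
   is integrable and [g] is bounded there by M. *)
have bd (M a : R) w w' g : measf w -> itg w' -> itg g -> 0 <= M -> 0 <= a ->
    (forall x, `|g x| <= M) -> (forall x, `|w x - w' x| <= dl / 2 + a * `|v x - u x|) ->
    integ (fun x => w' x * g x) <= integ (fun x => w x * g x) +
      dl / 2 * integ (fun x => `|g x|) + M * a * integ (fun x => `|v x - u x|).
  move=> wm w'i gi M0 a0 gM ww'.
  have i1 : itg (fun x => w' x * g x) by exact: itg_bounded_mul w'i (itg_measf gi) gM.
  have i2 : itg (fun x => dl / 2 * `|g x| + M * a * `|v x - u x|).
    by apply: itgD; [exact/itgZ/itg_norm|exact: itgZ].
  have le x : `|w x * g x - w' x * g x| <= dl / 2 * `|g x| + M * a * `|v x - u x|.
    rewrite -mulrBl normrM; apply: (@le_trans _ _ ((dl / 2 + a * `|v x - u x|) * `|g x|)).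
      exact: ler_wpM2r.
    rewrite mulrDl lerD2l mulrC mulrA ler_wpM2r// ler_wpM2r//.
  have i3 : itg (fun x => w x * g x - w' x * g x).
    apply: itg_le i2 le; apply: measfB; last exact: itg_measf.
    by apply: measfM => //; exact: itg_measf.
  have i4 : itg (fun x => w x * g x).
    have := itgD i3 i1; congr (itg _); apply/funext => x; by rewrite subrK.
  rewrite -addrA -[dl / 2 * _]integZ; last exact: itg_norm.
  rewrite -[M * a * _]integZ// -integD; [|exact/itgZ/itg_norm|exact: itgZ].
  rewrite -integD//; apply: integ_le => //; first exact: itgD.
  move=> x; have := le x; rewrite ler_norml => /andP[h _]; clear -h; lra.
have b1 : integ (fun x => Num.min (u x) t * divergence phi x) <=
    integ (fun x => smooth_min t dl (v x) * divergence phi x) +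
    dl / 2 * integ (fun x => `|divergence phi x|) +
    Mp * 1 * integ (fun x => `|v x - u x|).
  apply: (bd Mp 1 _ _ _ Fm mini pi Mp0 ler01 pM) => x.
  by rewrite mul1r; exact: smooth_min_dist.
have b2 := bd Mq 2 _ _ _ (measfB (itg_measf vi) Fm) (itgB ui mini) qi Mq0 (ler0n _ 2) qM.
move=> B.
have {}b2 : integ (fun x => (u x - Num.min (u x) t) * divergence psi x) <=
    integ (fun x => (v x - smooth_min t dl (v x)) * divergence psi x) +
    dl / 2 * integ (fun x => `|divergence psi x|) +
    Mq * 2 * integ (fun x => `|v x - u x|).
  apply: b2 => x.
  have := smooth_min_dist t dl0 (v x) (u x).
  rewrite [_ - _ - _](_ : _ = (v x - u x) - (smooth_min t dl (v x) - Num.min (u x) t)); last by ring.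
  move=> h; apply: (le_trans (ler_normB _ _)); clear -h; lra.
have h1 : dl / 2 * N <= eps / 2.
  rewrite mulrAC ler_pM2r ?invr_gt0// /dl mulrAC ler_pdivrMr ?ltr_wpDl//.
  by rewrite ler_pM2l// lerDl.
have h2 : (Mp + 2 * Mq) * integ (fun x => `|v x - u x|) <= eps / 2.
  apply: (@le_trans _ _ ((Mp + 2 * Mq) * et)).
    by apply: ler_wpM2l => //; rewrite addr_ge0// mulr_ge0.
  rewrite (_ : _ * et = eps / 2 * ((Mp + 2 * Mq) / (Mp + 2 * Mq + 1))).
    by rewrite ler_piMr ?divr_ge0 ?(ltW eps0)// ler_pdivrMr// mul1r lerDl.
  by rewrite /et; field; rewrite gt_eqF.
move: B b1 b2 h1 h2; rewrite /N mulr1; lra_integ.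
Qed.

End tv_splitting.

(** * The coarea inequality *)

Section coarea_inequality.
Variables (R : realType) (d : nat).
Local Notation V := 'rV[R]_d.
Local Notation lam := (leb R d).
Local Notation tv := (@Defs.total_variation R d).
Implicit Types (u : V -> R) (x : V) (s t : R).

Definition excess u t x : R := u x - Num.min (u x) t.

Definition superlevel u t : set V := [set x | t < u x].

Lemma excess_cases u t x : (u x <= t /\ excess u t x = 0) \/
  (t < u x /\ excess u t x = u x - t).
Proof.
rewrite /excess; have [ut|ut] := leP (u x) t; [left|right] => //.
by rewrite subrr.
Qed.

Lemma excess_ge0 u t x : 0 <= excess u t x.
Proof. by have [[_ ->]|[h ->]] := excess_cases u t x; rewrite ?subr_ge0// ltW. Qed.

Lemma excess_le u t x : 0 <= t -> 0 <= u x -> excess u t x <= u x.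
Proof. by move=> t0 u0; have [[_ ->]|[h ->]] := excess_cases u t x; lra. Qed.

Lemma excess0 u : (forall x, 0 <= u x) -> excess u 0 = u.
Proof.
move=> u0; apply/funext => x; have := u0 x.
by have [[h ->]|[h ->]] := excess_cases u 0 x; lra.
Qed.

(** Lets the continuation restart from (u - s)^+ at each level. *)
Lemma excess_excess u s t : 0 <= t -> excess (excess u s) t = excess u (s + t).
Proof.
move=> t0; apply/funext => x.
have [[h1 E1]|[h1 E1]] := excess_cases (excess u s) t x; rewrite E1;
have [[h2 E2]|[h2 E2]] := excess_cases u (s + t) x; rewrite E2;
by move: h1 E1 h2 E2; have [[h3 ->]|[h3 ->]] := excess_cases u s x; lra.
Qed.

Lemma excess_nincr u s t x : s <= t -> excess u t x <= excess u s x.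
Proof.
move=> st; have [[h1 ->]|[h1 ->]] := excess_cases u s x;
by have [[h2 ->]|[h2 ->]] := excess_cases u t x; lra.
Qed.

Lemma min_excessE u s t x : 0 <= t ->
  Num.min (excess u s x) t = excess u s x - excess u (s + t) x.
Proof. by move=> t0; rewrite -(excess_excess u s t0) {2}/excess subKr. Qed.

Lemma itg_excess u t : itg u -> (forall x, 0 <= u x) -> 0 <= t -> itg (excess u t).
Proof.
move=> ui u0 t0; apply: (itg_le _ ui) => [|x].
  apply: measfB; first exact: itg_measf.
  exact: (measurable_minr (itg_measf ui) (@measf_cst R d t)).
by rewrite ger0_norm ?excess_ge0// excess_le.
Qed.

Lemma measurable_superlevel u t : measf u ->
  measurable (superlevel u t : set (Ld R d)).
Proof.
move=> mu; rewrite -[X in measurable X]setTI.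
rewrite (_ : superlevel u t = u @^-1` `]t, +oo[); last first.
  by apply/seteqP; split => x /=; rewrite in_itv /= andbT.
by apply: mu => //; exact: measurable_itv.
Qed.

(** The difference is at most t - s and vanishes unless u > s, where 1 <= u / s. This turns a
    uniform bound into an integrable one. *)
Lemma excess_dist_le u s t x : 0 < s -> s <= t -> 0 <= u x ->
  `|excess u s x - excess u t x| <= (t - s) / s * u x.
Proof.
move=> s0 st u0; rewrite ger0_norm ?subr_ge0 ?excess_nincr//.
have [us|us] := leP (u x) s.
  have -> : excess u s x = 0 by have [[_ ->]//|[h _]] := excess_cases u s x; lra.
  have -> : excess u t x = 0 by have [[_ ->]//|[h _]] := excess_cases u t x; lra.
  by rewrite subrr mulr_ge0// divr_ge0 ?subr_ge0// ltW.
apply: (@le_trans _ _ (t - s)).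
  by have [[h1 ->]|[h1 ->]] := excess_cases u s x;
    have [[h2 ->]|[h2 ->]] := excess_cases u t x; lra.
rewrite mulrAC -mulrA ler_peMr ?subr_ge0// ler_pdivlMr// mul1r; exact: ltW.
Qed.

Lemma integ_excess_cvg0 u : itg u -> (forall x, 0 <= u x) ->
  integ (excess u n%:R) @[n --> \oo] --> 0.
Proof.
move=> ui u0.
have [||_ _] := @integ_dominated R d (fun n => excess u n%:R) (fun=> 0) u
  (fun n => itg_measf (itg_excess ui u0 (ler0n _ n))) (@measf_cst R d 0) ui.
- by move=> n x; rewrite ger0_norm ?excess_ge0// excess_le.
- apply: aeW => x; apply: (@cvg_trans _ ((fun=> 0) @ \oo)); last exact: cvg_cst.
  apply: near_eq_cvg; exists (Num.bound (u x)) => // n /= un.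
  have [[_ ->]//|[h _]] := excess_cases u n%:R x.
  have := archi_boundP (u0 x); rewrite -(ler_nat R) in un; lra.
by rewrite integ0.
Qed.

Section real_induction.
Variables (u : V -> R) (c h : R).
Hypothesis ui : itg u.
Hypothesis u0 : forall x, 0 <= u x.
Hypothesis ufin : (lam (superlevel u 0) < +oo)%E.
Hypothesis upos : (0 < lam (superlevel u 0))%E.
Hypothesis h0 : 0 <= h.
Hypothesis uc : (tv u <= c%:E)%E.
Hypothesis uh : forall t, 0 <= t -> (0 < lam (superlevel u t))%E ->
  ((h * fine (lam (superlevel u t)))%:E < perimeter (superlevel u t))%E.

Let m t := integ (excess u t).

(** The property continued in [t]: up to level [t] the variation has dropped by at least [h] times
    the mass removed. *)
Let good t := 0 <= t /\ (tv (excess u t) <= (c - h * (m 0 - m t))%:E)%E.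

Let good0 : good 0.
Proof. by split=> //; rewrite subrr mulr0 subr0 excess0. Qed.

Let m_nincr s t : 0 <= s -> s <= t -> m t <= m s.
Proof.
move=> s0 st; apply: integ_le => [||x].
- by apply: itg_excess => //; exact: le_trans st.
- exact: itg_excess.
- exact: excess_nincr.
Qed.

Let good_bound t : good t -> h * (m 0 - m t) <= c.
Proof.
move=> [t0 gt]; rewrite -subr_ge0 -lee_fin; apply: le_trans gt.
exact/tv_ge0/itg_excess.
Qed.

(** Limits from the left are enough, as a supremum is approached from below. *)
Let good_closed t : 0 < t ->
  (forall eps, 0 < eps -> exists s, [/\ good s, t - eps < s & s <= t]) -> good t.
Proof.
move=> t0 ht; split; first exact: ltW.
have ti : itg (excess u t) by exact/itg_excess/ltW.
apply: tv_lsc => // eps eps0.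
pose I := integ u; have I0 : 0 <= I by exact: integ_ge0.
pose K := (2 / t) * I * (1 + h).
have t2 : 0 <= 2 / t by rewrite divr_ge0// ltW.
have h1 : 0 <= 1 + h by rewrite addr_ge0.
have K0 : 0 <= K by apply: mulr_ge0 => //; exact: mulr_ge0.
have K1 : 0 < K + 1 by rewrite ltr_wpDl.
(* The bound t / 2 gives 1 / s <= 2 / t. With X = dl (2 / t) I, which bounds the L^1 distance of the
   two excesses, the other bound gives X (1 + h) <= eps, covering both X and h X. *)
pose dl := Num.min (t / 2) (eps / (K + 1)).
have dl0 : 0 < dl by rewrite lt_min !divr_gt0.
have [s [[s0 gs] ts st]] := ht dl dl0.
have d1 : dl <= t / 2 by rewrite ge_min lexx.
have d2 : dl * (K + 1) <= eps by rewrite -ler_pdivlMr// ge_min lexx orbT.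
have sp : t / 2 <= s by lra.
have sp0 : 0 < s by lra.
have si : itg (excess u s) by exact: itg_excess.
have D : integ (fun x => `|excess u s x - excess u t x|) <= dl * (2 / t) * I.
  rewrite -integZ//; apply: integ_le; [exact/itg_norm/itgB|exact: itgZ|move=> x].
  apply: le_trans (excess_dist_le sp0 st (u0 x)) _; rewrite ler_wpM2r//.
  apply: ler_pM; [lra|by rewrite invr_ge0 ltW|lra|].
  by rewrite -[2 / t]invf_div lef_pV2 ?posrE// divr_gt0.
have E : dl * (2 / t) * I * (1 + h) <= eps.
  apply: le_trans d2; rewrite -!mulrA ler_pM2l// !mulrA -/K lerDl//.
have mm : m s - m t <= dl * (2 / t) * I.
  apply: le_trans D; rewrite /m -integB//; apply: integ_le.
  - exact: itgB.
  - exact/itg_norm/itgB.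
  - by move=> x; exact: ler_norm.
have X0 : 0 <= dl * (2 / t) * I.
  by apply: mulr_ge0 => //; apply: mulr_ge0 => //; exact: ltW.
exists (excess u s); split=> //.
  by apply: le_trans D _; apply: le_trans E; rewrite ler_peMr// lerDl.
apply: le_trans gs _; rewrite lee_fin.
have : h * (m s - m t) <= h * (dl * (2 / t) * I) by exact: ler_wpM2l.
move: E X0; rewrite mulrDr mulr1.
set X := dl * (2 / t) * I; move: (m s) (m t) (m 0) => ms mt m0.
by rewrite [X * h]mulrC => E X0 H; lra.
Qed.

(** By strictness in [uh] some field [phi] has an integral of div phi over the superlevel set above
    h times its measure. The functions [q n], that is min((u - t)^+, dl) / dl with dl = 1 / (n + 1),
    increase to the indicator of that set, so [phi] keeps this advantage for some [n]; [tv_split]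
    then removes at least h L dl from the variation, while the mass removed is at most L dl. *)
Let good_extend t : good t -> (0 < lam (superlevel u t))%E ->
  exists2 dl, 0 < dl & good (t + dl).
Proof.
move=> [t0 gt] tpos; have := uh t0 tpos.
set E := superlevel u t; set L := fine (lam E).
have mE : measurable (E : set (Ld R d)) by exact/measurable_superlevel/itg_measf.
have Efin : (lam E < +oo)%E.
  apply: le_lt_trans ufin; apply: le_outer_measure => x; rewrite /E /superlevel /=; lra.
have Ei : itg \1_E by exact: itg_indic.
move=> /ereal_sup_gt[_ [phi pa <-]].
rewrite (EFin_integ (itg_divergence Ei pa)) lte_fin => hL.
have ti : itg (excess u t) by exact: itg_excess.
pose q (n : nat) x := n.+1%:R * Num.min (excess u t x) n.+1%:R^-1.
have n0 n : 0 < n.+1%:R^-1 :> R by rewrite invr_gt0.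
have mq n : measf (q n).
  apply: measfM; first exact: measf_cst.
  exact: (measurable_minr (itg_measf ti) (@measf_cst R d _)).
have q01 n x : 0 <= q n x <= \1_E x.
  rewrite /q mulr_ge0 ?le_min ?excess_ge0 ?(ltW (n0 n))//= indicE.
  have [[ut E0]|[ut _]] := excess_cases u t x.
    by rewrite E0 min_l ?(ltW (n0 n))// mulr0.
  rewrite mem_set//= -[leRHS](@mulfV _ n.+1%:R) ?pnatr_eq0// ler_pM2l//.
  by rewrite ge_min lexx orbT.
have [M M0 pM] := divergence_bounded pa.
have md := itg_measf (divergence_itg pa).
have [||_ _] := @integ_dominated R d (fun n x => q n x * divergence phi x)
    (fun x => \1_E x * divergence phi x) (fun x => M * \1_E x)
    (fun n => measfM (mq n) md) (itg_measf (itg_divergence Ei pa)) (itgZ M Ei).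
- move=> n x; rewrite normrM mulrC; have /andP[q0 q1] := q01 n x.
  by rewrite (ger0_norm q0) ler_pM.
- apply: aeW => x; apply: cvgMl.
  apply: (@cvg_trans _ ((fun=> \1_E x) @ \oo)); last exact: cvg_cst.
  apply: near_eq_cvg; rewrite indicE.
  have [[ut E0]|[ut Et]] := excess_cases u t x.
    apply: nearW => n; rewrite /q E0 memNset//=; last by move=> /(le_lt_trans ut); rewrite ltxx.
    by rewrite min_l ?mulr0// ltW.
  have ut0 : 0 < u x - t by rewrite subr_gt0.
  have : \forall n \near \oo, n.+1%:R^-1 < u x - t.
    exact: (cvgr_lt (0 : R) cvg_harmonic).
  apply: filterS => n nu; rewrite /q Et min_r ?(ltW nu)// mulfV ?pnatr_eq0//.
  by rewrite mem_set.
move=> /(cvgr_gt _)/(_ _ hL)[n _ /(_ n (leqnn n))] /= hn.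
pose dl : R := n.+1%:R^-1; exists dl; first exact: n0.
have dl0 : 0 <= dl by exact/ltW/n0.
have tdl0 : 0 <= t + dl by rewrite addr_ge0.
split=> //; apply: tv_le => [|psi qa]; first exact: itg_excess.
have := tv_split upos ti (excess_ge0 u t) dl0 gt pa qa.
have -> : (fun x => (excess u t x - Num.min (excess u t x) dl) * divergence psi x) =
          (fun x => excess u (t + dl) x * divergence psi x).
  by apply/funext => x; rewrite -(excess_excess u t dl0).
have mini : itg (fun x => Num.min (excess u t x) dl).
  rewrite (_ : (fun x => _) = fun x => excess u t x - excess u (t + dl) x).
    by apply: itgB => //; exact: itg_excess.
  by apply/funext => x; exact: min_excessE.
have h1 : h * L * dl <= integ (fun x => Num.min (excess u t x) dl * divergence phi x).
  rewrite mulrC -ler_pdivlMl ?n0// /dl invrK -integZ; last exact: itg_divergence.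
  apply/ltW; apply: (lt_le_trans hn); rewrite le_eqVlt; apply/orP; left.
  by apply/eqP/eq_integ => x; rewrite /q mulrA.
have h2 : m t - m (t + dl) <= L * dl.
  rewrite /m -integB//; last exact: itg_excess.
  rewrite /L -(integ_indic mE) mulrC -integZ//; apply: integ_le.
  - by apply: itgB => //; exact: itg_excess.
  - exact: itgZ.
  - move=> x; rewrite -min_excessE//; have /andP[_] := q01 n x.
    by rewrite /q -ler_pdivlMl// -[n.+1%:R^-1]/dl.
have h3 : h * (m t - m (t + dl)) <= h * (L * dl) by exact: ler_wpM2l.
move: h1 h3; rewrite mulrA.
move: (m t) (m (t + dl)) (m 0) (integ _) (integ _) => mt mtd m0 I1 I2.
by rewrite !mulrBr; lra.
Qed.

(** If good levels are unbounded, [m] tends to 0 along them. Otherwise their supremum is good and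
    cannot be extended, so u is at most that level almost everywhere and [m] vanishes there. Either
    way [good_bound] gives the claim. *)
Lemma coarea_bound : h * integ u <= c.
Proof.
have c0 : 0 <= c by rewrite -lee_fin; apply: le_trans uc; exact: tv_ge0.
have m0E : m 0 = integ u by rewrite /m excess0.
rewrite -m0E.
have [bnd|unb] := pselect (exists b, forall t, good t -> t <= b); last first.
  apply/ler_addgt0Pr => eps eps0.
  have e1 : 0 < eps / (h + 1) by rewrite divr_gt0// ltr_wpDl.
  have [n _ /(_ n (leqnn n)) /= hn] := cvgr_lt (0 : R) (integ_excess_cvg0 ui u0) _ e1.
  have [t gt nt] : exists2 t, good t & n%:R <= t.
    apply: contrapT => nt; apply: unb; exists n%:R => t gt.
    by rewrite leNgt; apply/negP => /ltW tn; apply: nt; exists t.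
  have := good_bound gt.
  have mt : m t <= eps / (h + 1) by rewrite (le_trans _ (ltW hn))// m_nincr.
  have : h * m t <= eps.
    apply: (@le_trans _ _ (h * (eps / (h + 1)))); first exact: ler_wpM2l.
    rewrite mulrCA ler_piMr ?(ltW eps0)// ler_pdivrMr ?ltr_wpDl// mul1r lerDl//.
  move: (m t) (m 0) => mt' m0'; rewrite mulrBr; lra.
pose T := sup good.
have hs : has_sup good by split; [exists 0|case: bnd => b hb; exists b => t /hb].
have T0 : 0 <= T by apply: ub_le_sup good0; case: hs.
have gT : good T.
  have [T0'|] := ltP 0 T; last first.
    by move=> T0'; rewrite (_ : T = 0)//; apply/le_anti; rewrite T0'.
  apply: good_closed => // eps eps0.
  have [s gs Ts] := sup_adherent eps0 hs.
  by exists s; split=> //; apply: ub_le_sup gs; case: hs.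
have [Tpos|] := ltP 0%E (lam (superlevel u T)).
  have [dl dl0 gd] := good_extend gT Tpos.
  have := ub_le_sup (proj2 hs) gd; rewrite -/T; lra.
rewrite le_eqVlt ltNge outer_measure_ge0 orbF => /eqP lT0.
have mT : m T = 0.
  rewrite /m -(integ0 R d); apply: ae_eq_integ.
  - exact/itg_measf/itg_excess.
  - exact: measf_cst.
  - exists (superlevel u T); split=> //.
      exact/measurable_superlevel/itg_measf.
    move=> x /= nx; have [[_ E]|[uT _]] := excess_cases u T x; last exact: uT.
    by case: nx; rewrite E.
by have := good_bound gT; rewrite mT subr0.
Qed.

End real_induction.

Theorem coarea_le u (c h : R) : itg u -> (forall x, 0 <= u x) ->
  (lam (superlevel u 0) < +oo)%E -> 0 <= h -> (tv u <= c%:E)%E ->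
  (forall t, 0 <= t -> (0 < lam (superlevel u t))%E ->
    ((h * fine (lam (superlevel u t)))%:E < perimeter (superlevel u t))%E) ->
  h * integ u <= c.
Proof.
move=> ui u0 ufin h0 uc uh.
have [upos|] := ltP 0%E (lam (superlevel u 0)); first exact: coarea_bound.
rewrite le_eqVlt ltNge outer_measure_ge0 orbF => /eqP l0.
rewrite (_ : integ u = 0) ?mulr0.
  by rewrite -lee_fin; apply: le_trans uc; exact: tv_ge0.
rewrite -(integ0 R d); apply: ae_eq_integ.
- exact: itg_measf.
- exact: measf_cst.
- exists (superlevel u 0); split=> //; first exact/measurable_superlevel/itg_measf.
  by move=> x /= nx; rewrite /superlevel /= lt0r u0 andbT; apply/eqP.
Qed.

Lemma cheeger_superlevel_le u (c : R) : itg u -> (forall x, 0 <= u x) ->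
  integ u = 1 -> (lam (superlevel u 0) < +oo)%E -> (tv u <= c%:E)%E ->
  (cheeger (superlevel u 0 : set (Ld R d)) <= c%:E)%E.
Proof.
move=> ui u0 u1 ufin uc; rewrite leNgt; apply/negP => ch.
have c0 : 0 <= c by rewrite -lee_fin; apply: le_trans uc; exact: tv_ge0.
(* A real number strictly in between provides the strict inequality of [coarea_le], and also covers
   an infinite Cheeger constant. *)
have [h ch1 ch2] : exists2 h : R, c < h & (h%:E < cheeger (superlevel u 0))%E.
  move: ch; case: (cheeger _) => [r| |//].
    by rewrite lte_fin => cr; exists ((c + r) / 2); rewrite ?lte_fin; lra.
  by exists (c + 1); rewrite ?ltry// ltrDl.
suff : h * integ u <= c by rewrite u1 mulr1 leNgt ch1.
apply: coarea_le => //; first by rewrite (le_trans c0)// ltW.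
move=> t t0 tpos; set E := superlevel u t.
have sE : E `<=` superlevel u 0 by move=> x; rewrite /E /superlevel /=; lra.
have Efin : (lam E < +oo)%E by apply: le_lt_trans ufin; exact: le_outer_measure.
have Ef : lam E \is a fin_num by rewrite ge0_fin_numE// outer_measure_ge0.
have : (h%:E < perimeter E * (lam E)^-1)%E.
  apply: lt_le_trans ch2 _; apply: ereal_inf_lbound; exists E => //.
  split; first exact/measurable_superlevel/itg_measf.
  split=> //; rewrite /subae (_ : _ `\` _ = set0) ?outer_measure0//.
  by apply/seteqP; split=> // x [/sE].
have L0 : 0 < fine (lam E) by rewrite fine_gt0// tpos.
rewrite -[in X in (_ < _ * X)%E](fineK Ef) inver gt_eqF//.
case: (perimeter E) => [p| |].
- by rewrite -EFinM !lte_fin ltr_pdivlMr.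
- by rewrite ltry.
- by rewrite gt0_mulNye ?lte_fin ?invr_gt0.
Qed.

End coarea_inequality.

(** * The isoperimetric inequality *)

Section isoperimetric.
Variables (R : realType) (d : nat).
Local Notation V := 'rV[R]_d.
Local Notation lam := (leb R d).
Local Notation e := (@ebasis R d).
Local Notation tv := (@Defs.total_variation R d).
Implicit Types (f u : V -> R) (x y : V) (j : 'I_d).

Lemma Cc1_shift f df y : Cc1 f df -> Cc1 (fun x => f (x + y)) (fun j x => df j (x + y)).
Proof.
have cs (g : V -> R) : continuous g -> continuous (fun x => g (x + y)).
  move=> cg x; apply: (continuous_comp (f := fun z : V => z + y)); last exact: cg.
  by apply: continuousD; [exact: cvg_id|exact: cst_continuous].
move=> [[cf fd cdf] [r f0]].
apply: (@C1_of_partials _ _ (r + `|y|)) => [j x|j|x xr].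
- apply: is_derive_line.
  have := fd j (x + y); rewrite -{1}[x + y]addr0 -{1}(scale0r (e j)) => /line_is_derive.
  by congr is_derive; apply/funext => s; rewrite addrAC.
- exact: cs.
- apply: f0 => /cubeP xy; apply: xr; apply/cubeP => i.
  have := xy i; rewrite !mxE => h; have := coord_le_norm y i => h2.
  by rewrite -[x 0 i](addrK (y 0 i)) (le_trans (ler_normB _ _))// lerD.
Qed.

Lemma Cc1N f df : Cc1 f df -> Cc1 (fun x => - f x) (fun j x => - df j x).
Proof.
move=> [[cf fd cdf] [r f0]]; split; last by exists r => x /f0 ->; rewrite oppr0.
split; first by move=> x; exact/continuousN/cf.
  by move=> j x; exact: (is_deriveN (fd j x)).
by move=> j x; exact/continuousN/cdf.
Qed.

(** Test with the fields whose only nonzero component is [f] or - [f], in position [j]. *)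
Lemma tv_partial_le u (c : R) f df j : itg u -> (tv u <= c%:E)%E ->
  Cc1 f df -> (forall x, `|f x| <= 1) -> `|integ (fun x => u x * df j x)| <= c.
Proof.
move=> ui uc; have main (g : V -> R) dg : Cc1 g dg -> (forall x, `|g x| <= 1) ->
    integ (fun x => u x * dg j x) <= c.
  move=> gc g1; pose phi i x := if i == j then g x else 0.
  pose dphi i k x := if i == j then dg k x else 0.
  have phic i : Cc1 (phi i) (dphi i).
    by rewrite /phi /dphi; case: (i == j) => //; exact: Cc1_0.
  have pa : admissible_field phi.
    apply: (admissible_fieldP phic) => x.
    rewrite (bigD1 j)//= big1 ?addr0; last first.
      by move=> i /negPf ij; rewrite /phi ij expr0n.
    by rewrite /phi eqxx -real_normK ?num_real// expr_le1.
  have := tv_leP ui uc pa; congr (_ <= _); apply: eq_integ => x; congr (_ * _).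
  rewrite (divergenceE phic) (bigD1 j)//= big1 ?addr0 /dphi ?eqxx//.
  by move=> i /negPf ->.
move=> fc f1; rewrite ler_norml (main f df)// andbT lerNl.
have [M _ fM] := Cc1_partial_bounded j fc.
have := main _ _ (Cc1N fc) (fun x => eq_ind_r (fun t => t <= 1) (f1 x) (normrN (f x))).
rewrite -mulN1r -integZ; last first.
  by apply: (itg_bounded_mul ui _ fM); exact/itg_measf/(Cc1_partial_itg j fc).
by congr (_ <= _); apply: eq_integ => x; rewrite mulN1r mulrN.
Qed.

(** On the support of [rho] each of the d coordinates is at most [s] in absolute value, so the
    average loses at most c d s. *)
Lemma mollifier_average_ge rho drho s (f : V -> R) (a c : R) : mollifier rho drho ->
  vanishes_off s rho -> 0 <= c -> itg (fun y => rho y * f y) ->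
  (forall y, a - c * \sum_i `|y 0 i| <= f y) ->
  a - c * (d%:R * s) <= integ (fun y => rho y * f y).
Proof.
move=> mr rs c0 rfi fa; have [[cr _ _] _] := mol_Cc1 mr.
have ri : itg rho by exact: continuous_vanishes_off_itg cr rs.
rewrite -[leLHS]mulr1 -[X in _ * X <= _](mol_integ mr) -integZ; last exact: ri.
apply: integ_le; [exact: itgZ|exact: rfi|move=> y]; rewrite mulrC.
have [ys|ys] := pselect (cube s y); last by rewrite rs // !mul0r.
apply: ler_wpM2l; first exact: mol_ge0 mr _.
apply: le_trans (fa y); rewrite lerD2l lerN2; apply: ler_wpM2l => //.
rewrite -[d in leRHS]card_ord -sumr_const mulr_suml; apply: ler_sum => i _.
by rewrite mul1r; move/cubeP: ys; exact.
Qed.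

Section fixed_test.
Variables (k : V -> R) (dk : 'I_d -> V -> R) (g : V -> R) (u : V -> R) (c : R).
Hypotheses (mk : mollifier k dk) (gi : itg g) (ui : itg u).
Hypotheses (uc : (tv u <= c%:E)%E) (kg1 : forall x, `|conv k g x| <= 1).
Variable (r : R).
Hypothesis (g0 : vanishes_off r g).

Let psi := conv k g.
Let dpsi j := conv (dk j) g.

Let psi_Cc1 : Cc1 psi dpsi.
Proof.
split; first exact: (conv_C1 mk gi).
by have [_ [s ks]] := mol_Cc1 mk; exists (r + s); exact: conv_vanishes_off.
Qed.

(** Correlation of [u] with the test function; its partial derivatives are integrals of [u] against
    those of a translate of [psi], hence bounded by the variation of [u]. *)
Let H y := integ (fun x => u x * psi (x + y)).

Let Hi y : itg (fun x => u x * psi (x + y)).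
Proof.
have [[cf _ _] _] := Cc1_shift y psi_Cc1.
by apply: (itg_bounded_mul (M := 1)) => //; exact: continuous_measurable_rV.
Qed.

Let H_derive j y :
  is_derive y (e j) H (integ (fun x => u x * dpsi j (x + y))).
Proof.
have [L [dl [dl0 kL]]] := conv_remainder mk gi.
have [D _ hD] := Cc1_partial_bounded j (Cc1_shift y psi_Cc1).
have di : itg (fun x => u x * dpsi j (x + y)).
  by apply: (itg_bounded_mul ui _ hD); exact/itg_measf/(Cc1_partial_itg j (Cc1_shift y psi_Cc1)).
apply: (@quad_remainder_is_derive _ _ _ _ _ _ (L * integ (fun x => `|u x|)) dl) => // h hd.
rewrite /H -integB// -integZ// -integB; [|exact: itgB|exact: itgZ].
rewrite mulrAC -integZ; last exact: itg_norm.
have i4 : itg (fun x => u x * psi (x + (y + h *: e j)) - u x * psi (x + y) -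
    h * (u x * dpsi j (x + y))).
  by apply: itgB; [exact: itgB|exact: itgZ].
apply: le_trans (integ_norm i4) _.
apply: integ_le; [exact: itg_norm|exact/itgZ/itg_norm|move=> x].
rewrite [h * (_ * _)]mulrCA -!mulrBr normrM mulrC ler_wpM2r//.
by rewrite addrA; exact: kL.
Qed.

(** Dual form of the estimate that translating a BV function by y moves it in L^1 by at most its
    variation times |y|_1. *)
Lemma translation_le y :
  `|integ (fun x => u x * psi x) - integ (fun x => u x * psi (x + y))| <=
  c * \sum_i `|y 0 i|.
Proof.
have := @partial_lipschitz _ _ H _ c (fun j x => H_derive j x) _ 0 y.
rewrite /H; under eq_integ => x do rewrite addr0.
under eq_bigr => i _ do rewrite mxE sub0r normrN.
apply=> j x; have sc := Cc1_shift x psi_Cc1.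
exact: (tv_partial_le j ui uc sc).
Qed.

Lemma conv_translationE rho drho (f : V -> R) x : mollifier rho drho -> itg f ->
  conv rho f x = integ (fun y => f (x + y) * rho y) /\
  itg (fun y => f (x + y) * rho y).
Proof.
move=> mr fi; have i := mollifier_conv_itg mr x fi.
have E y : f (y + x) * rho (x - (y + x)) = f (x + y) * rho y.
  by rewrite [y + x]addrC opprD addNKr (mol_even mr).
split; first by rewrite /conv -(integ_shift x i); exact: eq_integ.
by have := itg_shift x i; congr itg; apply/funext.
Qed.

(** By Fubini and evenness of [rho] the right-hand side is the average of [H] against [rho], and H y
    >= H 0 - c |y|_1 by [translation_le]. *)
Lemma conv_test_le rho drho s : mollifier rho drho -> vanishes_off s rho ->
  0 <= c ->
  integ (fun x => u x * psi x) - c * (d%:R * s) <=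
  integ (fun x => u x * conv rho psi x).
Proof.
move=> mr rs c0.
have [[[cpsi _ _] _] pi] : Cc1 psi dpsi /\ itg psi.
  by split=> //; exact: (conv_itg_L1 mk gi).1.
have rC1 := mol_Cc1 mr; have [[cr _ _] _] := rC1.
have ri : itg rho by exact: continuous_vanishes_off_itg cr rs.
have [K K0 rK] := Cc1_bounded rC1.
have H1 y : `|H y| <= integ (fun x => `|u x|).
  apply: le_trans (integ_norm (Hi y)) _.
  apply: integ_le; [exact/itg_norm|exact: itg_norm|move=> x].
  by rewrite normrM ler_piMr.
have cH : continuous H.
  apply: (lipschitz_continuous_rV c0).
  apply: partial_lipschitz => [j x|j x]; first exact: H_derive.
  exact: (tv_partial_le j ui uc (Cc1_shift x psi_Cc1)).
have Hri : itg (fun y => rho y * H y).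
  exact: itg_bounded_mul ri (continuous_measurable_rV cH) H1.
have cb (f : V -> R) x : itg f -> `|conv rho f x| <= K * integ (fun y => `|f y|).
  by move=> fi; exact: conv_bounded.
have mc (f : V -> R) : itg f -> measf (conv rho f).
  by move=> fi; apply: continuous_measurable_rV; have [] := conv_C1 mr fi.
have uci : itg (fun x => u x * conv rho psi x).
  exact: itg_bounded_mul ui (mc _ pi) (fun x => cb _ x pi).
have npi := itg_norm pi.
have E : integ (fun x => u x * conv rho psi x) = integ (fun y => rho y * H y).
  have m : measurable_fun [set: Ld R d * Ld R d]
      (fun z => u z.1 * psi ((z.1 : V) + (z.2 : V)) * rho z.2).
    apply: measurable_funM; last first.
      exact: (measurableT_comp (itg_measf ri) measurable_snd).
    apply: measurable_funM; first exact: (measurableT_comp (itg_measf ui) measurable_fst).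
    apply: (continuous_measurable_comp (S := fun z : Ld R d * Ld R d =>
      (z.1 : V) + (z.2 : V))) => // i.
    rewrite (_ : (fun z => _) = (fun z : Ld R d * Ld R d =>
      (z.1 : V) 0 i + (z.2 : V) 0 i)); last by apply/funext => z; rewrite !mxE.
    apply: measurable_funD.
    - exact: (measurableT_comp (measurable_coord i) measurable_fst).
    - exact: (measurableT_comp (measurable_coord i) measurable_snd).
  have := integral_Fubini (f := fun x y => u x * psi (x + y) * rho y) m.
  rewrite (eq_integral (fun x : Ld R d =>
    (`|u x| * conv rho (fun y => `|psi y|) x)%:E)); last first.
    move=> x _; have [-> i1] := conv_translationE x mr npi.
    rewrite -integZ// -EFin_integ; last exact: itgZ.
    apply: eq_integral => y _; congr EFin.
    by rewrite !normrM (ger0_norm (mol_ge0 mr _)) mulrA.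
  rewrite (EFin_integ (f := fun x => `|u x| * conv rho (fun y => `|psi y|) x)); last first.
    exact: itg_bounded_mul (itg_norm ui) (mc _ npi) (fun x => cb _ x npi).
  rewrite ltry => /(_ isT).
  rewrite (eq_integral (fun x : Ld R d => (u x * conv rho psi x)%:E)); last first.
    move=> x _; have [-> i1] := conv_translationE x mr pi.
    rewrite -integZ// -EFin_integ; last exact: itgZ.
    by apply: eq_integral => y _; rewrite mulrA.
  rewrite [RHS in (_ = RHS -> _)](eq_integral (fun y : Ld R d =>
      (rho y * H y)%:E)); last first.
    move=> y _; rewrite /H -integZ// -EFin_integ; last exact: itgZ.
    by apply: eq_integral => x _; rewrite mulrC.
  by rewrite (EFin_integ uci) (EFin_integ Hri); exact: EFin_inj.
rewrite E; apply: (mollifier_average_ge mr rs c0 Hri) => y.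
have := translation_le y; rewrite ler_norml => /andP[_ h].
by rewrite lerBlDr addrC -lerBlDr; exact: h.
Qed.
End fixed_test.

(** [conv_test_le] with u = g = 1_E, the inner mollifier [k] being an approximation of the identity
    with L^1 error [eps]. The right-hand side appears because convolution with [rho] is bounded by K
    |E|. *)
Lemma isoperimetric E r rho drho s (c K : R) :
  measurable (E : set (Ld R d)) -> E `<=` cube r -> (0 < lam E)%E -> 0 <= c -> (perimeter E <= c%:E)%E ->
  mollifier rho drho -> vanishes_off s rho -> (forall x, rho x <= K) ->
  fine (lam E) - c * (d%:R * s) <= K * fine (lam E) ^+ 2.
Proof.
move=> mE Er E_pos c0 Ec mr rs rK.
have Efin : (lam E < +oo)%E by apply: le_lt_trans (le_outer_measure _ _ _ Er) _; exact: cube_lty.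
have Ei := itg_indic mE Efin; rewrite -(integ_indic mE); set a := integ _.
have E0 x : 0 <= \1_E x :> R by rewrite indicE.
have E1 x : `|\1_E x| <= 1 :> R by rewrite indicE; case: (_ \in _); rewrite ?normr1 ?normr0.
have a0 : 0 <= a by exact: integ_ge0.
have K0 : 0 <= K := le_trans (mol_ge0 mr 0) (rK 0).
apply/ler_addgt0Pr => eps eps0.
have [dl dl0 hdl] := itg_L1_mollifiable Ei eps0.
have [k [dk [mk kdl]]] := mollifier_exists E_pos dl0.
have kE := hdl _ _ _ mk kdl (lexx _).
have kE0 x : 0 <= conv k \1_E x.
  by apply: integ_ge0 => y; rewrite mulr_ge0// (mol_ge0 mk).
have kE1 x : `|conv k \1_E x| <= 1.
  rewrite ger0_norm// -(integ_mollifier_reflect mk x); apply: integ_le.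
  - exact: (mollifier_conv_itg mk x Ei).
  - exact: (mollifier_reflect_itg mk x).
  - move=> y; rewrite -[leRHS]mul1r; apply: ler_wpM2r; first exact: (mol_ge0 mk).
    exact: le_trans (ler_norm _) (E1 y).
have E_off : vanishes_off r (\1_E : V -> R).
  by move=> x xr; rewrite indicE memNset// => /Er.
have [ki kL1] := conv_itg_L1 mk Ei.
have := conv_test_le mk Ei Ei Ec kE1 E_off mr rs c0.
have [[crho _ _] _] := mol_Cc1 mr.
have rK' x : `|rho x| <= K by rewrite ger0_norm// (mol_ge0 mr).
have mc : measf (conv rho (conv k \1_E)).
  by apply: continuous_measurable_rV; have [] := conv_C1 mr ki.
have na : integ (fun x => `|\1_E x|) = a.
  by apply: eq_integ => x; rewrite ger0_norm.
have cM x : `|conv rho (conv k \1_E) x| <= K * a.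
  apply: le_trans (conv_bounded x ki crho rK') _.
  by apply: ler_wpM2l => //; apply: le_trans kL1 _; rewrite na.
have h1 : integ (fun x => \1_E x * conv rho (conv k \1_E) x) <= K * a ^+ 2.
  rewrite expr2 mulrA -integZ; last exact: Ei.
  apply: integ_le; [exact: itg_bounded_mul Ei mc cM|exact: itgZ|move=> x].
  rewrite mulrC; apply: ler_wpM2r => //; exact: le_trans (ler_norm _) (cM x).
have := integ_mul_dist ki Ei (itg_measf Ei) E1.
rewrite [X in `|_ - X|](_ : _ = a); last first.
  by apply: eq_integ => x; rewrite indicE; case: (_ \in _); rewrite ?mulr1 ?mulr0.
rewrite mul1r (@eq_integ _ _ (fun x => conv k \1_E x * \1_E x)
  (fun x => \1_E x * conv k \1_E x)); last by move=> x; rewrite mulrC.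
move=> /le_trans/(_ kE); rewrite ler_norml => /andP[+ _]; move: h1.
move: (integ _) (integ _) => p q; clear - a; move: a (d%:R) => a' D; lra.
Qed.

(* With [s * d * M <= 1/2] in [isoperimetric] the constant depends only on [M]. *)
Lemma perimeter_measure_lower_bound (M : R) (A : set V) : (0 < lam A)%E -> 0 <= M ->
  exists2 m, 0 < m & forall E r, measurable (E : set (Ld R d)) -> E `<=` cube r ->
    (0 < lam E)%E -> (perimeter E <= (M * fine (lam E))%:E)%E -> m <= fine (lam E).
Proof.
move=> A0 M0; pose s : R := (2 * (d%:R * M + 1))^-1.
have D0 : 0 < d%:R * M + 1 :> R by rewrite ltr_wpDl// mulr_ge0.
have s0 : 0 < s by rewrite invr_gt0 mulr_gt0.
have sM : M * (d%:R * s) <= 1 / 2.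
  rewrite /s invfM mulrCA !mulrA ler_pdivrMr// [d%:R * M]mulrC.
  move: D0; rewrite [d%:R * M]mulrC; lra.
have [rho [drho [mr rs]]] := mollifier_exists A0 s0.
have [K K0 rK] := Cc1_bounded (mol_Cc1 mr).
exists (2 * (K + 1))^-1; first by rewrite invr_gt0 mulr_gt0// ltr_wpDl.
move=> E r mE Er E0 PE.
have Efin : (lam E < +oo)%E by apply: le_lt_trans (le_outer_measure _ _ _ Er) _; exact: cube_lty.
have e0 : 0 < fine (lam E) by rewrite fine_gt0// E0.
have rK' x : rho x <= K by exact: le_trans (ler_norm _) (rK x).
have := isoperimetric mE Er E0 (mulr_ge0 M0 (ltW e0)) PE mr rs rK'.
move: (fine (lam E)) e0 => a a0 h.
have h2 : a * (M * (d%:R * s)) <= a * (1 / 2) by rewrite ler_pM2l.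
have h3 : a * 1 <= a * (2 * ((K + 1) * a)).
  move: h h2; rewrite -mulrA mulrCA; nra.
rewrite invfM ler_pdivrMr ?ltr_wpDl// mulrC; move: h3; rewrite ler_pM2l//; lra.
Qed.

End isoperimetric.

(** * Existence of Cheeger functions *)

Section L1_limit.
Variables (R : realType) (d : nat).
Local Notation V := 'rV[R]_d.
Local Notation lam := (leb R d).
Implicit Types (f : V -> R) (x : V).

Definition gap (f_ : nat -> V -> R) (n : nat) x := `|f_ n.+1 x - f_ n x|.

Lemma gap_summable_cvg (f_ : nat -> V -> R) x :
  (\sum_(n <oo) (gap f_ n x)%:E < +oo)%E -> cvgn (f_ ^~ x) /\
  forall n, `|f_ n x| <= `|f_ 0%N x| + fine (\sum_(n <oo) (gap f_ n x)%:E)%E.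
Proof.
set G := (\sum_(n <oo) _)%E => Gfin.
have g0 n : (0 <= (gap f_ n x)%:E)%E by rewrite lee_fin normr_ge0.
have G0 : (0 <= G)%E by apply: nneseries_ge0.
have GE : G = (fine G)%:E by rewrite fineK// ge0_fin_numE.
have part n : \sum_(0 <= i < n) gap f_ i x <= fine G.
  rewrite -lee_fin -GE -sumEFin; apply: nneseries_lim_ge => *; exact: g0.
pose u := telescope (f_ ^~ x).
have cu : cvgn (series u).
  apply: normed_cvg; apply: (@nondecreasing_is_cvgn _ (fun n => \sum_(0 <= i < n) gap f_ i x)).
    by apply/nondecreasing_seqP => n; rewrite big_nat_recr//= lerDl; exact: normr_ge0.
  by exists (fine G) => _ [n _ <-]; exact: part.
have E : (f_ ^~ x) = (fun n => f_ 0%N x + series u n).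
  by apply/funext => n; rewrite (eq_sum_telescope (f_ ^~ x) n).
split; first by rewrite E; apply: is_cvgD => //; exact: is_cvg_cst.
move=> n; rewrite [f_ n x](congr1 (fun h => h n) E).
apply: le_trans (ler_normD _ _) _; rewrite lerD2l; apply: le_trans (part n).
exact: ler_norm_sum.
Qed.

(** The gaps have a finite total integral, so their sum is finite almost everywhere and, added to
    |f_0|, dominates the sequence. The alternative in the conclusion holds at every point, so that
    nonnegativity and vanishing off a set pass to the limit everywhere. *)
Lemma L1_limit (f_ : nat -> V -> R) : (forall n, itg (f_ n)) ->
  (forall n, integ (fun x => `|f_ n.+1 x - f_ n x|) <= 1 / (2 ^ n.+1)%:R) ->
  exists f, [/\ itg f, forall x, (f_ ^~ x @ \oo --> f x) \/ f x = 0 &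
    integ (fun x => `|f_ n x - f x|) @[n --> \oo] --> 0].
Proof.
move=> fi fgap; pose G (x : Ld R d) := (\sum_(n <oo) (gap f_ n x)%:E)%E.
have g0 n x : (0 <= (gap f_ n x)%:E)%E by rewrite lee_fin normr_ge0.
have gi n : itg (gap f_ n) by exact/itg_norm/itgB.
have mg n : measurable_fun [set: Ld R d] (fun x : Ld R d => (gap f_ n x)%:E).
  by apply/measurable_EFinP; exact: itg_measf.
have G0 x : (0 <= G x)%E by apply: nneseries_ge0.
have mG : measurable_fun [set: Ld R d] G.
  by apply: ge0_emeasurable_sum => //; move=> n x _ _; exact: g0.
have GI : (\int[lam]_x G x < +oo)%E.
  rewrite integral_nneseries//.
  apply: (@le_lt_trans _ _ 1%E); last exact: ltry.
  apply: le_trans (epsilon_trick0 xpredT (ler01 : 0 <= 1 :> R)).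
  apply: lee_nneseries => [n _ _|n _]; first exact: integral_ge0.
  by rewrite (EFin_integ (gi n)) lee_fin; exact: fgap.
have Gi : lam.-integrable [set: Ld R d] G.
  apply/integrableP; split=> //.
  by under eq_integral do rewrite gee0_abs//.
pose A : set (Ld R d) := [set x | (G x < +oo)%E].
have mA : measurable A.
  rewrite -[A]setTI; apply: emeasurable_fun_infty_o => //.
have FA := ae_filter_ringOfSetsType (lebesgue_measure_rV R d).
have aeA : {ae lam, forall x : Ld R d, A x}.
  apply: filterS (integrable_ae measurableT Gi) => x /(_ I).
  by rewrite ge0_fin_numE.
(* Setting the functions to 0 where the gaps are not summable makes the sequence converge at every
   point. *)
pose h n x : R := f_ n x * \1_(A : set V) x.
have hA n x : A x -> h n x = f_ n x by move=> Ax; rewrite /h indicE mem_set// mulr1.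
have hnA n x : ~ A x -> h n x = 0 by move=> Ax; rewrite /h indicE memNset// mulr0.
have hc x : exists l : R, h ^~ x @ \oo --> l.
  have [Ax|nAx] := pselect (A x).
    have [cf _] := gap_summable_cvg Ax; exists (lim (f_ ^~ x @ \oo)).
    by under eq_fun do rewrite hA//.
  by exists 0; under eq_fun do rewrite hnA//; exact: cvg_cst.
have [f hf] := choice hc.
have mh n : measf (h n) by apply: measfM; [exact: itg_measf|exact: measf_indic].
have mf : measf f by apply: (measurable_fun_cvg mh) => x _; exact: hf.
pose g x := `|f_ 0%N x| + fine (G x).
have Gfi : itg (fun x => fine (G x)).
  apply: (le_integrable measurableT _ _ Gi).
    apply/measurable_EFinP; exact: (measurableT_comp (fine_measurable measurableT) mG).
  move=> x _ /=.
  by case: (G x) (G0 x) => [s||]//= _; rewrite leey.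
have gi' : itg g by apply: itgD => //; exact: itg_norm.
have hg n x : `|h n x| <= g x.
  have [Ax|nAx] := pselect (A x).
    by rewrite hA//; have [_] := gap_summable_cvg Ax; exact.
  by rewrite hnA// normr0 addr_ge0// fine_ge0.
have [fi' fl _] := integ_dominated mh mf gi' hg (aeW lam hf).
exists f; split=> //.
  move=> x; have [Ax|nAx] := pselect (A x).
    by left; have := hf x; under eq_fun do rewrite hA//.
  right; have := hf x; under eq_fun do rewrite hnA//.
  move=> h0; apply: (cvg_unique _ h0 _); [exact: norm_hausdorff|exact: cvg_cst].
rewrite (_ : (fun n => _) = (fun n => integ (fun x => `|h n x - f x|))) //.
apply/funext => n; apply: ae_eq_integ.
- exact/measf_norm/measfB/mf/itg_measf.
- exact/measf_norm/measfB.
- by apply: filterS aeA => x Ax; rewrite hA.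
Qed.

End L1_limit.

(** * Near-minimizers of the L^2 norm in nested convex constraints *)

Section minimizing_sequence.
Variables (R : realType) (d : nat).
Local Notation V := 'rV[R]_d.
Local Notation lam := (leb R d).
Implicit Types (u v w : V -> R) (x : V).
Variables (F : set V) (C : R -> (V -> R) -> Prop) (B : R).
Hypothesis mF : measurable (F : set (Ld R d)).
Hypothesis Ffin : (lam F < +oo)%E.
Hypothesis C_itg : forall e w, C e w -> itg w /\ itg (fun x => w x ^+ 2).
Hypothesis C_off : forall e w x, C e w -> ~ F x -> w x = 0.
Hypothesis C_le : forall e e' w, e <= e' -> C e w -> C e' w.
Hypothesis C_mid : forall e u w, C e u -> C e w -> C e (fun x => (u x + w x) / 2).
Hypothesis C_bounded : forall e, 0 < e ->
  exists w, C e w /\ integ (fun x => w x ^+ 2) <= B.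

Let sq u := integ (fun x => u x ^+ 2).

Let sq_ge0 u : 0 <= sq u.
Proof. by apply: integ_ge0 => x; exact: sqr_ge0. Qed.

(** J is the limit as e tends to 0 of the infimum of [sq] on [C e]. The infimum grows as e
    decreases, so J is the supremum of all lower bounds over all e, finite by [C_bounded]. One J for
    all levels makes near-minimizers at different levels comparable. *)
Lemma near_minimizer_exists : exists J, forall eta, 0 < eta ->
  exists ew : R * (V -> R), [/\ 0 < ew.1, ew.1 <= eta, C ew.1 ew.2, sq ew.2 <= J + eta &
    forall v, C ew.1 v -> J - eta <= sq v].
Proof.
pose T : set R := [set t | exists2 e, 0 < e & forall v, C e v -> t <= sq v].
have T0 : T 0 by exists 1 => // v _; exact: sq_ge0.
have TB : ubound T B.
  move=> t [e e0 et]; have [w [Cw wB]] := C_bounded e0.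
  exact: le_trans (et _ Cw) wB.
have Ts : has_sup T by split; [exists 0|exists B].
exists (sup T) => eta eta0.
have [t [e e0 et] tJ] := sup_adherent eta0 Ts.
pose e' := Num.min e eta.
have e'0 : 0 < e' by rewrite lt_min e0.
have [w [Cw wJ]] : exists w, C e' w /\ sq w <= sup T + eta.
  apply: contrapT => h.
  have : T (sup T + eta).
    exists e' => // v Cv; have [//|/ltW vJ] := leP (sup T + eta) (sq v).
    by exfalso; apply: h; exists v.
  by move=> /(ub_le_sup Ts.2); rewrite gerDl leNgt eta0.
exists (e', w); split=> //=; first by rewrite /e' ge_min lexx orbT.
move=> v Cv; apply: le_trans (ltW tJ) (et _ _).
by apply: C_le Cv; rewrite /e' ge_min lexx.
Qed.

(** Both functions and their midpoint lie in the larger of the two classes; the parallelogram law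
    gives 2 (J + eta) + 2 (J + eta) - 4 (J - eta) = 8 eta. *)
Lemma near_minimizers_dist e1 e2 w1 w2 (J eta : R) : C e1 w1 -> C e2 w2 ->
  sq w1 <= J + eta -> sq w2 <= J + eta ->
  (forall v, C e1 v -> J - eta <= sq v) -> (forall v, C e2 v -> J - eta <= sq v) ->
  itg (fun x => (w1 x - w2 x) ^+ 2) /\ integ (fun x => (w1 x - w2 x) ^+ 2) <= 8 * eta.
Proof.
move=> C1 C2 s1 s2 l1 l2.
have [e [C1' C2' l]] : exists e, [/\ C e w1, C e w2 & forall v, C e v -> J - eta <= sq v].
  have [e12|/ltW e12] := leP e1 e2.
    by exists e2; split=> //; exact: C_le C1.
  by exists e1; split=> //; exact: C_le C2.
have Cm := C_mid C1' C2'; have lm := l _ Cm.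
have [_ i1] := C_itg C1; have [_ i2] := C_itg C2; have [_ im] := C_itg Cm.
have E x : (w1 x - w2 x) ^+ 2 = (2 * w1 x ^+ 2 + 2 * w2 x ^+ 2) -
    4 * ((w1 x + w2 x) / 2) ^+ 2 by field.
have i12 : itg (fun x => 2 * w1 x ^+ 2 + 2 * w2 x ^+ 2) by apply: itgD; exact: itgZ.
split; first by under eq_fun do rewrite E; apply: itgB => //; exact: itgZ.
rewrite (eq_integ E) integB//; last exact: itgZ.
rewrite integD; [|exact: itgZ..].
rewrite !integZ//; move: s1 s2 lm; rewrite /sq.
move: (integ _) (integ _) (integ _) => a b c.
clear i1 i2 im i12; lra.
Qed.

(* [|f| <= th + f^2 / (4 th)] on [F] *)
Lemma L1_le_L2 f (th c : R) : 0 < th -> itg f -> itg (fun x => f x ^+ 2) ->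
  (forall x, ~ F x -> f x = 0) -> integ (fun x => f x ^+ 2) <= c ->
  integ (fun x => `|f x|) <= th * fine (lam F) + c / (4 * th).
Proof.
move=> th0 fi f2i f0 fc; have Fi := itg_indic mF Ffin.
rewrite -(integ_indic mF) -integZ//.
apply: (@le_trans _ _ (integ (fun x => th * \1_F x + (4 * th)^-1 * f x ^+ 2))).
  apply: integ_le; [exact: itg_norm|by apply: itgD; exact: itgZ|move=> x].
  have [Fx|Fx] := pselect (F x); last first.
    by rewrite f0// normr0 indicE memNset// mulr0 expr0n mulr0 addr0.
  rewrite indicE mem_set// mulr1 -[f x ^+ 2]real_normK ?num_real//.
  rewrite -subr_ge0 (_ : _ - _ = (4 * th)^-1 * (2 * th - `|f x|) ^+ 2).
    by rewrite mulr_ge0 ?sqr_ge0// invr_ge0 mulr_ge0// ltW.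
  by field; rewrite gt_eqF.
rewrite integD; [|exact: itgZ..]; rewrite [X in _ + X]integZ// lerD2l mulrC.
by rewrite ler_wpM2r// invr_ge0 mulr_ge0// ltW.
Qed.

Lemma minimizing_sequence : exists2 w_ : nat -> V -> R,
  forall n, C (1 / (2 ^ n.+1)%:R) (w_ n) &
  forall n, integ (fun x => `|w_ n.+1 x - w_ n x|) <= 1 / (2 ^ n.+1)%:R.
Proof.
have [J hJ] := near_minimizer_exists.
pose A := fine (lam F); have A0 : 0 <= A by apply: fine_ge0; exact: outer_measure_ge0.
pose tau n : R := 1 / (2 ^ n.+1)%:R.
have tau0 n : 0 < tau n by rewrite divr_gt0// ltr0n expn_gt0.
have tauS n : tau n.+1 <= tau n.
  by rewrite /tau !div1r lef_pV2 ?posrE ?ltr0n ?expn_gt0// ler_nat leq_exp2l.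
have tau1 n : tau n <= 1.
  by rewrite /tau ler_pdivrMr ?ltr0n ?expn_gt0// mul1r ler1n expn_gt0.
(* Chosen with th = tau / (2 (A + 1)) in [L1_le_L2]: the bound th A + 8 eta / (4 th) is then tau A /
   (2 (A + 1)) + tau / 2 <= tau. *)
pose eta n := tau n ^+ 2 / (8 * (A + 1)).
have D0 : 0 < 8 * (A + 1) by rewrite mulr_gt0// ltr_wpDl.
have eta0 n : 0 < eta n by rewrite divr_gt0// exprn_gt0.
have etaS n : eta n.+1 <= eta n.
  by rewrite ler_pM2r ?invr_gt0// ler_pXn2r ?nnegrE ?(ltW (tau0 _)).
have eta_tau n : eta n <= tau n.
  rewrite ler_pdivrMr// expr2 ler_wpM2l ?(ltW (tau0 _))//.
  by apply: le_trans (tau1 n) _; move: A0 => /=; lra.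
have [ew hew] := choice (fun n => hJ _ (eta0 n)).
exists (fun n => (ew n).2) => n.
  by have [_ h Cn _ _] := hew n; apply: C_le Cn; exact: le_trans h (eta_tau n).
have [_ _ C0 s0 l0] := hew n; have [_ _ C1 s1 l1] := hew n.+1.
have s1' : sq (ew n.+1).2 <= J + eta n by apply: le_trans s1 _; rewrite lerD2l.
have l1' v : C (ew n.+1).1 v -> J - eta n <= sq v.
  by move=> /l1; apply: le_trans; rewrite lerD2l lerN2.
have [i2 b2] := near_minimizers_dist C1 C0 s1' s0 l1' l0.
have th0 : 0 < tau n / (2 * (A + 1)) by rewrite divr_gt0// mulr_gt0// ltr_wpDl.
apply: le_trans (L1_le_L2 th0 _ i2 _ b2) _.
- by apply: itgB; [have [] := C_itg C1|have [] := C_itg C0].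
- by move=> x Fx; rewrite (C_off C1 Fx) (C_off C0 Fx) subrr.
rewrite -/A -/(tau n) /eta.
have A1 : A + 1 != 0 by rewrite gt_eqF// ltr_wpDl.
have t1 : tau n != 0 by rewrite gt_eqF.
rewrite (_ : _ / (4 * _) = tau n / 2); last by field; rewrite A1 t1.
rewrite (_ : _ * A = tau n / 2 * (A / (A + 1))); last by field.
have : A / (A + 1) <= 1 by rewrite ler_pdivrMr ?ltr_wpDl// mul1r lerDl.
have th : 0 <= tau n / 2 by rewrite divr_ge0// ltW.
move=> /(ler_wpM2l th); move: (tau n) (_ / (A + 1)) => t q; lra.
Qed.

End minimizing_sequence.

(** * Cheeger constants and functions attaining them *)

Section cheeger_functions.
Variables (R : realType) (d : nat).
Local Notation V := 'rV[R]_d.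
Local Notation lam := (leb R d).
Local Notation tv := (@Defs.total_variation R d).
Implicit Types (u w : V -> R) (x : V) (E F G : set (Ld R d)).

Lemma subae_le E F : subae E F -> (lam E <= lam F)%E.
Proof.
move=> EF; rewrite -[leRHS]adde0 -EF.
apply: le_trans (outer_measureU2 _ _ _); apply: le_outer_measure => x Ex.
by have [Fx|Fx] := pselect (F x); [left|right].
Qed.

Lemma subae_trans E F G : subae E F -> subae F G -> subae E G.
Proof.
move=> EF FG; apply/eqP; rewrite eq_le outer_measure_ge0 andbT.
have -> : 0%E = (lam (E `\` F) + lam (F `\` G))%E by rewrite EF FG adde0.
apply: le_trans (outer_measureU2 _ _ _); apply: le_outer_measure => x [Ex Gx].
by have [Fx|Fx] := pselect (F x); [right|left].
Qed.

Lemma subset_subae E F : E `<=` F -> subae E F.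
Proof. by move=> EF; rewrite /subae (_ : _ `\` _ = set0) ?outer_measure0// setD_eq0. Qed.

Lemma cheeger_ge0 F : (lam F < +oo)%E -> (0 <= cheeger F)%E.
Proof.
move=> Ffin; apply: le_ereal_inf_tmp => _ [E [mE [EF _]] <-].
apply: mule_ge0; last by rewrite inve_ge0; exact: outer_measure_ge0.
apply: tv_ge0; apply: itg_indic => //; exact: le_lt_trans (subae_le EF) Ffin.
Qed.

Lemma cheeger_subae E F : subae E F -> (cheeger F <= cheeger E)%E.
Proof.
move=> EF; apply: le_ereal_inf => _ [G [mG [GE G0]] <-]; exists G => //; do 2!split=> //.
  exact: subae_trans GE EF.
Qed.

(** Replaces a competitor contained in [F] up to a null set by one truly contained in it. *)
Lemma subae_setI E F : measurable E -> measurable F -> subae E F -> (lam F < +oo)%E ->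
  lam (E `&` F) = lam E /\ perimeter (E `&` F) = perimeter E.
Proof.
move=> mE mF EF Ffin; have Efin := le_lt_trans (subae_le EF) Ffin.
have E1 : lam (E `&` F) = lam E.
  apply/eqP; rewrite eq_le; apply/andP; split; first exact: le_outer_measure.
  by apply: subae_le; rewrite /subae setDIr setDv set0U.
have mEF := measurableI _ _ mE mF.
split=> //; apply: eq_tv.
- by apply: itg_indic => //; rewrite E1.
- exact: itg_indic.
- exists (E `\` F); split=> //; first exact: measurableD.
  move=> x /= h; apply: contrapT => nEF; apply: h; rewrite !indicE.
  have [Ex|Ex] := pselect (E x); last by rewrite !memNset// => -[].
  have Fx : F x by apply: contrapT => Fx; apply: nEF.
  by rewrite !mem_set.
Qed.

Lemma near_cheeger_set F (h eps : R) : measurable F -> (lam F < +oo)%E ->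
  cheeger F = h%:E -> 0 < eps ->
  exists E, [/\ measurable E, E `<=` F, (0 < lam E)%E &
    (perimeter E <= ((h + eps) * fine (lam E))%:E)%E].
Proof.
move=> mF Ffin Fh eps0.
have [|_ [E [mE [EF E0]] <-]] := lb_ereal_inf_adherent eps0 (S := [set (perimeter E * (lam E)^-1)%E
            | E in [set E | measurable E /\ subae E F /\ (0 < lam E)%E]]).
  by rewrite -/(cheeger F) Fh.
rewrite -/(cheeger F) Fh => lt.
have [E1 E2] := subae_setI mE mF EF Ffin.
exists (E `&` F); split; [exact: measurableI|exact: subIsetr|by rewrite E1|].
rewrite E1 E2; move: lt.
have Efin : lam E \is a fin_num.
  by rewrite ge0_fin_numE ?outer_measure_ge0//; exact: le_lt_trans (subae_le EF) Ffin.
have e0 : 0 < fine (lam E) by rewrite fine_gt0// E0 -ge0_fin_numE// outer_measure_ge0.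
rewrite -{1}(fineK Efin) inver gt_eqF// lte_pdivrMr// => /ltW.
by rewrite EFinM EFinD.
Qed.

Lemma cheeger_function_exists F (h r : R) : measurable F -> F `<=` cube r ->
  cheeger F = h%:E -> exists w, [/\ itg w, forall x, 0 <= w x,
    forall x, ~ F x -> w x = 0, integ w = 1 & (tv w <= h%:E)%E].
Proof.
move=> mF Fr Fh.
have Ffin : (lam F < +oo)%E.
  by apply: le_lt_trans (le_outer_measure _ _ _ Fr) _; exact: cube_lty.
have h0 : 0 <= h by rewrite -lee_fin -Fh cheeger_ge0.
pose C e w := [/\ itg w, itg (fun x => w x ^+ 2),
  forall x, 0 <= w x /\ (~ F x -> w x = 0), integ w = 1 & (tv w <= (h + e)%:E)%E].
have [E0 [_ E0F E0pos _]] := near_cheeger_set mF Ffin Fh ltr01.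
have F0 : (0 < lam F)%E by apply: lt_le_trans E0pos _; exact: le_outer_measure.
have [m m0 hm] := perimeter_measure_lower_bound F0 (addr_ge0 h0 ler01).
have C_le e e' w : e <= e' -> C e w -> C e' w.
  by move=> ee [? ? ? ? wt]; split=> //; apply: le_trans wt _; rewrite lee_fin lerD2l.
have C_itg e w : C e w -> itg w /\ itg (fun x => w x ^+ 2) by case.
have C_off e w x : C e w -> ~ F x -> w x = 0 by move=> [_ _ + _ _] => /(_ x)[].
have C_mid e u w : C e u -> C e w -> C e (fun x => (u x + w x) / 2).
  move=> [ui u2 u0 u1 ut] [wi w2 w0 w1 wt].
  have E x : (u x + w x) / 2 = 2^-1 * (u x + w x) by rewrite mulrC.
  have i : itg (fun x => (u x + w x) / 2).
    by under eq_fun do rewrite E; apply/itgZ/itgD.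
  split=> //.
  - apply: (itg_le _ (itgD u2 w2)) => [|x].
      by apply: measfM; exact: itg_measf.
    rewrite ger0_norm ?sqr_ge0//.
    have := sqr_ge0 (u x - w x); have := sqr_ge0 (u x); have := sqr_ge0 (w x).
    by clear; move: (u x) (w x) => a b; nra.
  - move=> x; have [a0 aF] := u0 x; have [b0 bF] := w0 x; split.
      by rewrite divr_ge0// addr_ge0.
    by move=> Fx; rewrite aF// bF// addr0 mul0r.
  - by rewrite (eq_integ E) integZ ?integD ?u1 ?w1//; [field|exact: itgD].
  - rewrite (_ : (fun x => _) = (fun x => 2^-1 * (u x + w x))); last exact/funext.
    have i2 : 0 <= 2^-1 :> R by rewrite invr_ge0.
    have := tv_scale_le i2 (itgD ui wi) (tv_add_le ui wi ut wt).
    by rewrite (_ : 2^-1 * _ = h + e)//; field.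
have C_bounded e : 0 < e -> exists w, C e w /\ integ (fun x => w x ^+ 2) <= m^-1.
  (* Keeping the tolerance at most 1 makes the perimeter ratio at most h + 1, the value for which
     [m] was fixed. The normalised indicator of [E] then has squared L^2 norm 1 / |E| <= 1 / m,
     whatever e is. *)
  move=> e0; have e'0 : 0 < Num.min e 1 by rewrite lt_min e0 ltr01.
  have [E [mE EF Epos EP]] := near_cheeger_set mF Ffin Fh e'0.
  have Efin : (lam E < +oo)%E by apply: le_lt_trans Ffin; exact: le_outer_measure.
  have Ei := itg_indic mE Efin.
  have a0 : 0 < fine (lam E) by rewrite fine_gt0// Epos.
  have am : m <= fine (lam E).
    apply: (hm E r) => //; first exact: subset_trans Fr.
    apply: le_trans EP _; rewrite lee_fin ler_pM2r// lerD2l.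
    by rewrite ge_min lexx orbT.
  pose w x := (fine (lam E))^-1 * \1_E x.
  have w2 : (fun x => w x ^+ 2) = (fun x => (fine (lam E))^-1 * w x).
    apply/funext => x; rewrite /w indicE.
    by case: (x \in E); rewrite ?mulr1 ?mulr0 ?expr0n.
  have wi : itg w by exact: itgZ.
  have w1 : integ w = 1 by rewrite integZ// integ_indic// mulVf// gt_eqF.
  exists w; split; last by rewrite w2 integZ// w1 mulr1 lef_pV2.
  split=> //; first by rewrite w2; exact: itgZ.
    move=> x; split; first by apply: mulr_ge0; [rewrite invr_ge0 ltW|rewrite indicE].
    by move=> Fx; rewrite /w indicE memNset ?mulr0// => /EF.
  have ai : 0 <= (fine (lam E))^-1 by rewrite invr_ge0 ltW.
  apply: le_trans (tv_scale_le ai Ei EP) _.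
  rewrite lee_fin mulrCA mulVf ?gt_eqF// mulr1 lerD2l.
  by rewrite ge_min lexx.
have [w_ wC wgap] := minimizing_sequence mF Ffin C_itg C_off C_le C_mid C_bounded.
have wi n : itg (w_ n) by have [] := wC n.
have [w [iw wlim wcvg]] := L1_limit wi wgap.
have near eps : 0 < eps -> exists n, C eps (w_ n) /\
    integ (fun x => `|w_ n x - w x|) <= eps.
  move=> eps0.
  have [n _ /(_ n (leqnn n))[/ltW n1 /ltW n2]] :=
    filterI (near_infty_natSinv_lt (PosNum eps0)) (cvgr_lt (0 : R) wcvg eps eps0).
  exists n; split=> //; apply: C_le (wC n); apply: le_trans n1.
  by rewrite div1r lef_pV2 ?posrE ?ltr0n ?expn_gt0// ler_nat ltnW// ltn_expl.
exists w; split=> //.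
- move=> x; have [wx|->//] := wlim x; rewrite -(cvg_lim (@norm_hausdorff _ _) wx).
  apply: limr_ge; first by apply/cvg_ex; exists (w x).
  by apply: nearW => n; have [_ _ /(_ x)[]] := wC n.
- move=> x Fx; have [+|->//] := wlim x.
  rewrite (_ : w_ ^~ x = cst 0); last by apply/funext => n; exact: C_off (wC n) Fx.
  move=> wx; apply: (cvg_unique _ wx _); [exact: norm_hausdorff|exact: cvg_cst].
- apply/eqP; rewrite -subr_eq0 -normr_le0; apply/ler_addgt0Pr => eps eps0.
  have [n [[_ _ _ wn1 _] wn]] := near _ eps0.
  rewrite add0r distrC -wn1 -integB//; apply: le_trans wn.
  by apply: integ_norm; exact: itgB.
- apply: tv_lsc => // eps eps0; have [n [[_ _ _ _ wt] wn]] := near _ eps0.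
  by exists (w_ n).
Qed.

End cheeger_functions.

(** * N-sets and N-functions *)

Section Nsets_and_Nfunctions.
Variables (R : realType) (d N : nat).
Local Notation V := 'rV[R]_d.
Local Notation lam := (leb R d).
Local Notation tv := (@Defs.total_variation R d).
Variables (Omega : set (Ld R d)) (r : R).
Hypotheses (mO : measurable Omega) (Or : Omega `<=` cube r).

Let Ofin : (lam Omega < +oo)%E.
Proof. by apply: le_lt_trans (le_outer_measure _ _ _ Or) _; exact: cube_lty. Qed.

(** Equality, not only an upper bound, is what serves a [Phi] that need not be monotone. The lower
    bound is [cheeger_superlevel_le] for [w], whose support lies in [E]. *)
Lemma cheeger_function_of_subae (E : set (Ld R d)) : measurable E -> subae E Omega ->
  cheeger E \is a fin_num ->
  exists w : V -> R, [/\ itg w, forall x, 0 <= w x,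
    forall x, ~ (E `&` Omega) x -> w x = 0, integ w = 1 & tv w = cheeger E].
Proof.
move=> mE EO Efin.
have mEO := measurableI _ _ mE mO.
have EEO : subae E (E `&` Omega) by rewrite /subae setDIr setDv set0U.
have hE : cheeger (E `&` Omega) = cheeger E.
  apply/eqP; rewrite eq_le (cheeger_subae EEO); apply: cheeger_subae.
  by apply: subset_subae; exact: subIsetl.
have EOr : E `&` Omega `<=` cube r by apply: subset_trans Or; exact: subIsetr.
have := hE; rewrite -(fineK Efin).
move=> /(cheeger_function_exists mEO EOr) [w [wi w0 wE w1 wt]].
exists w; split=> //; apply/eqP; rewrite eq_le wt /=.
have tfin : tv w \is a fin_num by rewrite ge0_fin_numE ?tv_ge0//; exact: le_lt_trans wt (ltry _).
have supE : superlevel w 0 `<=` E `&` Omega.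
  by move=> x wx; apply: contrapT => /wE w0x; move: wx; rewrite /superlevel /= w0x ltxx.
have sfin : (lam (superlevel w 0) < +oo)%E.
  apply: le_lt_trans Ofin; apply: le_outer_measure; apply: subset_trans supE _.
  exact: subIsetr.
rewrite fineK// -hE -(fineK tfin).
apply: le_trans (cheeger_superlevel_le wi w0 w1 sfin _); last by rewrite fineK.
exact/cheeger_subae/subset_subae.
Qed.

Lemma Nfunction_of_Nset (E : 'I_N -> set (Ld R d)) : admissible_Nset Omega E ->
  exists u, [/\ is_1N_function Omega u, bracket1 u = (fun i => fine (cheeger (E i))) &
    forall i, subae [set x : Ld R d | 0 < u i x] (E i)].
Proof.
move=> [[Ei Eij] Efin].
have [u hu] := choice (fun i => let: And3 mE EO _ := Ei i in
  cheeger_function_of_subae mE EO (Efin i)).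
exists u; split; last 2 first.
- by apply/funext => i; rewrite /bracket1; have [_ _ _ _ ->] := hu i.
- move=> i; apply: subset_subae => x /= ux; apply: contrapT => Ex.
  by have [_ _ /(_ x) uE _ _] := hu i; move: ux; rewrite uE ?ltxx// => -[].
split.
- move=> i; have [ui _ uE _ ut] := hu i; split; last first.
    by apply: aeW => x Ox; apply: uE => -[].
  split; [exact: itg_measf|exact: ui|].
  by rewrite ut ltey_eq Efin.
- by move=> i x; have [_] := hu i.
- move=> i; have [ui u0 _ u1 _] := hu i.
  rewrite (EFin_integ (f := fun x => `|u i x|)); last exact: itg_norm.
  by congr EFin; rewrite -u1; apply: eq_integ => x; rewrite ger0_norm.
- move=> i j ij; exists (E i `&` E j); split; last 2 first.
  + exact: Eij.
  + move=> x /= ux; have [_ _ /(_ x) ui _ _] := hu i; have [_ _ /(_ x) uj _ _] := hu j.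
    split; apply: contrapT => Ex; apply: ux.
      by rewrite ui ?mul0r// => -[].
    by rewrite uj ?mulr0// => -[].
  + by apply: measurableI; [have [] := Ei i|have [] := Ei j].
Qed.

Lemma Nset_of_Nfunction (u : 'I_N -> V -> R) : is_1N_function Omega u ->
  let E i := [set x : Ld R d | 0 < u i x] in
  admissible_Nset Omega E /\ forall i, (cheeger (E i) <= tv (u i))%E.
Proof.
move=> [uBV u0 u1 uij] E.
have ui i : itg (u i) by have [[]] := uBV i.
have mE i : measurable (E i) by exact: (measurable_superlevel 0 (itg_measf (ui i))).
have null (A B : set (Ld R d)) : lam B = 0%E -> A `<=` B -> lam A = 0%E.
  move=> B0 AB; apply/eqP; rewrite eq_le outer_measure_ge0 andbT -B0.
  exact: le_outer_measure.
have EO i : subae (E i) Omega.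
  have [_ [B [_ B0 uB]]] := uBV i; apply: null B0 _ => x [Ex Ox].
  by apply: uB => /= /(_ Ox) ux; move: Ex; rewrite /E /= ux ltxx.
have Efin i : (lam (E i) < +oo)%E := le_lt_trans (subae_le (EO i)) Ofin.
have I1 i : integ (u i) = 1.
  have := u1 i; rewrite (EFin_integ (f := fun x => `|u i x|)); last exact: itg_norm.
  by move=> [<-]; apply: eq_integ => x; rewrite ger0_norm.
have tfin i : tv (u i) \is a fin_num.
  by rewrite ge0_fin_numE ?tv_ge0//; have [[]] := uBV i.
have hE i : (cheeger (E i) <= tv (u i))%E.
  have := @cheeger_superlevel_le R d (u i) (fine (tv (u i))) (ui i) (u0 i) (I1 i) (Efin i).
  by rewrite fineK//; exact.
split=> //; split; last first.
  move=> i; rewrite ge0_fin_numE; last exact: cheeger_ge0.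
  by apply: le_lt_trans (hE i) _; rewrite ltey_eq tfin.
split=> [i|i j ij].
  split=> //; rewrite lt0e outer_measure_ge0 andbT; apply/eqP => E0.
  have : integ (u i) = integ (fun _ : V => 0).
    apply: ae_eq_integ; [exact: itg_measf|exact: measf_cst|].
    exists (E i); split=> // x /= /eqP ux.
    by rewrite /E /= lt0r ux u0.
  by rewrite I1 integ0 => /eqP; rewrite oner_eq0.
have [B [_ B0 uB]] := uij i j ij; apply: null B0 _ => x [Ex Fx].
by apply: uB => /= /eqP; rewrite gt_eqF// mulr_gt0.
Qed.

End Nsets_and_Nfunctions.

(** * Comparison of the two infima and of their minimizers *)

Unset Implicit Arguments.

Theorem mainTheorem9 (R : realType) (d N : nat) (Omega : set 'rV[R]_d)
    (Phi : ('I_N -> R) -> R) :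
  open Omega -> bounded_set Omega -> Omega !=set0 ->
  (forall v : 'I_N -> R, (forall i, 0 <= v i) -> 0 <= Phi v) ->
  (LambdaPhi Phi (Omega : set (Ld R d)) <= LPhi Phi (Omega : set (Ld R d)))%E /\
  (Phi_monotone Phi ->
   [/\ LPhi Phi (Omega : set (Ld R d)) = LambdaPhi Phi (Omega : set (Ld R d)),
       (forall u : 'I_N -> 'rV[R]_d -> R,
          eigen_Nfunction Phi (Omega : set (Ld R d)) u ->
          eigen_Nset Phi (Omega : set (Ld R d))
            (fun i => [set x : Ld R d | 0 < u i x])) &
       (forall E : 'I_N -> set (Ld R d),
          eigen_Nset Phi (Omega : set (Ld R d)) E ->
          exists u : 'I_N -> 'rV[R]_d -> R,
            eigen_Nfunction Phi (Omega : set (Ld R d)) u /\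
            forall i, subae [set x : Ld R d | 0 < u i x] (E i))]).
Proof.
move=> oO bO _ _.
have [r Or] := bounded_sub_cube bO.
have mO : measurable (Omega : set (Ld R d)).
  exact: (measurable_open_preimage (T := Ld R d) (S := id) (@measurable_coord R d) oO).
have LE : (LambdaPhi Phi (Omega : set (Ld R d)) <= LPhi Phi (Omega : set (Ld R d)))%E.
  apply: le_ereal_inf_tmp => _ [E aE <-].
  (* The variations of [u] equal the Cheeger constants of [E], so [Phi] takes the same value on
     both, whatever [Phi] is. *)
  have [u [uN uE _]] := Nfunction_of_Nset mO Or aE.
  by apply: ereal_inf_lbound; exists u => //; rewrite uE.
split=> // Phi3.
have hPhi u : is_1N_function (Omega : set (Ld R d)) u ->
    ((Phi_h Phi (fun i => [set x : Ld R d | 0 < u i x]))%:E <= (Phi (bracket1 u))%:E)%E.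
  move=> uN; have [aE hE] := Nset_of_Nfunction Or uN.
  rewrite lee_fin; apply: Phi3 => i.
    apply: fine_ge0; apply: cheeger_ge0; have [[/(_ i)[_ EO _] _] _] := aE.
    apply: le_lt_trans (subae_le EO) _.
    by apply: le_lt_trans (le_outer_measure _ _ _ Or) _; exact: cube_lty.
  have [/(_ i)[[_ _ tfin] _] _ _ _] := uN.
  have ci := aE.2 i.
  apply: fine_le => //.
  rewrite fin_numE gt_eqF ?lt_eqF//.
  by apply: lt_le_trans (hE i); rewrite ltNye_eq ci.
have EQ : LPhi Phi (Omega : set (Ld R d)) = LambdaPhi Phi (Omega : set (Ld R d)).
  apply/eqP; rewrite eq_le LE andbT; apply: le_ereal_inf_tmp => _ [u uN <-].
  have [aE _] := Nset_of_Nfunction Or uN.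
  by apply: le_trans (hPhi u uN); apply: ereal_inf_lbound; exists (fun i => [set x : Ld R d | 0 < u i x]).
split=> //.
- move=> u [uN uL]; have [aE _] := Nset_of_Nfunction Or uN.
  split=> //; apply/eqP; rewrite eq_le; apply/andP; split.
    by rewrite EQ -uL; exact: hPhi.
  by apply: ereal_inf_lbound; exists (fun i => [set x : Ld R d | 0 < u i x]).
- move=> E [aE EL]; have [u [uN uE us]] := Nfunction_of_Nset mO Or aE.
  by exists u; split=> //; split=> //; rewrite uE -EQ -EL.
Qed.
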